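(* Let $G$ be a homogeneous group and let $\mu$ be a finite, compactly supported Borel measure on $G$, supported away from the origin (i.e. the group identity $0$ is not in $\operatorname{supp}\mu$) and satisfying the Curvature assumption (CA). Let $\alpha<0$ and $1<p<\infty$. Suppose that there exists a constant $C$, independent of $k\in\mathbb{Z}$ and $f$, such that for all $k\in\mathbb{Z}$ and all $f$ $$\int_G|S[\mu_k]f(x)|^p\,|x|^\alpha\,dx\le C\int_G|f(x)|^p\,|x|^\alpha\,dx .$$ Then there is a constant $C'$ independent of $f$ such that for all $f$ $$\int_G|\mathcal{S}_{lac}[\mu]f(x)|^p\,|x|^\alpha\,dx\le C'\int_G|f(x)|^p\,|x|^\alpha\,dx .$$
   Context: A homogeneous group $G$ is a connected, simply connected nilpotent Lie group whose finite-dimensional real Lie algebra $\mathfrak g$ is endowed with a family of algebra automorphisms $\delta_r=\exp(\Gamma\log r)$, $r>0$, where $\Gamma$ is a diagonalisable linear operator on $\mathfrak g$ with positive eigenvalues. The maps $\exp\circ\,\delta_r\circ\exp^{-1}$ are group automorphisms of $G$, again denoted $\delta_r$ (dilations). $G$ is identified with $\mathbb{R}^n$ via the exponential map, and Haar measure $dx$ with Lebesgue measure; $0$ is the group identity. Fix a homogeneous quasi-norm $|\cdot|:G\to[0,\infty)$: it is continuous, $|x|=0$ iff $x=0$, $|\delta_r x|=r|x|$, and $|x\cdot y|\le c_G(|x|+|y|)$ for some $c_G\ge1$. For a finite compactly supported (nonnegative) Borel measure $\mu$ and $r>0$, the dilate $\mu_r$ is defined by $\langle\mu_r,\phi\rangle=\int_G\phi(\delta_r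 x)\,d\mu(x)$ for $\phi\in C_c(G)$. For $k\in\mathbb{Z}$, in the dyadic notation, $\mu_k$ means the dilate of $\mu$ by $2^k$. The reflection $\tilde\mu$ is defined by $\langle\tilde\mu,\phi\rangle=\int_G\phi(x^{-1})\,d\mu(x)$. For $f\in C_c(G)$ set $$S[\mu]f(x)=f*\mu(x)=\int_G f(x\cdot y^{-1})\,d\mu(y),\qquad \mathcal{S}_{lac}[\mu]f(x)=\sup_{k\in\mathbb{Z}}|S[\mu_k]f(x)|.$$ Weighted estimates for these operators are understood for $f\in C_c(G)$ (and hence, by density, on the weighted Lebesgue space); the right-hand sides may be infinite. Curvature assumption (CA): define iterated convolutions by $\mu^{(1)}=\tilde\mu$, $\mu^{(2k)}=\mu^{(2k-1)}*\mu$ and $\mu^{(2k+1)}=\mu^{(2k)}*\tilde\mu$ for $k\ge1$. The measure $\mu$ satisfies (CA) if there is a natural number $N$ such that $\mu^{(N)}$ is absolutely continuous with respect to Haar measure and there are $\gamma>0$, $C_\mu>0$ such that its Radon–Nikodym derivative $h$ satisfies $$\int_G\big(|h(xy^{-1})-h(x)|+|h(y^{-1}x)-h(x)|\big)\,dx\le C_\mu|y|^\gamma\quad\text{for all }y\in G.$$ *)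

(* Defs.v *)
From HB Require Import structures.
From mathcomp Require Import all_boot all_order all_algebra.
From mathcomp Require Import all_classical all_reals all_analysis.

Set Implicit Arguments.
Unset Strict Implicit.
Unset Printing Implicit Defensive.

Import Order.TTheory GRing.Theory Num.Theory.
Import numFieldNormedType.Exports.

Local Open Scope classical_set_scope.
Local Open Scope ring_scope.

(* Borel sigma-algebra of R^n *)
HB.instance Definition _ (R : realType) (n : nat) :=
  Measurable.copy 'rV[R]_n (g_sigma_algebraType (@open 'rV[R]_n)).

(* n-dimensional Lebesgue measure, as the n-fold product of the one-dimensional
   one. It is a plain set function; only its values on Borel sets matter. *)
Fixpoint lebesgue (R : realType) (n : nat) : set 'rV[R]_n -> \bar R :=
  match n with
  | 0 => \d_(0 : 'rV[R]_0)
  | m.+1 => pushforward (@lebesgue_measure R \x @lebesgue R m)%E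
              (fun p => row_mx p.1%:M p.2 : 'rV[R]_(1 + m))
  end.

Definition expmx (R : realType) (n : nat) (A : 'M[R]_n) : 'M[R]_n :=
  \matrix_(i, j) limn (series (fun k => (A ^+ k) i j / k`!%:R)).

(* exp (Gamma log r); operators act on row vectors from the right *)
Definition dilation_of (R : realType) (n : nat) (Gamma : 'M[R]_n) (r : R)
    (x : 'rV[R]_n) : 'rV[R]_n :=
  x *m expmx (ln r *: Gamma).

Section BakerCampbellHausdorff.
Variables (R : realType) (n : nat) (br : 'rV[R]_n -> 'rV[R]_n -> 'rV[R]_n).

(* [w_1, [w_2, ... [w_(k-1), w_k]]] *)
Fixpoint nested_bracket (w : seq 'rV[R]_n) : 'rV[R]_n :=
  match w with
  | [::] => 0
  | [:: z] => z
  | z :: w' => br z (nested_bracket w')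
  end.

(* Dynkin's formula for log (exp x exp y),
     sum_(m >= 1) (-1)^(m-1) / m  sum_(r_i + s_i > 0)
       [x^(r_1) y^(s_1) ... x^(r_m) y^(s_m)]
         / ((r_1 + s_1 + ... + r_m + s_m) r_1! s_1! ... r_m! s_m!),
   with f i = (r_i, s_i) and m, r_i, s_i <= step: all other terms are brackets
   of more than step elements, hence 0 in a Lie algebra nilpotent of step at
   most step. *)
Definition bch (step : nat) (x y : 'rV[R]_n) : 'rV[R]_n :=
  \sum_(1 <= m < step.+1) ((-1) ^+ m.-1 / m%:R) *:
    \sum_(f : {ffun 'I_m -> 'I_step.+1 * 'I_step.+1} |
            [forall i, (0 < (f i).1 + (f i).2)%N])
      ((\sum_i ((f i).1 + (f i).2)) *
        \prod_i ((f i).1`! * (f i).2`!))%N%:R^-1 *: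
      nested_bracket
        (flatten [seq nseq (f i).1 x ++ nseq (f i).2 y | i <- enum 'I_m]).

End BakerCampbellHausdorff.

(* A homogeneous group in exponential coordinates, for an arbitrary linear
   basis of its Lie algebra: G = g = R^n as sets, exp is the identity map, the
   group law is the Baker-Campbell-Hausdorff product (so that the identity is 0
   and the inverse is the opposite), and Haar measure, which is bi-invariant,
   is Lebesgue measure. The group axioms and the invariance of Lebesgue
   measure follow from the other fields, by standard facts on the
   Baker-Campbell-Hausdorff product of a nilpotent Lie algebra; they are
   recorded as part of the identification of G with R^n and exclude no
   homogeneous group. *)
Record homogeneousGroup (R : realType) (n : nat) := HomogeneousGroup {
  bracket : 'rV[R]_n -> 'rV[R]_n -> 'rV[R]_n ;
  bracket_linearr : forall x, linear (bracket x) ;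
  bracket_linearl : forall y, linear (bracket^~ y) ;
  bracketxx : forall x, bracket x x = 0 ;
  bracket_jacobi : forall x y z, bracket x (bracket y z)
    + bracket y (bracket z x) + bracket z (bracket x y) = 0 ;
  nilstep : nat ;
  bracket_nilpotent : forall w,
    (nilstep < size w)%N -> nested_bracket bracket w = 0 ;

  dilgen : 'M[R]_n ;
  dilgen_diag : diagonalizable dilgen ;
  dilgen_gt0 : forall a, eigenvalue dilgen a -> 0 < a ;
  bracket_dilation : forall r x y, 0 < r ->
    bracket (dilation_of dilgen r x) (dilation_of dilgen r y)
      = dilation_of dilgen r (bracket x y) ;

  gmul : 'rV[R]_n -> 'rV[R]_n -> 'rV[R]_n ;
  gmulE : forall x y, gmul x y = bch bracket nilstep x y ;
  gmulA : associative gmul ;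
  gmul0x : left_id 0 gmul ;
  gmulx0 : right_id 0 gmul ;
  gmulNx : left_inverse 0 -%R gmul ;
  gmulxN : right_inverse 0 -%R gmul ;
  haar_left : forall a (A : set 'rV[R]_n), measurable A ->
    lebesgue (gmul a @^-1` A) = lebesgue A ;
  haar_right : forall a (A : set 'rV[R]_n), measurable A ->
    lebesgue (gmul^~ a @^-1` A) = lebesgue A }.

Definition ginv (R : realType) (n : nat) (G : homogeneousGroup R n)
  (x : 'rV[R]_n) : 'rV[R]_n := - x.

Definition dilation (R : realType) (n : nat) (G : homogeneousGroup R n)
  (r : R) (x : 'rV[R]_n) : 'rV[R]_n := dilation_of (dilgen G) r x.

Record quasiNorm (R : realType) (n : nat) (G : homogeneousGroup R n) :=
  QuasiNorm {
  qnorm :> 'rV[R]_n -> R ;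
  qnorm_ge0 : forall x, 0 <= qnorm x ;
  qnorm_continuous : continuous qnorm ;
  qnorm_eq0 : forall x, qnorm x = 0 <-> x = 0 ;
  qnorm_dilation : forall r x, 0 < r -> qnorm (dilation G r x) = r * qnorm x ;
  qnorm_triangle : exists2 c : R, 1 <= c &
    forall x y, qnorm (gmul G x y) <= c * (qnorm x + qnorm y) }.

Definition msupport (R : realType) (n : nat) (mu : set 'rV[R]_n -> \bar R) :
    set 'rV[R]_n :=
  [set x | forall U : set 'rV[R]_n, open U -> U x -> (0 < mu U)%E].

(* C_c(G) *)
Definition Cc (R : realType) (n : nat) : set ('rV[R]_n -> R) :=
  [set f | continuous f /\ compact (closure [set x | f x != 0])].

Section Operators.
Variables (R : realType) (n : nat) (G : homogeneousGroup R n).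
Implicit Types mu nu : set 'rV[R]_n -> \bar R.

Definition dilate mu (r : R) : set 'rV[R]_n -> \bar R :=
  pushforward mu (dilation G r).

Definition reflection mu : set 'rV[R]_n -> \bar R := pushforward mu (ginv G).

Definition mconv mu nu : set 'rV[R]_n -> \bar R :=
  pushforward (mu \x nu)%E (fun p => gmul G p.1 p.2).

(* iter_mconv mu j is mu^(j+1) *)
Fixpoint iter_mconv mu (j : nat) : set 'rV[R]_n -> \bar R :=
  match j with
  | 0 => reflection mu
  | i.+1 => mconv (iter_mconv mu i) (if odd i then reflection mu else mu)
  end.

Definition curvature_assumption (qn : quasiNorm G) mu : Prop :=
  exists j : nat, iter_mconv mu j `<< @lebesgue R n /\
  exists2 h : 'rV[R]_n -> R,
    measurable_fun setT h /\
    (forall A, measurable A ->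
      iter_mconv mu j A = \int[@lebesgue R n]_(x in A) (h x)%:E)%E &
    exists gamma Cmu : R, [/\ 0 < gamma, 0 < Cmu &
      forall y, (\int[@lebesgue R n]_x
          (`|h (gmul G x (ginv G y)) - h x|
           + `|h (gmul G (ginv G y) x) - h x|)%:E
        <= (Cmu * qn y `^ gamma)%:E)%E].

(* S[mu] f = f * mu *)
Definition average mu (f : 'rV[R]_n -> R) (x : 'rV[R]_n) : R :=
  fine (\int[mu]_y (f (gmul G x (ginv G y)))%:E)%E.

Definition lacunary_maximal mu (f : 'rV[R]_n -> R) (x : 'rV[R]_n) : \bar R :=
  ereal_sup (range (fun k : int => (`|average (dilate mu (2 ^ k)) f x|)%:E)).

End Operators.

(* Main.v *)
(* Write T_k f = f * mu_k. Under (CA), high powers of the self-adjoint operator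
   f -> (f * mu) * mu~ are Hoelder continuous along translations, so T_k decays
   geometrically in L^2 on functions having mean zero on the cells, of size
   2^i < 2^k, of a Christ-type dyadic filtration. A stopping-time argument on
   the averages over these cells turns this into a weak-type estimate losing M in L^1
   and gaining rho^M in L^2; slicing f by its height and choosing M according to
   the height gives sup_k |T_k f| <= C |f| in L^p for every p > 1.

   For the weight, let |x| ~ 2^l. If k < l + L, then T_k f(x) only sees f on a
   ball of radius ~ 2^l; the unweighted bound applies to that piece, and since
   alpha < 0 the weights 2^(l alpha) of the shells whose ball contains y sum
   geometrically to ~ |y|^alpha. If k >= l + L, then, mu being supported away from 0,
   T_k f(x) only sees f at |y| ~ 2^k; there the supremum is bounded by the sum
   over k, the single-scale hypothesis is used term by term, and the pieces of
   f overlap boundedly.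

   The given quasi-norm need not be symmetric; the cells use the comparable
   symmetric one max(|x|, |x^-1|). *)
Require Import Defs.
From HB Require Import structures.
From mathcomp Require Import all_boot all_order all_algebra.
From mathcomp Require Import all_classical all_reals all_analysis measurable_realfun.
From mathcomp Require Import ring lra zify.

Set Implicit Arguments.
Unset Strict Implicit.

Import Order.TTheory GRing.Theory Num.Theory.
Import numFieldNormedType.Exports.

Local Open Scope classical_set_scope.
Local Open Scope ring_scope.

(** The curvature assumption concerns only a high convolution power of [mu], so the decay it yields
    is in L^2; nothing is known about a single f * mu_k near L^1, and the L^2 norm of T_k f itself
    does not decay in k. Hence the splitting, at each scale, into a cell average and a remainder of
    mean zero, with a free gap of M levels between the cells and the averaging scale. The M
    averaging scales just above a stopped cell escape both the exceptional set and the threshold;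
    this is the loss M. As that loss is linear and the gain rho^M exponential, the part of f that is
    2^l times higher than the threshold can be treated with M ~ l. The polynomial loss in l and the
    shrinking share of the threshold allotted to that part are absorbed by 2^(-l (p - 1)), and this
    is where p > 1 is spent. All estimates are made for finitely many scales and for bounded
    functions of bounded support, with constants independent of the number of scales and of the
    smallest one, so that monotone convergence is applied only at the end. Positivity of the
    operators allows |f| in place of f. *)

Section RowVectorMeasurability.
Context {R : realType}.

Lemma measurable_rV_open n (A : set 'rV[R]_n) : open A -> measurable A.
Proof. exact: sub_gen_smallest. Qed.

Lemma measurable_rV_closed n (A : set 'rV[R]_n) : closed A -> measurable A.
Proof.
move=> cA; rewrite -[A]setCK; apply: measurableC.
by apply: measurable_rV_open; rewrite openC.
Qed.

Lemma measurable_fun_continuous n (f : 'rV[R]_n -> R) :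
  continuous f -> measurable_fun setT f.
Proof.
move=> cf; apply: (measurability _ (measurable_realfun.RGenOpens.measurableE R)).
move=> _ [_ [a [b ->] <-]]; rewrite setTI; apply: measurable_rV_open.
by apply: open_comp; [move=> x _; exact: cf|exact: interval_open].
Qed.

Lemma norm_rV_ltP n (x : 'rV[R]_n) (k : R) :
  `|x| < k <-> 0 < k /\ forall j, `|x 0 j| < k.
Proof.
rewrite (_ : `|x| = \big[Num.max/0]_ij `|x ij.1 ij.2|); last exact: mx_normrE.
split; first by move=> /bigmax_ltP[k0 h]; split => // j; exact: (h (0, j)).
by move=> [k0 h]; apply/bigmax_ltP; split => // -[i j] _ /=; rewrite ord1.
Qed.

Lemma norm_rV_leP n (x : 'rV[R]_n) (k : R) :
  `|x| <= k <-> 0 <= k /\ forall j, `|x 0 j| <= k.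
Proof.
rewrite (_ : `|x| = \big[Num.max/0]_ij `|x ij.1 ij.2|); last exact: mx_normrE.
split; first by move=> /bigmax_leP[k0 h]; split => // j; exact: (h (0, j)).
by move=> [k0 h]; apply/bigmax_leP; split => // -[i j] _ /=; rewrite ord1.
Qed.

Lemma rat_ball_rV n (x : 'rV[R]_n) (e : R) : 0 < e ->
  exists q : 'rV[rat]_n, `|x - map_mx ratr q| < e.
Proof.
move=> e0.
have H j : exists q : rat, `|x 0 j - ratr q| < e.
  have b0 : ball (x 0 j) e !=set0 by exists (x 0 j); exact: ballxx.
  have [y [/= qb [r _ rq]]] := @dense_rat R _ b0 (ball_open _ _).
  by exists r; rewrite rq.
have [q hq] := choice H.
exists (\row_j q j); apply/norm_rV_ltP; split => // j.
by rewrite !mxE.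
Qed.

(** An open set is the countable union of the balls with rational centre and radius 1/(k+1) that it
    contains, and in the sup norm such a ball is a finite intersection of conditions on single
    coordinates. *)
Lemma measurable_fun_rVP d (T : measurableType d) n (F : T -> 'rV[R]_n) :
  (forall j, measurable_fun setT (fun t => F t 0 j)) -> measurable_fun setT F.
Proof.
move=> mF; apply: (@measurability _ _ _ _ _ F (@open 'rV[R]_n)) => //.
move=> _ [U oU <-]; rewrite setTI.
pose V (i : 'rV[rat]_n * nat) := map_mx ratr i.1 : 'rV[R]_n.
pose D (i : 'rV[rat]_n * nat) := [set x | `|x - V i| < i.2.+1%:R^-1].
have -> : F @^-1` U = \bigcup_i (F @^-1` [set x | D i x /\ D i `<=` U]).
  apply/seteqP; split => [t Ut|t [i _ [? +]]]; last exact.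
  have /nbhs_ballP [e /= e0 eU] := open_nbhs_nbhs (conj oU Ut).
  have [k ke] : exists k : nat, k.+1%:R^-1 < e / 2.
    have [|k hk] := @ltr_add_invr R 0 (e / 2); first by rewrite divr_gt0.
    by exists k; move: hk; rewrite add0r.
  have k0 : (0 : R) < k.+1%:R^-1 by rewrite invr_gt0.
  have [q hq] := rat_ball_rV (F t) k0.
  exists (q, k) => //=; split => //.
  move=> y; rewrite /D /V /= => hy; apply: eU.
  rewrite mx_norm_ball /ball_ /=.
  rewrite (le_lt_trans (ler_distD (map_mx ratr q) _ _))// (splitr e).
  by rewrite ltrD// ?(lt_trans hq)// distrC (lt_trans hy).
apply: countable_bigcupT_measurable => [|i]; first exact: countableP.
have [DU|nDU] := pselect (D i `<=` U); last first.
  by rewrite (_ : _ @^-1` _ = set0)// -subset0 => t [].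
have -> : F @^-1` [set x | D i x /\ D i `<=` U] =
    \bigcap_(j in [set: 'I_n])
      ((fun t => F t 0 j) @^-1` (ball (V i 0 j) i.2.+1%:R^-1)).
  apply/seteqP; split => [t [/norm_rV_ltP[_ Dt] _] j _ /=|t Ht /=].
    by have := Dt j; rewrite !mxE distrC.
  split => //; apply/norm_rV_ltP; split; first by rewrite invr_gt0.
  by move=> j; have := Ht j I; rewrite /ball /= distrC !mxE.
apply: fin_bigcap_measurable => // j _.
rewrite -[X in measurable X]setTI; apply: mF => //.
by apply: open_measurable; exact: ball_open.
Qed.

Lemma measurable_rV_coord n j : measurable_fun setT (fun x : 'rV[R]_n => x 0 j).
Proof. by apply: measurable_fun_continuous; exact: coord_continuous. Qed.

Lemma measurable_fun_rV_continuous n m (F : 'rV[R]_n -> 'rV[R]_m) :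
  continuous F -> measurable_fun setT F.
Proof.
move=> cF; apply: measurable_fun_rVP => j; apply: measurable_fun_continuous => x.
exact: (cvg_comp _ _ (cF x) (@coord_continuous _ _ _ 0 j (F x))).
Qed.

Lemma measurable_row_mx d (T : measurableType d) n m (f : T -> 'rV[R]_n)
    (g : T -> 'rV[R]_m) : measurable_fun setT f -> measurable_fun setT g ->
  measurable_fun setT (fun t => row_mx (f t) (g t)).
Proof.
move=> mf mg; apply: measurable_fun_rVP => j.
case: (split_ordP j) => i ->.
  under eq_fun do rewrite row_mxEl.
  exact: (measurableT_comp (measurable_rV_coord i)).
under eq_fun do rewrite row_mxEr.
exact: (measurableT_comp (measurable_rV_coord i)).
Qed.

Lemma measurable_fun_scalar_mx : measurable_fun setT (fun r : R => r%:M : 'rV[R]_1).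
Proof.
apply: measurable_fun_rVP => j.
rewrite (_ : (fun _ => _) = id); first exact: measurable_id.
by apply/funext => r; rewrite mxE ord1 eqxx mulr1n.
Qed.

End RowVectorMeasurability.

Section MeasurePacking.
Context d (T : measurableType d) (R : realType) (m : {measure set T -> \bar R}).

(** The proof is an argument of the set function, so that the head constant carries it and a measure
    built inside a proof can receive the structure that Fubini's theorem or [haar_unique] asks
    for. *)
Definition sigma_finite_pack & sigma_finite setT m : set T -> \bar R := m.
Definition finite_pack & fin_num_fun m : set T -> \bar R := m.

Variables (sm : sigma_finite setT m) (fm : fin_num_fun m).

HB.instance Definition _ := Measure.on (sigma_finite_pack sm).
HB.instance Definition _ :=
  Measure_isSigmaFinite.Build _ _ _ (sigma_finite_pack sm) sm.

HB.instance Definition _ := Measure.on (finite_pack fm).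
HB.instance Definition _ := Measure_isFinite.Build _ _ _ (finite_pack fm) fm.

End MeasurePacking.

Lemma bounded_integrable d (T : measurableType d) (R : realType)
    (m : {finite_measure set T -> \bar R}) (h : T -> R) (M : R) :
  measurable_fun setT h -> (forall y, `|h y| <= M) -> m.-integrable setT (EFin \o h).
Proof.
move=> mh hM; apply: measurable_bounded_integrable => //.
  by rewrite -ge0_fin_numE// fin_num_measure.
by exists M; split; [exact: num_real|move=> N MN y _; exact: le_trans (hM y) (ltW MN)].
Qed.

(** * Lebesgue measure on R^n as a sigma-finite measure *)

Section LebesgueMeasure.
Context {R : realType}.

Definition row_cons m (p : R * 'rV[R]_m) : 'rV[R]_(1 + m) := row_mx p.1%:M p.2.

Lemma measurable_row_cons m : measurable_fun setT (@row_cons m).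
Proof.
apply: measurable_row_mx.
  by apply: measurableT_comp; [exact: measurable_fun_scalar_mx|exact: measurable_fst].
exact: measurable_snd.
Qed.

Lemma norm_row_cons m (p : R * 'rV[R]_m) (k : R) :
  `|row_cons p| <= k <-> `|p.1| <= k /\ `|p.2| <= k.
Proof.
rewrite !norm_rV_leP; split.
  move=> [k0 h]; split; last split => //.
    have := h (lshift _ 0); rewrite /row_cons row_mxEl mxE eqxx mulr1n; exact.
  by move=> j; have := h (rshift _ j); rewrite /row_cons row_mxEr.
move=> [h1 [k0 h2]]; split => // j; rewrite /row_cons.
case: (split_ordP j) => i ->; last by rewrite row_mxEr.
by rewrite row_mxEl mxE ord1 eqxx mulr1n.
Qed.

Lemma measurable_norm_ball n (k : R) : measurable [set x : 'rV[R]_n | `|x| <= k].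
Proof.
apply: measurable_rV_closed.
apply: (@closed_comp _ _ (fun x : 'rV[R]_n => `|x|) [set y | y <= k]).
  by move=> x _; exact: norm_continuous.
exact: closed_le.
Qed.

Lemma norm_balls_cover n : \bigcup_(k : nat) [set x : 'rV[R]_n | `|x| <= k%:R] = setT.
Proof.
apply/seteqP; split => // x _; exists (Num.truncn `|x|).+1 => //=.
by rewrite ltW// truncnS_gt.
Qed.

(** The induction has to carry sigma-finiteness, since the product with one more line needs it of
    the second factor. Finiteness on norm balls is carried too, because the balls are the exhausting
    sequence at the next step. *)
Lemma lebesgue_sigma_measure n : {m : {sigma_finite_measure set 'rV[R]_n -> \bar R} |
  (m : set _ -> \bar R) = @lebesgue R n & forall k : R, (m [set x | (`|x| <= k)%R] < +oo)%E}.
Proof.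
elim: n => [|n [m mE mk]].
  exists (@dirac _ _ (0 : 'rV[R]_0) R) => // k.
  by rewrite /dirac ltry.
pose f := @row_cons n.
have mf : measurable_fun setT f := @measurable_row_cons n.
pose M : {measure set 'rV[R]_(1 + n) -> \bar R} :=
  measure_function_pushforward__canonical__measure_function_Measure
    (@lebesgue_measure R \x m)%E mf.
have Mfin (k : R) : (M [set x | (`|x| <= k)%R] < +oo)%E.
  rewrite /M /= /pushforward.
  have -> : f @^-1` [set x | `|x| <= k] = `[- k, k]%classic `*` [set x | `|x| <= k].
    apply/seteqP; split => [p /=|p /= [h1 h2]].
      by move/norm_row_cons => [h1 h2]; split => //=; rewrite in_itv/= -ler_norml.
    by apply/norm_row_cons; split => //; move: h1; rewrite in_itv/= ler_norml.
  rewrite product_measure1E//; last exact: measurable_norm_ball.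
  apply: lte_mul_pinfty => //.
    rewrite ge0_fin_numE//; have /= -> := lebesgue_measure_itv `[- k, k].
    by case: ifP => // _; rewrite -EFinB ltry.
have Msf : sigma_finite setT M.
  exists (fun k : nat => [set x | `|x| <= k%:R]); first by rewrite norm_balls_cover.
  by move=> k; split; [exact: measurable_norm_ball|exact: Mfin].
exists (sigma_finite_pack Msf) => //=.
by rewrite /sigma_finite_pack /M /= mE.
Qed.

Lemma lebesgue0 n : @lebesgue R n set0 = 0%E.
Proof. by case: (lebesgue_sigma_measure n) => m <- _; exact: measure0. Qed.

Lemma lebesgue_ge0 n A : (0 <= @lebesgue R n A)%E.
Proof. by case: (lebesgue_sigma_measure n) => m <- _; exact: measure_ge0. Qed.

Lemma lebesgue_semi_sigma_additive n : semi_sigma_additive (@lebesgue R n).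
Proof.
case: (lebesgue_sigma_measure n) => m <- _; exact: measure_semi_sigma_additive.
Qed.

HB.instance Definition _ n := isMeasure.Build _ _ _ (@lebesgue R n)
  (lebesgue0 n) (@lebesgue_ge0 n) (@lebesgue_semi_sigma_additive n).

Lemma lebesgue_sigma_finite n : sigma_finite setT (@lebesgue R n).
Proof. case: (lebesgue_sigma_measure n) => m <- _; exact: sigma_finiteT. Qed.

HB.instance Definition _ n := Measure_isSigmaFinite.Build _ _ _ (@lebesgue R n)
  (@lebesgue_sigma_finite n).

Lemma lebesgue_norm_ball_fin n (k : R) : (@lebesgue R n [set x | (`|x| <= k)%R] < +oo)%E.
Proof. by case: (lebesgue_sigma_measure n) => m <-. Qed.

Lemma lebesgue_setT_gt0 n : (0 < @lebesgue R n setT)%E.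
Proof.
elim: n => [|n IH].
  by rewrite /= diracT lte01.
rewrite /= /pushforward preimage_setT -setXTT.
case: (lebesgue_sigma_measure n) => m mE _; rewrite -mE product_measure1E//.
rewrite mule_gt0//; last by rewrite mE.
have := lebesgue_measure_itv (`]-oo, +oo[ : interval R); rewrite /= set_itvNyy => ->.
by rewrite /= ltry.
Qed.

End LebesgueMeasure.

Section PowerBounds.
Context {R : realType}.
Implicit Types x a : R.

Lemma powR1l a : 1 `^ a = 1 :> R.
Proof. by rewrite powR1. Qed.

Lemma powR_le1 x a : 0 <= x -> x <= 1 -> 0 <= a -> x `^ a <= 1.
Proof. by move=> x0 x1 a0; rewrite -[leRHS](powR1l a) ge0_ler_powR// nnegrE. Qed.

Lemma powR_ge1 x a : 1 <= x -> 0 <= a -> 1 <= x `^ a.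
Proof.
move=> x1 a0; rewrite -[leLHS](powR1l a) ge0_ler_powR// nnegrE//.
exact: le_trans x1.
Qed.

Lemma powR_lt1 x a : 0 <= x -> x < 1 -> 0 < a -> x `^ a < 1.
Proof. by move=> x0 x1 a0; rewrite -[ltRHS](powR1l a) gt0_ltr_powR// nnegrE. Qed.

Lemma small_expr (t e : R) : 0 <= t -> t < 1 -> 0 < e -> exists i, t ^+ i < e.
Proof.
move=> t0 t1 e0.
have /cvgrPdist_lt/(_ e e0)[i _ hi] : (GRing.exp t @ \oo) --> (0 : R).
  by apply: cvg_expr; rewrite ger0_norm.
by exists i; have := hi i (leqnn i); rewrite sub0r normrN ger0_norm// exprn_ge0.
Qed.

End PowerBounds.

(** * The dilations exp(Gamma log r) in an eigenbasis *)

Section MatrixExponential.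
Context {R : realType} {n : nat}.
Implicit Types (x : 'rV[R]_n) (Gamma P : 'M[R]_n).

Lemma norm_rV_coord x j : `|x 0 j| <= `|x|.
Proof. by have /norm_rV_leP[_] := lexx `|x|; exact. Qed.

Lemma norm_rV_mulmx m (M : 'M[R]_(n, m)) : exists2 C : R, 0 <= C &
  forall x, `|x *m M| <= C * `|x|.
Proof.
exists (\sum_i \sum_j `|M i j|); first by rewrite !sumr_ge0// => i _; exact: sumr_ge0.
move=> x; apply/norm_rV_leP; split.
  by rewrite mulr_ge0// !sumr_ge0// => i _; exact: sumr_ge0.
move=> j; rewrite mxE (le_trans (ler_norm_sum _ _ _))// mulr_suml ler_sum// => i _.
rewrite normrM mulrC ler_pM ?norm_rV_coord//.
by rewrite (bigD1 j)//= lerDl sumr_ge0.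
Qed.

(** Conjugation makes every power of [Gamma] diagonal, so each entry of the matrix series is a fixed
    finite linear combination of scalar exponential series. *)
Lemma expmx_similar Gamma P (D : 'rV[R]_n) (s : R) : P \in unitmx ->
  Gamma = invmx P *m diag_mx D *m P ->
  expmx (s *: Gamma) = invmx P *m diag_mx (\row_l expR (s * D 0 l)) *m P.
Proof.
move=> Pu GE.
have sGE : s *: Gamma = invmx P *m diag_mx (s *: D) *m P.
  rewrite GE; apply/matrixP => i j; rewrite mxE [in LHS]mxE [RHS]mxE mulr_sumr.
  apply: eq_bigr => l _; rewrite !mul_mx_diag mxE [in RHS]mxE [in RHS]mxE.
  by rewrite mulrA [in RHS]mulrCA.
have powE k : (s *: Gamma) ^+ k =
    invmx P *m diag_mx (\row_l (s * D 0 l) ^+ k) *m P.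
  elim: k => [|k IH].
    rewrite expr0 (_ : diag_mx _ = 1%:M) ?mulmx1 ?mulVmx//.
    by apply/matrixP => i j; rewrite !mxE expr0.
  rewrite exprSr IH sGE -[LHS]/(_ *m _) -!mulmxA mulKVmx//.
  congr (_ *m _); rewrite mulmxA mulmx_diag; congr (diag_mx _ *m _).
  by apply/rowP => l; rewrite !mxE exprSr.
apply/matrixP => i j; rewrite /expmx mxE.
rewrite !mxE.
under eq_bigr do rewrite mul_mx_diag !mxE.
apply/cvg_lim => //.
have -> : series (fun k => ((s *: Gamma) ^+ k) i j / k`!%:R) =
    (fun N => \sum_l (invmx P i l * P l j) * series (exp_coeff (s * D 0 l)) N).
  apply/funext => N; rewrite /series /=.
  under [RHS]eq_bigr do rewrite mulr_sumr.
  rewrite exchange_big /=; apply: eq_bigr => k _.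
  rewrite powE mxE mulr_suml; apply: eq_bigr => l _.
  rewrite mul_mx_diag mxE [X in _ * X * _]mxE /exp_coeff /= !mulrA.
  by congr (_ / _); rewrite mulrAC.
have -> : \sum_l invmx P i l * expR (s * D 0 l) * P l j =
    \sum_l (invmx P i l * P l j) * expR (s * D 0 l).
  by apply: eq_bigr => l _; rewrite mulrAC.
elim: (index_enum _) => [|l ls IH].
  under eq_fun do rewrite big_nil.
  by rewrite big_nil; exact: cvg_cst.
under eq_fun do rewrite big_cons.
rewrite big_cons; apply: cvgD => //; apply: cvgMr.
exact: is_cvg_series_exp_coeff.
Qed.

End MatrixExponential.

Section Dilations.
Context {R : realType} {n : nat} (G : homogeneousGroup R n).
Notation V := 'rV[R]_n.
Implicit Types (x y z : V) (r s : R).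

(** [D] lists the eigenvalues of the generator. Multiplicativity in r and the growth bounds below
    are read off from this form. *)
Lemma dilation_diag : exists P (D : V), [/\ P \in unitmx, forall l, 0 < D 0 l &
  forall r x, 0 < r -> dilation G r x =
    x *m (invmx P *m diag_mx (\row_l (r `^ D 0 l)) *m P)].
Proof.
have [P Pu /(similar_diagLR Pu)[D GE]] := dilgen_diag G.
exists P, D; split => // [l|r x r0].
  apply: (@dilgen_gt0 _ _ G); apply/eigenvalueP; exists (row l P).
    rewrite GE conjVmx// !mulmxA -row_mul mulmxV// row1.
    by rewrite -[_ *m diag_mx D]rowE row_diag_mx -scalemxAl -rowE.
  apply/eqP => P0; have : row l P *m invmx P = 0 by rewrite P0 mul0mx.
  rewrite -row_mul mulmxV// => /rowP/(_ l); rewrite !mxE eqxx => /eqP.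
  by rewrite oner_eq0.
rewrite /dilation /dilation_of (expmx_similar _ Pu (D := D)) ?GE ?conjVmx//.
congr (_ *m (_ *m diag_mx _ *m _)); apply/rowP => l; rewrite !mxE.
by rewrite /powR gt_eqF// mulrC.
Qed.

Lemma dilation_linear r : linear (dilation G r).
Proof. by move=> a x y; rewrite /dilation /dilation_of mulmxDl -scalemxAl. Qed.

Lemma dilation0 r : dilation G r 0 = 0.
Proof. by rewrite /dilation /dilation_of mul0mx. Qed.

Lemma dilationN r x : dilation G r (- x) = - dilation G r x.
Proof. by rewrite /dilation /dilation_of mulNmx. Qed.

Lemma dilationM r s x : 0 < r -> 0 < s ->
  dilation G r (dilation G s x) = dilation G (r * s) x.
Proof.
move=> r0 s0; have [P [D [Pu _ dE]]] := dilation_diag.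
rewrite (dE _ _ r0) (dE _ _ s0) (dE _ _ (mulr_gt0 r0 s0)) -mulmxA; congr (_ *m _).
rewrite -!mulmxA mulKVmx//; congr (_ *m _); rewrite mulmxA; congr (_ *m _).
rewrite mulmx_diag; congr diag_mx; apply/rowP => l; rewrite !mxE.
by rewrite mulrC powRM// ltW.
Qed.

Lemma dilation1 x : dilation G 1 x = x.
Proof.
have [P [D [Pu _ dE]]] := dilation_diag.
rewrite dE// (_ : diag_mx _ = 1%:M) ?mulmx1 ?mulVmx ?mulmx1//.
by apply/matrixP => i j; rewrite !mxE powR1.
Qed.

Lemma dilationK r : 0 < r -> cancel (dilation G r) (dilation G r^-1).
Proof. by move=> r0 x; rewrite dilationM ?invr_gt0// mulVf ?gt_eqF// dilation1. Qed.

Lemma dilationVK r : 0 < r -> cancel (dilation G r^-1) (dilation G r).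
Proof. by move=> r0 x; rewrite dilationM ?invr_gt0// mulfV ?gt_eqF// dilation1. Qed.

Lemma dilation_norm_le : exists2 C : R, 0 < C & exists a b : R,
  [/\ 0 < a, 0 < b,
      forall r x, 0 < r <= 1 -> `|dilation G r x| <= C * r `^ a * `|x| &
      forall r x, 1 <= r -> `|dilation G r x| <= C * r `^ b * `|x|].
Proof.
have [P [D [Pu D0 dE]]] := dilation_diag.
have [C1 C10 hC1] := norm_rV_mulmx (invmx P).
have [C2 C20 hC2] := norm_rV_mulmx P.
have main r t x : 0 < r -> (forall l, r `^ D 0 l <= t) -> 0 <= t ->
    `|dilation G r x| <= (C1 * C2 + 1) * t * `|x|.
  move=> r0 rt t0; rewrite dE// !mulmxA.
  apply: (le_trans (hC2 _)).
  have : `|x *m invmx P *m diag_mx (\row_l r `^ D 0 l)| <= t * (C1 * `|x|).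
    apply/norm_rV_leP; split; first by rewrite !mulr_ge0.
    move=> j; rewrite mul_mx_diag !mxE normrM mulrC ler_pM//.
      by rewrite ger0_norm ?powR_ge0.
    have := norm_rV_coord (x *m invmx P) j; rewrite mxE => /le_trans; exact.
  move=> /(ler_wpM2l C20)/le_trans; apply.
  rewrite mulrDl mul1r mulrDl -[leLHS]addr0 lerD ?mulr_ge0//.
  by rewrite le_eqVlt; apply/orP; left; apply/eqP; ring.
exists (C1 * C2 + 1); first by rewrite ltr_wpDl ?mulr_ge0.
(* The smallest and the largest eigenvalue. The default 1 keeps both exponents positive when n = 0;
   otherwise including it only weakens the two bounds. *)
exists (\big[Num.min/1]_l D 0 l), (\big[Num.max/1]_l D 0 l).
split.
- by apply: lt_bigmin => //.
- by apply: (lt_le_trans ltr01); exact: bigmax_ge_id.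
- move=> r x /andP[r0 r1]; apply: main => //; last exact: powR_ge0.
  by move=> l; apply: ger_powR; rewrite ?r0// bigmin_le_cond.
- move=> r x r1; apply: main; rewrite ?(lt_le_trans ltr01)//; last exact: powR_ge0.
  by move=> l; apply: ler_powR => //; exact: le_bigmax.
Qed.

End Dilations.

(** * The Baker-Campbell-Hausdorff product: local Lipschitz bounds and dilations *)

Section GroupLaw.
Context {R : realType} {n : nat} (G : homogeneousGroup R n).
Notation V := 'rV[R]_n.
Implicit Types (x y z : V) (r s : R).

Lemma bracket0r x : bracket G x 0 = 0.
Proof.
have := bracket_linearr G x (-1) 0 0; rewrite scaler0 add0r => ->.
by rewrite scaleN1r addNr.
Qed.

Lemma bracket0l y : bracket G 0 y = 0.
Proof.
have := bracket_linearl G y (-1) 0 0; rewrite scaler0 add0r => ->.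
by rewrite scaleN1r addNr.
Qed.

Lemma bracket_sumr (I : Type) (s : seq I) x (c : I -> R) (u : I -> V) :
  bracket G x (\sum_(i <- s) c i *: u i) = \sum_(i <- s) c i *: bracket G x (u i).
Proof.
elim: s => [|i s IH]; first by rewrite !big_nil bracket0r.
by rewrite !big_cons bracket_linearr IH.
Qed.

Lemma bracket_suml (I : Type) (s : seq I) y (c : I -> R) (u : I -> V) :
  bracket G (\sum_(i <- s) c i *: u i) y = \sum_(i <- s) c i *: bracket G (u i) y.
Proof.
elim: s => [|i s IH]; first by rewrite !big_nil bracket0l.
rewrite !big_cons -IH; exact: (bracket_linearl G y).
Qed.

Lemma bracket_norm_le : exists2 K : R, 0 <= K &
  forall x y, `|bracket G x y| <= K * `|x| * `|y|.
Proof.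
pose e (i : 'I_n) : V := delta_mx 0 i.
exists (\sum_i \sum_j `|bracket G (e i) (e j)|).
  by rewrite sumr_ge0// => i _; exact: sumr_ge0.
move=> x y; rewrite [x in bracket G x]row_sum_delta bracket_suml.
rewrite (le_trans (ler_norm_sum _ _ _))// !mulr_suml ler_sum// => i _.
rewrite normrZ [y in bracket G _ y]row_sum_delta bracket_sumr.
rewrite -mulrA mulrCA ler_pM ?norm_rV_coord//.
rewrite (le_trans (ler_norm_sum _ _ _))// mulr_suml ler_sum// => j _.
by rewrite normrZ mulrC ler_wpM2l ?norm_rV_coord.
Qed.

(** A rate is wanted and not only continuity: the Lipschitz constants of the group law become the
    Hoelder bound for conjugation in [qnorm_conj_le]. *)
Definition locally_lipschitz (F : V -> V -> V) := forall rho : R,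
  exists2 L : R, 0 <= L & forall x x' y y',
    `|x| <= rho -> `|x'| <= rho -> `|y| <= rho -> `|y'| <= rho ->
    `|F x y - F x' y'| <= L * (`|x - x'| + `|y - y'|).

Lemma locally_lipschitz_bound F rho : locally_lipschitz F -> 0 <= rho ->
  exists2 M : R, 0 <= M & forall x y, `|x| <= rho -> `|y| <= rho -> `|F x y| <= M.
Proof.
move=> /(_ rho)[L L0 hL] rho0.
exists (`|F 0 0| + L * (rho + rho)); first by rewrite addr_ge0// mulr_ge0// addr_ge0.
move=> x y xr yr.
have := hL x 0 y 0 xr; rewrite normr0 !subr0 => /(_ rho0 yr rho0) h.
rewrite -[F x y](subrK (F 0 0)) (le_trans (ler_normD _ _))// addrC lerD2l.
by rewrite (le_trans h)// ler_wpM2l// lerD.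
Qed.

Lemma locally_lipschitz_sum (I : Type) (s : seq I) (P : pred I) F :
  (forall i, locally_lipschitz (F i)) ->
  locally_lipschitz (fun x y => \sum_(i <- s | P i) F i x y).
Proof.
move=> hF rho; elim: s => [|i s [L L0 IH]].
  by exists 0 => // x x' y y' *; rewrite !big_nil subrr normr0 mul0r.
have [L' L'0 hL'] := hF i rho.
exists (L' + L); first exact: addr_ge0.
move=> x x' y y' h1 h2 h3 h4; rewrite !big_cons; case: (P i); last first.
  rewrite (le_trans (IH _ _ _ _ h1 h2 h3 h4))// ler_wpM2r ?addr_ge0//.
  by rewrite lerDr.
rewrite opprD addrACA (le_trans (ler_normD _ _))// mulrDl lerD//.
  exact: hL'.
exact: IH.
Qed.

Lemma locally_lipschitz_scale c F : locally_lipschitz F ->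
  locally_lipschitz (fun x y => c *: F x y).
Proof.
move=> hF rho; have [L L0 hL] := hF rho.
exists (`|c| * L); first by rewrite mulr_ge0.
move=> x x' y y' h1 h2 h3 h4; rewrite -scalerBr normrZ -mulrA ler_wpM2l//.
exact: hL.
Qed.

Lemma locally_lipschitz_bracket E F : locally_lipschitz E ->
  locally_lipschitz F -> locally_lipschitz (fun x y => bracket G (E x y) (F x y)).
Proof.
move=> hE hF rho.
have [rho0|rho0] := ltP rho 0.
  exists 0 => // x x' y y' h; have := le_lt_trans (le_trans (normr_ge0 _) h) rho0.
  by rewrite ltxx.
have [K K0 hK] := bracket_norm_le.
have [A A0 hA] := hE rho; have [B B0 hB] := hF rho.
have [M M0 hM] := locally_lipschitz_bound hE rho0.
have [N N0 hN] := locally_lipschitz_bound hF rho0.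
exists (K * A * N + K * M * B); first by rewrite addr_ge0// !mulr_ge0.
move=> x x' y y' h1 h2 h3 h4.
have -> : bracket G (E x y) (F x y) - bracket G (E x' y') (F x' y') =
    bracket G (E x y - E x' y') (F x y) + bracket G (E x' y') (F x y - F x' y').
  have := bracket_linearl G (F x y) (-1) (E x' y') (E x y).
  have := bracket_linearr G (E x' y') (-1) (F x' y') (F x y).
  rewrite !scaleN1r ![- _ + _]addrC => -> ->.
  by rewrite addrA subrK.
rewrite (le_trans (ler_normD _ _))// mulrDl lerD//.
  rewrite (le_trans (hK _ _))// -!mulrA ler_wpM2l//.
  by rewrite mulrCA mulrC ler_pM ?hN// hA.
rewrite (le_trans (hK _ _))// -!mulrA ler_wpM2l//.
by rewrite ler_pM ?hM// hB.
Qed.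

(** A bracket monomial in x and y is encoded by a word of booleans that does not depend on x and y,
    so one induction on words treats all terms of Dynkin's sum. *)
Lemma locally_lipschitz_nested (bs : seq bool) :
  locally_lipschitz (fun x y =>
    nested_bracket (bracket G) [seq (if b then x else y) | b : bool <- bs]).
Proof.
elim: bs => [|b bs IH].
  by move=> rho; exists 0 => // *; rewrite /= subrr normr0 mul0r.
have hb : locally_lipschitz (fun x y => if b then x else y).
  move=> rho; exists 1 => // x x' y y' _ _ _ _; rewrite mul1r.
  by case: b; rewrite ?lerDl ?lerDr.
case: bs IH => [|b' bs] IH //=.
exact: locally_lipschitz_bracket.
Qed.

Lemma locally_lipschitz_gmul : locally_lipschitz (gmul G).
Proof.
have -> : gmul G = bch (bracket G) (nilstep G).
  by apply/funext => x; apply/funext => y; rewrite gmulE.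
apply: locally_lipschitz_sum => m; apply: locally_lipschitz_scale.
apply: locally_lipschitz_sum => f; apply: locally_lipschitz_scale.
pose bs := flatten [seq nseq (f i).1 true ++ nseq (f i).2 false | i <- enum 'I_m].
have := locally_lipschitz_nested bs; congr locally_lipschitz.
apply/funext => x; apply/funext => y; congr nested_bracket.
rewrite /bs map_flatten -map_comp; congr flatten; apply: eq_map => i /=.
by rewrite map_cat !map_nseq.
Qed.

Lemma nested_bracket_dilation r w : 0 < r ->
  nested_bracket (bracket G) (map (dilation G r) w) =
  dilation G r (nested_bracket (bracket G) w).
Proof.
move=> r0; elim: w => [|z [|z' w] IH] //=; first by rewrite dilation0.
transitivity (bracket G (dilation G r z) (dilation G r
  (nested_bracket (bracket G) (z' :: w)))); first by rewrite -IH.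
exact: bracket_dilation.
Qed.

(** The product is a fixed linear combination of iterated brackets of x and y, and a linear
    automorphism of the Lie algebra passes through each bracket letter by letter. *)
Lemma dilation_gmul r x y : 0 < r ->
  dilation G r (gmul G x y) = gmul G (dilation G r x) (dilation G r y).
Proof.
move=> r0.
have dS (I : Type) (s : seq I) (P : pred I) (c : I -> R) (u : I -> V) :
    dilation G r (\sum_(i <- s | P i) c i *: u i) =
    \sum_(i <- s | P i) c i *: dilation G r (u i).
  elim: s => [|i s IH]; first by rewrite !big_nil dilation0.
  by rewrite !big_cons; case: (P i); rewrite ?IH// dilation_linear IH.
rewrite !gmulE /bch dS; apply: eq_bigr => m _; congr (_ *: _).
rewrite dS; apply: eq_bigr => f _; congr (_ *: _).
rewrite -nested_bracket_dilation//; congr nested_bracket.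
rewrite map_flatten -map_comp; congr flatten; apply: eq_map => i /=.
by rewrite map_cat !map_nseq.
Qed.

Lemma gmulVK x : cancel (gmul G (- x)) (gmul G x).
Proof. by move=> y; rewrite gmulA gmulxN gmul0x. Qed.

Lemma gmulKV x : cancel (gmul G x) (gmul G (- x)).
Proof. by move=> y; rewrite gmulA gmulNx gmul0x. Qed.

Lemma gmulK x : cancel (gmul G ^~ x) (gmul G ^~ (- x)).
Proof. by move=> y; rewrite -gmulA gmulxN gmulx0. Qed.

Lemma gmulNK x : cancel (gmul G ^~ (- x)) (gmul G ^~ x).
Proof. by move=> y; rewrite -gmulA gmulNx gmulx0. Qed.

Lemma gmulN x y : - gmul G x y = gmul G (- y) (- x).
Proof.
rewrite -[RHS](gmulKV (gmul G x y)) (gmulA G (gmul G x y)) -(gmulA G x y).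
by rewrite gmulxN gmulx0 gmulxN gmulx0.
Qed.

End GroupLaw.

(** * The quasi-norm compared with the norm of R^n *)

Section QuasiNorm.
Context {R : realType} {n : nat} (G : homogeneousGroup R n) (q : quasiNorm G).
Notation V := 'rV[R]_n.
Implicit Types (x y z : V) (r s : R).

Lemma qnorm0 : q 0 = 0.
Proof. exact/(qnorm_eq0 q). Qed.

Lemma qnorm_gt0 x : x != 0 -> 0 < q x.
Proof.
move=> /eqP x0; rewrite lt_neqAle qnorm_ge0 andbT eq_sym.
by apply/eqP => /(qnorm_eq0 q).
Qed.

Lemma compact_norm_annulus (a b : R) : compact [set x : V | a <= `|x| <= b].
Proof.
apply: bounded_closed_compact.
  by exists b; split; [exact: num_real|move=> c bc x /= /andP[_ xb]; rewrite (le_trans xb)// ltW].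
have -> : [set x : V | a <= `|x| <= b] = [set x | a <= `|x|] `&` [set x | `|x| <= b].
  by apply/seteqP; split => x /=; [move=> /andP[]|move=> [-> ->]].
apply: closedI.
  apply: (@closed_comp _ _ (fun x : V => `|x|) [set y | a <= y]); last exact: closed_ge.
  by move=> x _; exact: norm_continuous.
apply: (@closed_comp _ _ (fun x : V => `|x|) [set y | y <= b]); last exact: closed_le.
by move=> x _; exact: norm_continuous.
Qed.

Lemma qnorm_ub (rho : R) : exists2 M : R, 0 < M & forall x, `|x| <= rho -> q x <= M.
Proof.
have [rho0|rho0] := ltP rho 0.
  exists 1 => // x xr; exfalso.
  by have := le_lt_trans (le_trans (normr_ge0 x) xr) rho0; rewrite ltxx.
have [|||c _ hc] := @EVT_max_rV R n q [set x | 0 <= `|x| <= rho].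
- by exists 0 => /=; rewrite normr0 lexx.
- exact: compact_norm_annulus.
- by apply: continuous_subspaceT; exact: qnorm_continuous.
exists (q c + 1); first by rewrite ltr_wpDl// qnorm_ge0.
by move=> x xr; rewrite ler_wpDr// hc// inE /= normr_ge0.
Qed.

Lemma qnorm_lb (a b : R) : 0 < a ->
  exists2 m : R, 0 < m & forall x, a <= `|x| <= b -> m <= q x.
Proof.
move=> a0; have [[x0 hx0]|ne] := pselect (exists x : V, a <= `|x| <= b); last first.
  by exists 1 => // x hx; exfalso; apply: ne; exists x.
have [|||c hc hm] := @EVT_min_rV R n q [set x | a <= `|x| <= b].
- by exists x0.
- exact: compact_norm_annulus.
- by apply: continuous_subspaceT; exact: qnorm_continuous.
exists (q c); last by move=> x hx; apply: hm; rewrite inE.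
apply: qnorm_gt0; rewrite -normr_gt0; move: hc; rewrite inE /= => /andP[h _].
exact: lt_le_trans h.
Qed.

(** Dilations by 1/2 bring u into the unit ball. One step shrinks the norm by at most the factor
    [k], so the first iterate inside lies in the annulus between k and 1, where compactness bounds
    the quasi-norm below by [m]. Homogeneity then limits the number of steps in terms of rho / m. *)
Lemma qnorm_proper (rho : R) : exists2 M : R, 0 < M & forall x, q x <= rho -> `|x| <= M.
Proof.
have [C C0 [a [b [a0 b0 hs hl]]]] := dilation_norm_le G.
pose k := (C * 2 `^ b)^-1.
have C2 : 0 < C * 2 `^ b by rewrite mulr_gt0// powR_gt0.
have k0 : 0 < k by rewrite invr_gt0.
have hk x : k * `|x| <= `|dilation G 2^-1 x|.
  rewrite /k mulrC ler_pdivrMr// mulrC -[x in leLHS](@dilationVK _ _ G 2)//.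
  by apply: hl; rewrite ler1n.
have [m m0 hm] := qnorm_lb 1 k0.
exists (1 + C * (`|rho| / m) `^ b).
  by rewrite ltr_wpDr// mulr_ge0 ?powR_ge0 ?ltW.
move=> u qu.
pose d i := dilation G (2^-1 ^+ i) u.
have dS i : d i.+1 = dilation G 2^-1 (d i).
  by rewrite /d dilationM ?invr_gt0 ?exprn_gt0 ?invr_gt0// exprS.
have ex : exists i, `|d i| <= 1.
  have t1 : (2^-1 : R) `^ a < 1.
    by rewrite powR_lt1 ?invr_ge0 ?invf_lt1 ?ltr1n.
  have u0 : 0 < C * `|u| + 1 by rewrite ltr_wpDl// mulr_ge0// ltW.
  have ui : 0 < (C * `|u| + 1)^-1 by rewrite invr_gt0.
  have [i hi] := small_expr (powR_ge0 _ _) t1 ui.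
  exists i; rewrite (le_trans (hs _ _ _))//.
    by rewrite exprn_gt0 ?invr_gt0// exprn_ile1// ?invr_ge0// invf_le1// ler1n.
  rewrite -powR_mulrn ?invr_ge0// powRAC powR_mulrn ?powR_ge0//.
  move: hi => /ltW.
  rewrite -[X in _ <= X]mul1r ler_pdivlMr// => /(le_trans _); apply.
  rewrite mulrAC mulrC ler_wpM2l ?exprn_ge0 ?powR_ge0//.
  by rewrite lerDl.
case: (ex_minnP ex) => -[|i] hi mi.
  move: hi; rewrite /d expr0 dilation1 => hi.
  by rewrite (le_trans hi)// lerDl mulr_ge0 ?powR_ge0 ?ltW.
have di : 1 < `|d i| by rewrite ltNge; apply/negP => /mi; rewrite ltnn.
have hd : k <= `|d i.+1| <= 1.
  by rewrite hi andbT dS (le_trans _ (hk _))// ler_peMr// ltW.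
have uE : u = dilation G (2 ^+ i.+1) (d i.+1).
  by rewrite /d dilationM ?exprn_gt0 ?invr_gt0// -exprMn mulfV// expr1n dilation1.
have q2 : 2 ^+ i.+1 <= `|rho| / m.
  rewrite ler_pdivlMr//; apply: le_trans (ler_norm rho); apply: le_trans qu.
  rewrite uE qnorm_dilation ?exprn_gt0// ler_wpM2l ?exprn_ge0//.
  exact: hm.
rewrite uE; apply: (le_trans (hl _ _ _)); first by rewrite exprn_ege1// ler1n.
rewrite ler_wpDl// -[leRHS]mulr1 -!mulrA ler_pM2l// ler_pM ?powR_ge0//.
by rewrite ge0_ler_powR ?nnegrE ?exprn_ge0 ?divr_ge0// ltW.
Qed.

(** Dilating x to quasi-norm 1 puts it into a bounded set; dilating back by r = q x <= 1 contracts
    the norm by r^a. *)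
Lemma norm_le_qnorm (rho : R) : exists C a : R, [/\ 0 < C, 0 < a &
  forall x, q x <= rho -> `|x| <= C * q x `^ a].
Proof.
have [C C0 [a [b [a0 b0 hs hl]]]] := dilation_norm_le G.
have [M M0 hM] := qnorm_proper 1.
have [M' M'0 hM'] := qnorm_proper rho.
exists (C * M + M'), a; split => // [|x qx]; first by rewrite addr_gt0// mulr_gt0.
have [->|x0] := eqVneq x 0.
  by rewrite normr0 mulr_ge0 ?powR_ge0// addr_ge0 ?mulr_ge0// ltW.
have q0 := qnorm_gt0 x0.
rewrite mulrDl; have [q1|q1] := leP (q x) 1.
  rewrite ler_wpDr//; first by rewrite mulr_ge0 ?powR_ge0// ltW.
  rewrite -[x in leLHS](dilationVK G q0) (le_trans (hs _ _ _)) ?q0//.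
  rewrite mulrAC ler_wpM2r ?powR_ge0// ler_pM2l// hM//.
  by rewrite qnorm_dilation ?invr_gt0// mulVf ?gt_eqF.
rewrite ler_wpDl//; first by rewrite !mulr_ge0 ?powR_ge0// ltW.
rewrite (le_trans (hM' _ qx))// ler_peMr ?(ltW M'0)//.
by rewrite powR_ge1// ltW.
Qed.

(** The parameter t = |x|^(1/b) is chosen so that dilating x by 1/t leaves a norm of at most C;
    homogeneity then gives q x <= M t. *)
Lemma qnorm_le_norm (rho : R) : exists C a : R, [/\ 0 < C, 0 < a &
  forall x, `|x| <= rho -> q x <= C * `|x| `^ a].
Proof.
have [C C0 [a [b [a0 b0 hs hl]]]] := dilation_norm_le G.
have [M M0 hM] := qnorm_ub C.
have [M' M'0 hM'] := qnorm_ub rho.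
exists (M + M'), b^-1; rewrite invr_gt0; split => // [|x xr]; first exact: addr_gt0.
have [->|x0] := eqVneq x 0.
  by rewrite qnorm0 mulr_ge0 ?powR_ge0// addr_ge0 ?mulr_ge0// ltW.
have n0 : 0 < `|x| by rewrite normr_gt0.
rewrite mulrDl; have [n1|n1] := leP `|x| 1.
  rewrite ler_wpDr//; first by rewrite mulr_ge0 ?powR_ge0// ltW.
  set t := `|x| `^ b^-1; have t0 : 0 < t by rewrite powR_gt0.
  have t1 : t <= 1.
    by rewrite powR_le1// ?invr_ge0// ltW.
  rewrite -[x in leLHS](dilationVK G t0) qnorm_dilation// mulrC ler_pM2r// hM//.
  rewrite (le_trans (hl _ _ _)) ?invf_ge1//.
  rewrite -mulrA -[leRHS]mulr1 ler_pM2l// -powR_inv1 ?powR_ge0// /t -!powRrM.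
  rewrite mulN1r mulrN mulVf ?gt_eqF// powR_inv1// mulVf ?gt_eqF//.
rewrite ler_wpDl//; first by rewrite !mulr_ge0 ?powR_ge0// ltW.
rewrite (le_trans (hM' _ xr))// ler_peMr ?(ltW M'0)//.
by rewrite powR_ge1 ?invr_ge0// ltW.
Qed.

(** In the norm of R^n, y^-1 z y is O(|z|) for bounded y, because it vanishes with z and the group
    law is Lipschitz. Passing from the quasi-norm to the norm and back costs an exponent, which is
    harmless for Hoelder regularity. *)
Lemma qnorm_conj_le (sigma rho : R) : exists C a : R, [/\ 0 < C, 0 < a &
  forall y z, q y <= sigma -> q z <= rho ->
    q (gmul G (- y) (gmul G z y)) <= C * q z `^ a].
Proof.
have [S S0 hS] := qnorm_proper sigma.
have [Z Z0 hZ] := qnorm_proper rho.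
have [L1 L10 hL1] := locally_lipschitz_gmul G (S + Z).
have [K K0 hK] : exists2 K : R, 0 < K & forall y z, `|y| <= S -> `|z| <= Z ->
    `|gmul G z y| <= K.
  have SZ : 0 <= S + Z by rewrite addr_ge0 ?ltW.
  have [K K0 hK] := locally_lipschitz_bound (locally_lipschitz_gmul G) SZ.
  exists (K + 1) => [|y z yS zZ]; first by rewrite ltr_wpDl.
  rewrite (le_trans (hK _ _ _ _)) ?lerDl//.
    by rewrite ler_wpDl// ltW.
  by rewrite ler_wpDr// ltW.
have [L2 L20 hL2] := locally_lipschitz_gmul G (S + K).
have [C [a [C0 a0 hC]]] := qnorm_le_norm (L2 * (L1 * Z)).
have [C' [a' [C'0 a'0 hC']]] := norm_le_qnorm rho.
exists (C * (L2 * (L1 * C') + 1) `^ a), (a' * a); split.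
- rewrite mulr_gt0// powR_gt0// ltr_wpDl// !mulr_ge0// ltW//.
- exact: mulr_gt0.
move=> y z yS zr.
have nle : `|gmul G (- y) (gmul G z y)| <= L2 * (L1 * `|z|).
  rewrite -[gmul G (- y) _]subr0 -[X in _ - X](gmulNx G y).
  have h1 : `|gmul G z y - y| <= L1 * `|z|.
    have := hL1 z 0 y y; rewrite gmul0x subrr subr0 normr0 addr0; apply.
    - by rewrite ler_wpDl ?hZ// ltW.
    - by rewrite addr_ge0// ltW.
    - by rewrite ler_wpDr ?hS// ltW.
    - by rewrite ler_wpDr ?hS// ltW.
  apply: le_trans (ler_wpM2l L20 h1).
  have := hL2 (- y) (- y) (gmul G z y) y; rewrite subrr normr0 add0r; apply.
  - by rewrite normrN ler_wpDr ?hS// ltW.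
  - by rewrite normrN ler_wpDr ?hS// ltW.
  - by rewrite ler_wpDl ?hK ?hS ?hZ// ltW.
  - by rewrite ler_wpDr ?hS// ltW.
apply: (le_trans (hC _ _)).
  by rewrite (le_trans nle)// ler_wpM2l// ler_wpM2l// hZ.
rewrite -mulrA ler_pM2l// powRrM -powRM ?powR_ge0//; last first.
  by rewrite ler_wpDl// !mulr_ge0// ltW.
apply: ge0_ler_powR; rewrite ?nnegrE//; first exact: ltW.
  by rewrite mulr_ge0 ?powR_ge0// addr_ge0// !mulr_ge0// ltW.
rewrite (le_trans nle)// mulrDl ler_wpDr ?mul1r ?powR_ge0// -!mulrA.
by rewrite ler_wpM2l// ler_wpM2l// hC'.
Qed.

End QuasiNorm.

(* Locked, because unfolding [dilation] down to the matrix exponential makes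
   unification diverge. *)
HB.lock Definition dl (R : realType) (n : nat) (G : homogeneousGroup R n) (r : R)
  (x : 'rV[R]_n) : 'rV[R]_n := dilation G r x.

Section LockedDilations.
Context {R : realType} {n : nat} (G : homogeneousGroup R n).
Notation V := 'rV[R]_n.
Implicit Types (x y z : V) (r s : R).

Lemma dlE r : dl G r = dilation G r.
Proof. by apply/funext => x; rewrite dl.unlock. Qed.

Lemma dlN r x : dl G r (- x) = - dl G r x.
Proof. by rewrite dlE dilationN. Qed.

Lemma dlM r s x : 0 < r -> 0 < s -> dl G r (dl G s x) = dl G (r * s) x.
Proof. by rewrite !dlE; exact: dilationM. Qed.

Lemma dl1 x : dl G 1 x = x.
Proof. by rewrite dlE dilation1. Qed.

Lemma dlK r : 0 < r -> cancel (dl G r) (dl G r^-1).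
Proof. by rewrite !dlE; exact: dilationK. Qed.

Lemma dlVK r : 0 < r -> cancel (dl G r^-1) (dl G r).
Proof. by rewrite !dlE; exact: dilationVK. Qed.

Lemma dl_gmul r x y : 0 < r -> dl G r (gmul G x y) = gmul G (dl G r x) (dl G r y).
Proof. by rewrite !dlE; exact: dilation_gmul. Qed.

Lemma qnorm_dl (q : quasiNorm G) r x : 0 < r -> q (dl G r x) = r * q x.
Proof. by rewrite dlE; exact: qnorm_dilation. Qed.

Lemma measurable_dl r : measurable_fun setT (dl G r).
Proof.
rewrite dlE; apply: measurable_fun_rVP => j; rewrite /dilation /dilation_of.
under eq_fun do rewrite mxE.
apply: measurable_sum => i; apply: measurable_funM => //.
exact: measurable_rV_coord.
Qed.

Lemma dl_norm_le r : exists2 C : R, 0 <= C & forall x, `|dl G r x| <= C * `|x|.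
Proof. rewrite dlE; exact: norm_rV_mulmx. Qed.

End LockedDilations.

(** * Haar measure: uniqueness, inversion and dilations *)

Section HaarMeasure.
Context {R : realType} {n : nat} (G : homogeneousGroup R n).
Notation V := 'rV[R]_n.
Notation lam := (@lebesgue R n).
Implicit Types (x y z : V) (A B : set V) (r s k : R).

(** Continuity is proved on R^(n + n), whose sigma-algebra is the Borel one. The pair type carries
    the product sigma-algebra instead, and concatenation is measurable from it to R^(n + n). *)
Lemma measurable_gmul : measurable_fun setT (fun p : V * V => gmul G p.1 p.2).
Proof.
pose F (w : 'rV[R]_(n + n)) := gmul G (lsubmx w) (rsubmx w).
have nl (w : 'rV[R]_(n + n)) : `|lsubmx w| <= `|w|.
  by apply/norm_rV_leP; split => // j; rewrite mxE norm_rV_coord.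
have nr (w : 'rV[R]_(n + n)) : `|rsubmx w| <= `|w|.
  by apply/norm_rV_leP; split => // j; rewrite mxE norm_rV_coord.
have cF : continuous F.
  move=> w; have FF := nbhs_filter w; apply/cvgrPdist_lt => e e0.
  have [L L0 hL] := locally_lipschitz_gmul G (`|w| + 1).
  have d0 : 0 < e / (L * 2 + 1) by rewrite divr_gt0// ltr_wpDl// mulr_ge0.
  near=> w'.
  have w1 : `|w - w'| < 1 by near: w'; exact: cvgr_dist_lt.
  have w2 : `|w - w'| < e / (L * 2 + 1) by near: w'; exact: cvgr_dist_lt.
  have ww : `|w'| <= `|w| + 1.
    by rewrite -(subKr w w') (le_trans (ler_normB _ _))// lerD2l ltW.
  have wl : `|w| <= `|w| + 1 by rewrite lerDl.
  apply: (le_lt_trans (hL _ _ _ _ _ _ _ _)); rewrite ?(le_trans (nl _))// ?(le_trans (nr _))//.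
  have -> : lsubmx w - lsubmx w' = lsubmx (w - w') by apply/rowP => j; rewrite !mxE.
  have -> : rsubmx w - rsubmx w' = rsubmx (w - w') by apply/rowP => j; rewrite !mxE.
  apply: (@le_lt_trans _ _ ((L * 2 + 1) * `|w - w'|)).
    rewrite mulrDl mul1r ler_wpDr// -mulrA ler_wpM2l// mulr_natl mulr2n.
    by rewrite lerD.
  by rewrite mulrC -ltr_pdivlMr// ltr_wpDl// mulr_ge0.
rewrite (_ : (fun p => _) = F \o (fun p : V * V => row_mx p.1 p.2)); last first.
  by apply/funext => p; rewrite /F /= row_mxKl row_mxKr.
apply: measurableT_comp; first exact: measurable_fun_rV_continuous.
by apply: measurable_row_mx; [exact: measurable_fst|exact: measurable_snd].
Unshelve. all: by end_near.
Qed.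

Lemma measurable_fun_gmul d (T : measurableType d) (f g : T -> V) :
  measurable_fun setT f -> measurable_fun setT g ->
  measurable_fun setT (fun t => gmul G (f t) (g t)).
Proof.
move=> mf mg.
have mfg : measurable_fun setT (fun t => (f t, g t)) by exact: measurable_fun_pair.
exact: (measurableT_comp measurable_gmul mfg).
Qed.

Lemma measurable_gmull x : measurable_fun setT (gmul G x).
Proof. exact: measurable_fun_gmul. Qed.

Lemma measurable_gmulr x : measurable_fun setT (gmul G ^~ x).
Proof. exact: measurable_fun_gmul. Qed.

Lemma measurable_oppV : measurable_fun setT (fun x : V => - x).
Proof. by apply: measurable_fun_rV_continuous => x; exact: oppr_continuous. Qed.

Lemma measurable_fun_oppV d (T : measurableType d) (f : T -> V) :
  measurable_fun setT f -> measurable_fun setT (fun t => - f t).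
Proof. exact: (measurableT_comp measurable_oppV). Qed.

Lemma measurable_preimage d d' (T : measurableType d) (U : measurableType d')
    (f : T -> U) (B : set U) : measurable_fun setT f -> measurable B -> measurable (f @^-1` B).
Proof. by move=> mf mB; rewrite -[X in measurable X]setTI; exact: mf. Qed.

Lemma measurable_indicE d (T : measurableType d) (A : set T) :
  measurable A -> measurable_fun setT (fun t => (\1_A t)%:E : \bar R).
Proof. by move=> mA; apply/measurable_EFinP; exact: measurable_indic. Qed.

Section Uniqueness.
Variable nu : {sigma_finite_measure set V -> \bar R}.
Hypothesis nu_left : forall a A, measurable A -> nu (gmul G a @^-1` A) = nu A.

(** The double integral of 1_A(x) 1_B(y x) over nu(x) and lam(y) is evaluated twice. Right
    invariance of lam in y gives the left side; the shift x -> y^-1 x under nu, followed by y -> x y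
    under lam, gives the right side. With nu = lam this yields invariance under inversion, with nu a
    dilate of lam the Jacobian of a dilation. *)
Lemma haar_unique A B : measurable A -> measurable B ->
  (lam B * nu A = nu B * lam (-%R @^-1` A))%E.
Proof.
move=> mA mB.
have intind (m : {measure set V -> \bar R}) C : measurable C ->
    (\int[m]_x (\1_C x)%:E = m C)%E.
  by move=> mC; rewrite integral_indic// setIT.
pose F (p : V * V) : \bar R := ((\1_A p.1)%:E * (\1_B (gmul G p.2 p.1))%:E)%E.
have mF : measurable_fun setT F.
  apply: emeasurable_funM.
    exact: (measurableT_comp (measurable_indicE mA) measurable_fst).
  apply: (measurableT_comp (measurable_indicE mB)).
  by apply: measurable_fun_gmul; [exact: measurable_snd|exact: measurable_fst].
have F0 p : (0 <= F p)%E by rewrite mule_ge0// lee_fin.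
pose H (p : V * V) : \bar R := ((\1_B p.1)%:E * (\1_A (gmul G (- p.2) p.1))%:E)%E.
have mH : measurable_fun setT H.
  apply: emeasurable_funM.
    exact: (measurableT_comp (measurable_indicE mB) measurable_fst).
  apply: (measurableT_comp (measurable_indicE mA)).
  apply: measurable_fun_gmul; last exact: measurable_fst.
  by apply: measurable_fun_oppV; exact: measurable_snd.
have H0 p : (0 <= H p)%E by rewrite mule_ge0// lee_fin.
transitivity (\int[nu]_x \int[lam]_y F (x, y))%E.
  transitivity (\int[nu]_x ((\1_A x)%:E * lam B))%E.
    rewrite ge0_integralZr//; last exact: measurable_indicE.
    by rewrite intind// muleC.
  apply: eq_integral => x _; rewrite /F /= ge0_integralZl//; last first.
    by apply: (measurableT_comp (measurable_indicE mB)); exact: measurable_gmulr.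
  congr (_ * _)%E; rewrite -(haar_right G x mB) -intind//.
  by apply: measurable_preimage => //; exact: measurable_gmulr.
rewrite (fubini_tonelli F)//.
transitivity (\int[lam]_y \int[nu]_x H (x, y))%E.
  apply: eq_integral => y _.
  rewrite (_ : (fun x => F (x, y)) =
      (fun x => (\1_((gmul G y @^-1` [set u | A (gmul G (- y) u) /\ B u])) x)%:E)); last first.
    apply/funext => x; rewrite /F /= -EFinM; congr EFin; rewrite !indicE -natrM mulnb.
    congr (nat_of_bool _)%:R; apply/idP/idP.
      by move=> /andP[/set_mem a /set_mem b]; apply/mem_set => /=; rewrite gmulKV.
    by move=> /set_mem /= [+ b]; rewrite gmulKV => a; rewrite !mem_set.
  have mC : measurable [set u | A (gmul G (- y) u) /\ B u].
    rewrite (_ : [set u | _] = (gmul G (- y) @^-1` A) `&` B)//.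
    by apply: measurableI => //; apply: measurable_preimage => //; exact: measurable_gmull.
  rewrite intind; last first.
    by apply: measurable_preimage => //; exact: measurable_gmull.
  transitivity (nu [set u | A (gmul G (- y) u) /\ B u]); first exact: nu_left.
  rewrite -(intind nu _ mC); apply: eq_integral => x _.
  rewrite /H /= -EFinM; congr EFin.
  rewrite !indicE -natrM mulnb; congr (nat_of_bool _)%:R; apply/idP/idP.
    by move=> /set_mem /= [a b]; rewrite !mem_set.
  by move=> /andP[/set_mem a /set_mem b]; apply/mem_set.
rewrite -(fubini_tonelli H)//.
transitivity (\int[nu]_x ((\1_B x)%:E * lam (-%R @^-1` A)))%E; last first.
  rewrite ge0_integralZr//; last exact: measurable_indicE.
  by rewrite intind// muleC.
apply: eq_integral => x _; rewrite /H /= ge0_integralZl//; last first.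
  apply: (measurableT_comp (measurable_indicE mA)).
  by apply: measurable_fun_gmul => //; exact: measurable_oppV.
congr (_ * _)%E.
have mC : measurable [set y | A (gmul G (- y) x)].
  apply: (@measurable_preimage _ _ _ _ (fun y => gmul G (- y) x)) => //.
  by apply: measurable_fun_gmul => //; exact: measurable_oppV.
rewrite intind; last exact: mC.
transitivity (lam (gmul G x @^-1` [set y | A (gmul G (- y) x)])).
  by rewrite haar_left.
congr (lam _).
by apply/seteqP; split => y /=; rewrite gmulN gmulNK.
Qed.

End Uniqueness.

Definition norm_ball (k : R) : set V := [set x | `|x| <= k].

(** Balls of integer radius exhaust a space of positive measure, so one of them has positive
    measure. It serves as the unit of volume against which invariant measures are normalised. *)
Lemma haar_ball_pos : exists2 k : R, 0 <= k & (0 < lam (norm_ball k) < +oo)%E.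
Proof.
apply: contrapT => h.
have z (k : nat) : lam (norm_ball k%:R) = 0%E.
  apply/eqP; rewrite eq_le measure_ge0 andbT leNgt; apply/negP => h'.
  by apply: h; exists k%:R => //; rewrite h' lebesgue_norm_ball_fin.
have := @lebesgue_setT_gt0 R n; rewrite ltNge => /negP; apply.
rewrite -norm_balls_cover.
apply: (le_trans (@measure_sigma_subadditive _ _ _ lam _
  (fun k : nat => norm_ball k%:R) _ _ _)) => //.
- by move=> k; exact: measurable_norm_ball.
- by rewrite norm_balls_cover.
by rewrite eseries0// => k _ _; exact: z.
Qed.

Definition haar_ball : set V := norm_ball (s2val (cid2 haar_ball_pos)).

Lemma haar_ballP : (0 < lam haar_ball < +oo)%E.
Proof. by rewrite /haar_ball; case: cid2. Qed.

Lemma measurable_haar_ball : measurable haar_ball.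
Proof. exact: measurable_norm_ball. Qed.

Lemma haarN A : measurable A -> lam (-%R @^-1` A) = lam A.
Proof.
move=> mA; have /andP[p f] := haar_ballP.
have h : (lam haar_ball * lam A = lam haar_ball * lam (-%R @^-1` A))%E.
  by apply: haar_unique => //; [exact: haar_left|exact: measurable_haar_ball].
have f1 : lam haar_ball \is a fin_num by rewrite ge0_fin_numE.
have c0 : 0 < fine (lam haar_ball) by rewrite fine_gt0// p f.
rewrite -(fineK f1) in h.
have : ((fine (lam haar_ball))^-1%:E * ((fine (lam haar_ball))%:E * lam A))%E =
    ((fine (lam haar_ball))^-1%:E * ((fine (lam haar_ball))%:E * lam (-%R @^-1` A)))%E.
  by rewrite h.
by rewrite !muleA -!EFinM mulVf ?gt_eqF// !mul1e.
Qed.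

(** This is r^Q with Q the homogeneous dimension. It is taken as the volume ratio of one fixed ball;
    [haar_dilation] shows that every set has the same ratio. *)
Definition jac (r : R) : R :=
  fine (lam (dl G r^-1 @^-1` haar_ball)) / fine (lam haar_ball).

Lemma bounded_measure_fin A (k : R) : measurable A ->
  (forall x, A x -> `|x| <= k) -> (lam A < +oo)%E.
Proof.
move=> mA Ak; apply: le_lt_trans (lebesgue_norm_ball_fin n k).
by apply: le_measure; rewrite ?inE//; exact: measurable_norm_ball.
Qed.

Lemma dilation_ball_fin r k : 0 < r -> (lam (dl G r @^-1` norm_ball k) < +oo)%E.
Proof.
move=> r0.
have [C C0 hC] := dl_norm_le G r^-1.
apply: (@bounded_measure_fin _ (C * k)).
  by apply: measurable_preimage; [exact: measurable_dl|exact: measurable_norm_ball].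
move=> x xk; rewrite -[x](dlK G r0) (le_trans (hC _))// ler_wpM2l//.
Qed.

(** A dilation is a group automorphism, so the image of lam under it is again left invariant, and
    [haar_unique] compares it with lam through the fixed ball. *)
Lemma haar_dilation r A : 0 < r -> measurable A ->
  lam (dl G r^-1 @^-1` A) = ((jac r)%:E * lam A)%E.
Proof.
move=> r0 mA.
have mD := measurable_dl G r^-1.
have V0 : 0 < r^-1 by rewrite invr_gt0.
pose nu0 : {measure set V -> \bar R} :=
  measure_function_pushforward__canonical__measure_function_Measure lam mD.
have nuE B : nu0 B = lam (dl G r^-1 @^-1` B) by [].
have sf : sigma_finite setT nu0.
  exists (fun k : nat => norm_ball k%:R); first by rewrite norm_balls_cover.
  by move=> k; split; [exact: measurable_norm_ball|exact: dilation_ball_fin].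
have nul a B : measurable B -> nu0 (gmul G a @^-1` B) = nu0 B.
  move=> mB; rewrite !nuE.
  have mdB : measurable (dl G r^-1 @^-1` B) by exact: measurable_preimage.
  rewrite -(haar_left G (dl G r a) mdB); congr (lam _).
  by apply/seteqP; split => x /=; rewrite dl_gmul// dlK.
have /= := @haar_unique (sigma_finite_pack sf) nul A haar_ball mA measurable_haar_ball.
rewrite haarN// /sigma_finite_pack !nuE.
have /andP[p f] := haar_ballP.
have f1 : lam haar_ball \is a fin_num by rewrite ge0_fin_numE.
have f2 : lam (dl G r^-1 @^-1` haar_ball) \is a fin_num.
  by rewrite ge0_fin_numE// dilation_ball_fin.
have c0 : 0 < fine (lam haar_ball) by rewrite fine_gt0// p f.
rewrite -{1}(fineK f1) -{1}(fineK f2) /jac => h.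
have : ((fine (lam haar_ball))^-1%:E * ((fine (lam haar_ball))%:E *
    lam (dl G r^-1 @^-1` A)))%E = ((fine (lam haar_ball))^-1%:E *
    ((fine (lam (dl G r^-1 @^-1` haar_ball)))%:E * lam A))%E by rewrite h.
by rewrite !muleA -!EFinM mulVf ?gt_eqF// mul1e mulrC.
Qed.

Lemma jac_ge0 r : 0 <= jac r.
Proof. by rewrite divr_ge0 ?fine_ge0. Qed.

Lemma jac_uniq r c : 0 < r -> lam (dl G r^-1 @^-1` haar_ball) = (c%:E * lam haar_ball)%E ->
  jac r = c.
Proof.
move=> r0; rewrite haar_dilation//; last exact: measurable_haar_ball.
have /andP[p f] := haar_ballP.
have f1 : lam haar_ball \is a fin_num by rewrite ge0_fin_numE.
have c0 : fine (lam haar_ball) != 0 by rewrite gt_eqF// fine_gt0// p f.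
by rewrite -(fineK f1) -!EFinM => -[] /(mulIf c0).
Qed.

Lemma jacM r s : 0 < r -> 0 < s -> jac (r * s) = jac r * jac s.
Proof.
move=> r0 s0; apply: jac_uniq; first exact: mulr_gt0.
have mB := measurable_haar_ball.
have mDB : measurable (dl G s^-1 @^-1` haar_ball).
  by apply: measurable_preimage => //; exact: measurable_dl.
have E1 := haar_dilation s0 mB; have E2 := haar_dilation r0 mDB.
rewrite EFinM -muleA -E1 -E2; congr (lam _).
by apply/seteqP; split => x /=; rewrite dlM ?invr_gt0// invfM mulrC.
Qed.

Lemma jac1 : jac 1 = 1.
Proof.
apply: jac_uniq => //; rewrite mul1e invr1; congr (lam _).
by apply/seteqP; split => x /=; rewrite dl1.
Qed.

Lemma jac_gt0 r : 0 < r -> 0 < jac r.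
Proof.
move=> r0; rewrite lt_neqAle jac_ge0 andbT eq_sym; apply/eqP => j0.
have := jac1; rewrite -(mulfV (lt0r_neq0 r0)) jacM ?invr_gt0// j0 mul0r.
by rewrite mulfV ?gt_eqF// => /eqP; rewrite eq_sym oner_eq0.
Qed.

End HaarMeasure.

(** * Fubini's theorem for functions dominated by a product *)

Section DominatedFubini.
Context d1 d2 (T1 : measurableType d1) (T2 : measurableType d2) (R : realType).
Variables (m1 : {sigma_finite_measure set T1 -> \bar R})
  (m2 : {sigma_finite_measure set T2 -> \bar R}).
Variables (F : T1 * T2 -> R) (a : T1 -> R) (b : T2 -> R).
Hypotheses (mF : measurable_fun setT F) (a0 : forall x, 0 <= a x)
  (b0 : forall y, 0 <= b y) (Fab : forall x y, `|F (x, y)| <= a x * b y)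
  (ia : m1.-integrable setT (EFin \o a)) (ib : m2.-integrable setT (EFin \o b)).

Lemma dominated_xintegrable x : m2.-integrable setT (fun y => (F (x, y))%:E).
Proof.
apply: (le_integrable _ _ _ (integrableZl _ (a x) ib)) => //.
  by apply/measurable_EFinP; exact: measurableT_comp.
by move=> y _; rewrite lee_fin (le_trans (Fab x y))// ler_norm.
Qed.

Lemma dominated_yintegrable y : m1.-integrable setT (fun x => (F (x, y))%:E).
Proof.
apply: (le_integrable _ _ _ (integrableZl _ (b y) ia)) => //.
  by apply/measurable_EFinP; exact: measurableT_comp.
by move=> x _; rewrite lee_fin (le_trans (Fab x y))// mulrC ler_norm.
Qed.

Lemma dominated_integrable : (m1 \x m2)%E.-integrable setT (EFin \o F).
Proof.
apply/integrable12ltyP; first exact/measurable_EFinP.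
have h x : (\int[m2]_y `|(F (x, y))%:E| <= (a x)%:E * \int[m2]_y `|(b y)%:E|)%E.
  rewrite -ge0_integralZl//; last 2 first.
    by apply: measurableT_comp => //; case/integrableP : ib.
    by rewrite lee_fin.
  apply: ge0_le_integral => //.
  - by apply: measurableT_comp => //; apply/measurable_EFinP; exact: measurableT_comp.
  - apply: emeasurable_funM => //; apply: measurableT_comp => //.
    by case/integrableP : ib.
  - by move=> y _; rewrite lee_fin (ger0_norm (b0 y)).
case/integrableP : ib => mb fb; case/integrableP : ia => ma fa.
apply: (@le_lt_trans _ _ (\int[m1]_x ((a x)%:E * \int[m2]_y `|(b y)%:E|))%E).
  apply: ge0_le_integral => //.
  - by move=> x _; exact: integral_ge0.
  - apply: (measurable_fun_fubini_tonelli_F (fun p => `|(F p)%:E|%E)) => //.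
    by apply: measurableT_comp => //; exact/measurable_EFinP.
  - by apply: emeasurable_funM.
  - by move=> x _; exact: h.
rewrite ge0_integralZr//; last 2 first.
  by move=> x _; rewrite lee_fin.
  exact: integral_ge0.
apply: lte_mul_pinfty; first by apply: integral_ge0 => x _; rewrite lee_fin.
  rewrite ge0_fin_numE; last by apply: integral_ge0 => x _; rewrite lee_fin.
  by apply: le_lt_trans fa; apply: ge0_le_integral => //;
    [by move=> x _; rewrite lee_fin|exact: measurableT_comp|by move=> x _; rewrite lee_fin ler_norm].
exact: fb.
Qed.

Lemma dominated_Fubini : (\int[m1]_x \int[m2]_y F (x, y) =
  \int[m2]_y \int[m1]_x F (x, y))%R.
Proof.
have := Fubini dominated_integrable; rewrite /= => h.
rewrite /Rintegral.
transitivity (fine (\int[m1]_x \int[m2]_y (F (x, y))%:E)).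
  congr fine; apply: eq_integral => x _; rewrite fineK//.
  exact: integrable_fin_num (dominated_xintegrable x).
rewrite h; congr fine; apply: eq_integral => y _; rewrite fineK//.
exact: integrable_fin_num (dominated_yintegrable y).
Qed.

Lemma measurable_dominated_xRintegral :
  measurable_fun setT (fun x => (\int[m2]_y F (x, y))%R).
Proof.
apply: measurableT_comp => //.
exact: (measurable_fubini_F dominated_integrable).
Qed.

End DominatedFubini.

(** * Integrals of bounded functions of bounded support *)

Section BoundedSupport.
Context {R : realType} {n : nat}.
Notation V := 'rV[R]_n.
Notation lam := (@lebesgue R n).
Implicit Types (x y z : V) (A B : set V) (r s k : R) (f g : V -> R).

(** The class on which all operators act. It is stable under sums, products, translations,
    dilations, averages along [mu] and cell averages, and integrals over it are finite, so [integ]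
    can be real-valued. *)
Definition bsupp f := measurable_fun setT f /\
  exists M rho : R, forall x, `|f x| <= M * \1_(norm_ball rho) x.

Lemma bsupp_measurable f : bsupp f -> measurable_fun setT f.
Proof. by case. Qed.

Lemma integrable_indic_ball (M rho : R) :
  lam.-integrable setT (EFin \o (fun x => M * \1_(norm_ball rho) x)).
Proof.
rewrite (_ : EFin \o _ = (fun x => (M%:E * (\1_(norm_ball rho) x)%:E)%E)); last first.
  by apply/funext => x; rewrite /= EFinM.
apply: integrableZl => //; apply/integrableP; split.
  by apply/measurable_EFinP; apply: measurable_indic; exact: measurable_norm_ball.
under eq_integral do rewrite gee0_abs ?lee_fin//.
by rewrite integral_indic ?setIT ?lebesgue_norm_ball_fin//; exact: measurable_norm_ball.
Qed.

Lemma bsupp_integrable f : bsupp f -> lam.-integrable setT (EFin \o f).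
Proof.
move=> [mf [M [rho h]]]; apply: le_integrable (integrable_indic_ball M rho) => //.
  exact/measurable_EFinP.
by move=> x _; rewrite lee_fin (le_trans (h x))// ler_norm.
Qed.

Definition integ f : R := (\int[lam]_x f x)%R.

Lemma integD f g : bsupp f -> bsupp g -> integ (fun x => f x + g x) = integ f + integ g.
Proof. by move=> bf bg; rewrite /integ RintegralD//; exact: bsupp_integrable. Qed.

Lemma integB f g : bsupp f -> bsupp g -> integ (fun x => f x - g x) = integ f - integ g.
Proof. by move=> bf bg; rewrite /integ RintegralB//; exact: bsupp_integrable. Qed.

Lemma integZ k f : bsupp f -> integ (fun x => k * f x) = k * integ f.
Proof. by move=> bf; rewrite /integ RintegralZl//; exact: bsupp_integrable. Qed.

Lemma integ_le f g : bsupp f -> bsupp g -> (forall x, f x <= g x) -> integ f <= integ g.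
Proof. by move=> bf bg fg; apply: le_Rintegral => //; exact: bsupp_integrable. Qed.

Lemma integ_ge0 f : (forall x, 0 <= f x) -> 0 <= integ f.
Proof. by move=> f0; exact: Rintegral_ge0. Qed.

Lemma integ_abs f : bsupp f -> `|integ f| <= integ (fun x => `|f x|).
Proof. by move=> bf; apply: le_normr_Rintegral => //; exact: bsupp_integrable. Qed.

Lemma eq_integ f g : (forall x, f x = g x) -> integ f = integ g.
Proof. by move=> fg; congr integ; apply/funext. Qed.

Lemma bsupp_le f g : measurable_fun setT f -> (forall x, `|f x| <= `|g x|) ->
  bsupp g -> bsupp f.
Proof.
move=> mf fg [mg [M [rho h]]]; split => //; exists M, rho => x.
exact: le_trans (fg x) (h x).
Qed.

Lemma bsupp_bound f : bsupp f -> exists2 M : R, 0 <= M & exists rho,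
  (forall x, `|f x| <= M) /\ (forall x, f x != 0 -> `|x| <= rho).
Proof.
move=> [mf [M [rho h]]]; exists `|M| => //; exists rho; split => x.
  apply: le_trans (h x) _; rewrite (le_trans (ler_norm _))// normrM.
  by rewrite ler_piMr// indicE; case: (_ \in _); rewrite ?normr0 ?normr1.
move=> f0; have := h x; rewrite indicE; case: (boolP (x \in _)) => [/set_mem//|_].
by rewrite mulr0 normr_le0 (negbTE f0).
Qed.

Lemma bsupp_intro f (M rho : R) : measurable_fun setT f ->
  (forall x, `|f x| <= M) -> (forall x, f x != 0 -> `|x| <= rho) -> bsupp f.
Proof.
move=> mf fM fr; split => //; exists M, rho => x; rewrite indicE.
case: (boolP (x \in _)) => [_|/negP xr]; first by rewrite mulr1.
rewrite mulr0 normr_le0; apply/negP => /negP f0; apply: xr; apply/mem_set; exact: fr.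
Qed.

Lemma bsuppM f g (M : R) : measurable_fun setT f -> (forall x, `|f x| <= M) ->
  bsupp g -> bsupp (fun x => f x * g x).
Proof.
move=> mf fM [mg [N [rho h]]]; split; first exact: measurable_funM.
exists (M * N), rho => x; rewrite normrM -mulrA ler_pM//.
Qed.

Lemma bsuppZ k f : bsupp f -> bsupp (fun x => k * f x).
Proof. by move=> bf; apply: (@bsuppM (fun=> k) f `|k|). Qed.

Lemma bsupp_mul f g : bsupp f -> bsupp g -> bsupp (fun x => f x * g x).
Proof.
move=> bf bg; have [M _ [rho [fM _]]] := bsupp_bound bf.
by apply: (bsuppM (M := M)) => //; exact: bsupp_measurable.
Qed.

Lemma bsupp_abs f : bsupp f -> bsupp (fun x => `|f x|).
Proof.
move=> bf; apply: (bsupp_le _ _ bf); last by move=> x; rewrite normr_id.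
by apply: measurableT_comp => //; case: bf.
Qed.

Lemma bsuppD f g : bsupp f -> bsupp g -> bsupp (fun x => f x + g x).
Proof.
move=> bf bg.
have [M M0 [rho [fM fr]]] := bsupp_bound bf; have [N N0 [rho' [gN gr]]] := bsupp_bound bg.
apply: (@bsupp_intro _ (M + N) (Num.max rho rho')).
- by apply: measurable_funD; exact: bsupp_measurable.
- by move=> x; rewrite (le_trans (ler_normD _ _))// lerD.
move=> x; have [->|f0] := eqVneq (f x) 0; rewrite le_max.
  by rewrite add0r => /gr ->; rewrite orbT.
by move=> _; rewrite fr.
Qed.

Lemma bsuppN f : bsupp f -> bsupp (fun x => - f x).
Proof.
move=> bf; have := bsuppZ (-1) bf; rewrite (_ : (fun x => _) = (fun x => - f x))//.
by apply/funext => x; rewrite mulN1r.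
Qed.

Lemma bsuppB f g : bsupp f -> bsupp g -> bsupp (fun x => f x - g x).
Proof. by move=> bf bg; apply: bsuppD => //; exact: bsuppN. Qed.

Lemma bsupp0 : bsupp (fun=> 0).
Proof. by split => //; exists 0, 0 => x; rewrite normr0 mul0r. Qed.

Lemma bsupp_sum (I : Type) (s : seq I) (P : pred I) (F : I -> V -> R) :
  (forall i, bsupp (F i)) -> bsupp (fun x => \sum_(i <- s | P i) F i x).
Proof.
move=> bF; elim: s => [|i s IH].
  by under eq_fun do rewrite big_nil; exact: bsupp0.
under eq_fun do rewrite big_cons; case: (P i) => //; exact: bsuppD.
Qed.

Lemma integ_sum (I : Type) (s : seq I) (P : pred I) (F : I -> V -> R) :
  (forall i, bsupp (F i)) -> integ (fun x => \sum_(i <- s | P i) F i x) =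
  \sum_(i <- s | P i) integ (F i).
Proof.
move=> bF; elim: s => [|i s IH].
  by rewrite big_nil /integ; under eq_Rintegral do rewrite big_nil; rewrite Rintegral_cst// mul0r.
rewrite big_cons -IH.
under [LHS]eq_integ do rewrite big_cons.
by case: (P i) => //; rewrite integD//; exact: bsupp_sum.
Qed.

Lemma bsupp_indic A rho : measurable A -> A `<=` norm_ball rho -> bsupp (\1_A).
Proof.
move=> mA Ar; apply: (@bsupp_intro _ 1 rho).
- exact: measurable_indic.
- by move=> x; rewrite indicE; case: (_ \in _); rewrite ?normr0 ?normr1.
- move=> x; rewrite indicE; case: (boolP (x \in A)) => [/set_mem/Ar//|_].
  by rewrite eqxx.
Qed.

(** One change of variables for both uses: k = 1 for translations, and k a Jacobian for
    dilations. *)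
Lemma ge0_integral_scaled (phi : V -> V) k (f : V -> \bar R) : 0 <= k ->
  measurable_fun setT phi ->
  (forall A, measurable A -> lam (phi @^-1` A) = (k%:E * lam A)%E) ->
  measurable_fun setT f -> (forall x, 0 <= f x)%E ->
  (\int[lam]_x f (phi x) = k%:E * \int[lam]_x f x)%E.
Proof.
move=> k0 mphi hphi mf f0.
have -> : (\int[lam]_x f (phi x) = \int[pushforward lam phi]_x f x)%E.
  by rewrite ge0_integral_pushforward.
rewrite (eq_measure_integral (mscale (NngNum k0) lam)); last first.
  by move=> A mA _; exact: hphi.
by rewrite ge0_integral_mscale.
Qed.

Lemma integ_scaled (phi : V -> V) k f : 0 <= k -> measurable_fun setT phi ->
  (forall A, measurable A -> lam (phi @^-1` A) = (k%:E * lam A)%E) ->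
  lam.-integrable setT (EFin \o f) -> integ (f \o phi) = k * integ f.
Proof.
move=> k0 mphi hphi intf.
have mf : measurable_fun setT (EFin \o f) by case/integrableP : intf.
have fp := integrable_pos_fin_num measurableT intf.
have fn := integrable_neg_fin_num measurableT intf.
rewrite /integ /Rintegral integralE [in RHS]integralE.
have E1 : (\int[lam]_x (EFin \o (f \o phi))^\+ x = k%:E * \int[lam]_x (EFin \o f)^\+ x)%E.
  rewrite -(@ge0_integral_scaled phi k ((EFin \o f)^\+)%E)//; last exact: measurable_funepos.
  by apply: eq_integral => x _; rewrite !funeposE.
have E2 : (\int[lam]_x (EFin \o (f \o phi))^\- x = k%:E * \int[lam]_x (EFin \o f)^\- x)%E.
  rewrite -(@ge0_integral_scaled phi k ((EFin \o f)^\-)%E)//; last exact: measurable_funeneg.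
  by apply: eq_integral => x _; rewrite !funenegE.
rewrite [X in fine (X - _)]E1 [X in fine (_ - X)]E2.
have Ep := fineK fp; have En := fineK fn.
rewrite -[X in (_ * X - _)%E]Ep -[X in (_ - _ * X)%E]En -!EFinM -EFinB /= -mulrBr.
by rewrite -[X in _ = k * fine (X - _)]Ep -[X in _ = k * fine (_ - X)]En.
Qed.

Lemma integ_fubini (F : V * V -> R) a b : measurable_fun setT F ->
  bsupp a -> bsupp b -> (forall x y, `|F (x, y)| <= `|a x| * `|b y|) ->
  integ (fun x => integ (fun y => F (x, y))) = integ (fun y => integ (fun x => F (x, y))).
Proof.
move=> mF ba bb Fab; apply: (dominated_Fubini (a := fun x => `|a x|) (b := fun x => `|b x|)) => //.
  exact/bsupp_integrable/bsupp_abs.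
exact/bsupp_integrable/bsupp_abs.
Qed.

Lemma measurable_integ_param (F : V * V -> R) a b : measurable_fun setT F ->
  bsupp a -> bsupp b -> (forall x y, `|F (x, y)| <= `|a x| * `|b y|) ->
  measurable_fun setT (fun x => integ (fun y => F (x, y))).
Proof.
move=> mF ba bb Fab; apply: (measurable_dominated_xRintegral (a := fun x => `|a x|) (b := fun x => `|b x|)) => //.
  exact/bsupp_integrable/bsupp_abs.
exact/bsupp_integrable/bsupp_abs.
Qed.

Lemma integ_eq0 : integ (fun=> 0) = 0.
Proof. by rewrite /integ Rintegral_cst// mul0r. Qed.

(* Optimising [2 |f g| <= t f ^ 2 + g ^ 2 / t] over [t > 0]. *)
Lemma integ_cauchy_schwarz f g : bsupp f -> bsupp g ->
  integ (fun x => f x * g x) ^+ 2 <= integ (fun x => f x ^+ 2) * integ (fun x => g x ^+ 2).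
Proof.
move=> bf bg.
have bff := bsupp_mul bf bf; have bgg := bsupp_mul bg bg; have bfg := bsupp_mul bf bg.
pose A := integ (fun x => f x * f x); pose B := integ (fun x => f x * g x).
pose D := integ (fun x => g x * g x).
have -> : integ (fun x => f x ^+ 2) = A by apply: eq_integ => x; rewrite expr2.
have -> : integ (fun x => g x ^+ 2) = D by apply: eq_integ => x; rewrite expr2.
rewrite -/B.
have key t : 0 <= t ^+ 2 * A - 2 * t * B + D.
  have -> : t ^+ 2 * A - 2 * t * B + D = integ (fun x => (t * f x - g x) ^+ 2).
    rewrite /A /B /D -!integZ// -integB; [|exact: bsuppZ..].
    rewrite -integD//; last by apply: bsuppB; exact: bsuppZ.
    by apply: eq_integ => x; ring.
  by apply: integ_ge0 => x; exact: sqr_ge0.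
have A0 : 0 <= A by apply: integ_ge0 => x; rewrite -expr2 sqr_ge0.
have D0 : 0 <= D by apply: integ_ge0 => x; rewrite -expr2 sqr_ge0.
have [A_eq0|A_neq0] := eqVneq A 0.
  have := key ((D + 1) / (2 * B)).
  have [->|B0] := eqVneq B 0; first by rewrite A_eq0 mul0r expr0n.
  have -> : 2 * ((D + 1) / (2 * B)) * B = D + 1 by field.
  by rewrite A_eq0 mulr0 => h; exfalso; lra.
have Apos : 0 < A by rewrite lt_neqAle eq_sym A_neq0.
have := key (B / A); have -> : (B / A) ^+ 2 * A - 2 * (B / A) * B + D = D - B ^+ 2 / A.
  by field.
by rewrite subr_ge0 ler_pdivrMr// mulrC.
Qed.

Lemma integ_norm_cauchy_schwarz f g : bsupp f -> bsupp g ->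
  integ (fun x => `|f x| * `|g x|) <=
  Num.sqrt (integ (fun x => f x ^+ 2)) * Num.sqrt (integ (fun x => g x ^+ 2)).
Proof.
move=> bf bg; have := integ_cauchy_schwarz (bsupp_abs bf) (bsupp_abs bg).
rewrite -sqrtrM; last by apply: integ_ge0 => x; exact: sqr_ge0.
have nn h : integ (fun x => `|h x| ^+ 2) = integ (fun x => h x ^+ 2).
  by apply: eq_integ => x; rewrite real_normK// num_real.
rewrite !nn => h; rewrite -[leLHS]ger0_norm; last first.
  by apply: integ_ge0 => x; rewrite mulr_ge0.
by rewrite -sqrtr_sqr ler_wsqrtr.
Qed.

End BoundedSupport.

Section GroupTranslations.
Context {R : realType} {n : nat} (G : homogeneousGroup R n).
Notation V := 'rV[R]_n.
Notation lam := (@lebesgue R n).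
Implicit Types (x y z : V) (A B : set V) (r s k : R) (f g : V -> R).

Lemma integ_gmulr z f : bsupp f -> integ (fun x => f (gmul G x z)) = integ f.
Proof.
move=> bf; rewrite -[RHS]mul1r -(integ_scaled (phi := gmul G ^~ z) (k := 1))//.
- exact: measurable_gmulr.
- by move=> A mA; rewrite mul1e haar_right.
- exact: bsupp_integrable.
Qed.

Lemma integ_gmull z f : bsupp f -> integ (fun x => f (gmul G z x)) = integ f.
Proof.
move=> bf; rewrite -[RHS]mul1r -(integ_scaled (phi := gmul G z) (k := 1))//.
- exact: measurable_gmull.
- by move=> A mA; rewrite mul1e haar_left.
- exact: bsupp_integrable.
Qed.

Lemma integ_dl r f : 0 < r -> bsupp f ->
  integ (fun x => f (dl G r x)) = jac G r^-1 * integ f.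
Proof.
move=> r0 bf; rewrite -(integ_scaled (phi := dl G r) (k := jac G r^-1))//.
- exact: jac_ge0.
- exact: measurable_dl.
- by move=> A mA; rewrite -haar_dilation ?invr_gt0// invrK.
- exact: bsupp_integrable.
Qed.

Lemma gmul_bound rho : exists2 K : R, 0 < K &
  forall x y, `|x| <= rho -> `|y| <= rho -> `|gmul G x y| <= K.
Proof.
have r0 : 0 <= `|rho| by [].
have [K K0 hK] := locally_lipschitz_bound (locally_lipschitz_gmul G) r0.
exists (K + 1) => [|x y xr yr]; first by rewrite ltr_wpDl.
by rewrite ler_wpDr// hK// (le_trans _ (ler_norm rho)).
Qed.

Lemma bsupp_gmulr z f : bsupp f -> bsupp (fun x => f (gmul G x z)).
Proof.
move=> bf; have [M M0 [rho [fM fr]]] := bsupp_bound bf.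
have [K K0 hK] := gmul_bound (Num.max rho `|z|).
apply: (@bsupp_intro _ _ _ M K) => //.
  by apply: (measurableT_comp (bsupp_measurable bf)); exact: measurable_gmulr.
move=> x /fr xr; rewrite -[x in leLHS](gmulK G z); apply: hK.
  by rewrite le_max xr.
by rewrite normrN le_max lexx orbT.
Qed.

Lemma bsupp_gmull z f : bsupp f -> bsupp (fun x => f (gmul G z x)).
Proof.
move=> bf; have [M M0 [rho [fM fr]]] := bsupp_bound bf.
have [K K0 hK] := gmul_bound (Num.max rho `|z|).
apply: (@bsupp_intro _ _ _ M K) => //.
  by apply: (measurableT_comp (bsupp_measurable bf)); exact: measurable_gmull.
move=> x /fr xr; rewrite -[x in leLHS](gmulKV G z); apply: hK.
  by rewrite normrN le_max lexx orbT.
by rewrite le_max xr.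
Qed.

Lemma bsupp_dl r f : 0 < r -> bsupp f -> bsupp (fun x => f (dl G r x)).
Proof.
move=> r0 bf; have [M M0 [rho [fM fr]]] := bsupp_bound bf.
have [C C0 hC] := dl_norm_le G r^-1.
apply: (@bsupp_intro _ _ _ M (C * rho)) => //.
  by apply: (measurableT_comp (bsupp_measurable bf)); exact: measurable_dl.
by move=> x /fr xr; rewrite -[x](dlK G r0) (le_trans (hC _))// ler_wpM2l.
Qed.

Definition qball (q : quasiNorm G) (rho : R) : set V := [set x | q x <= rho].

Lemma measurable_qnorm (q : quasiNorm G) : measurable_fun setT q.
Proof. by apply: measurable_fun_continuous; exact: qnorm_continuous. Qed.

Lemma measurable_qball (q : quasiNorm G) rho : measurable (qball q rho).
Proof.
rewrite (_ : qball q rho = q @^-1` `]-oo, rho]%classic).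
  by apply: measurable_preimage => //; exact: measurable_qnorm.
by apply/seteqP; split => x; rewrite /qball /= in_itv.
Qed.

Lemma qball_norm_ball (q : quasiNorm G) rho :
  exists k, qball q rho `<=` norm_ball k.
Proof. by have [M M0 hM] := qnorm_proper q rho; exists M. Qed.

End GroupTranslations.

(** * Averages along a finite measure: adjoints, L^1 and L^2 bounds *)

Section AverageOperators.
Context {R : realType} {n : nat} (G : homogeneousGroup R n).
Notation V := 'rV[R]_n.
Notation lam := (@lebesgue R n).
Variables (mu : {finite_measure set V -> \bar R}) (b : R).
Hypothesis mub : mu (~` norm_ball b) = 0.
Implicit Types (x y z : V) (A B : set V) (r k : R) (f g : V -> R) (s : V -> V).

Definition mass : R := fine (mu setT).

Lemma mass_ge0 : 0 <= mass.
Proof. exact: fine_ge0. Qed.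

(** [s y] is the right shift performed at y: -y gives f * mu, y gives its adjoint, - dl r y the
    dilated averages, and z y a translated average. Boundedness on the ball carrying [mu] keeps the
    support of [Op s f] bounded. *)
Definition adm s := measurable_fun setT s /\
  exists b' : R, forall y, `|y| <= b -> `|s y| <= b'.

Definition Op s f x : R := (\int[mu]_y f (gmul G x (s y)))%R.

Lemma measurable_gmul_comp f x s : adm s -> bsupp f ->
  measurable_fun setT (fun y => f (gmul G x (s y))).
Proof.
move=> [ms _] bf; apply: (measurableT_comp (bsupp_measurable bf)).
exact: measurable_fun_gmul.
Qed.

Lemma Op_integrable f x s : adm s -> bsupp f ->
  mu.-integrable setT (EFin \o (fun y => f (gmul G x (s y)))).
Proof.
move=> as_ bf; have [M M0 [rho [fM _]]] := bsupp_bound bf.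
by apply: (@bounded_integrable _ _ _ _ _ M) => //; exact: measurable_gmul_comp.
Qed.

(** The indicator is 1 almost everywhere for [mu]; with it the integrand is dominated by a multiple
    of the indicator of a ball in x, which the applications of Fubini below require. *)
Lemma OpE s f x : adm s -> bsupp f ->
  Op s f x = (\int[mu]_y (f (gmul G x (s y)) * \1_(norm_ball b) y))%R.
Proof.
move=> as_ bf; rewrite /Op /Rintegral; congr fine.
have mh := measurable_gmul_comp x as_ bf.
apply: ae_eq_integral => //.
- exact/measurable_EFinP.
- apply/measurable_EFinP; apply: measurable_funM => //.
  by apply: measurable_indic; exact: measurable_norm_ball.
exists (~` norm_ball b); split => //.
  by apply: measurableC; exact: measurable_norm_ball.
move=> y /= h Bb; apply: h => _; congr EFin.
by rewrite indicE mem_set// mulr1.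
Qed.

Lemma Op_dom s f : adm s -> bsupp f -> exists M rho : R, 0 <= M /\
  forall x y, `|f (gmul G x (s y)) * \1_(norm_ball b) y| <= M * \1_(norm_ball rho) x.
Proof.
move=> [ms [b' hb']] bf; have [M M0 [rho [fM fr]]] := bsupp_bound bf.
have [K K0 hK] := gmul_bound G (Num.max rho b').
exists M, K; split => // x y.
rewrite normrM [X in _ * X]ger0_norm; last by rewrite indicE; case: (_ \in _).
rewrite indicE; case: (boolP (y \in _)) => [/set_mem yb|_]; last first.
  by rewrite mulr0 mulr_ge0// indicE; case: (_ \in _).
rewrite mulr1; have [->|f0] := eqVneq (f (gmul G x (s y))) 0.
  by rewrite normr0 mulr_ge0// indicE; case: (_ \in _).
rewrite indicE mem_set ?mulr1// /qball /=.
suff : `|x| <= K by [].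
rewrite -[x in leLHS](gmulK G (s y)); apply: hK; first by rewrite le_max fr.
by rewrite normrN le_max hb' ?orbT.
Qed.

Lemma measurable_Op_kernel s f : adm s -> bsupp f ->
  measurable_fun setT (fun p : V * V => f (gmul G p.1 (s p.2)) * \1_(norm_ball b) p.2).
Proof.
move=> [ms _] bf; apply: measurable_funM.
  apply: (measurableT_comp (bsupp_measurable bf)); apply: measurable_fun_gmul => //.
  by apply: (measurableT_comp ms); exact: measurable_snd.
have m1 : measurable_fun setT (\1_(norm_ball b) : V -> R).
  by apply: measurable_indic; exact: measurable_norm_ball.
exact: (measurableT_comp m1 measurable_snd).
Qed.

Lemma Op_bsupp s f : adm s -> bsupp f -> bsupp (Op s f).
Proof.
move=> as_ bf; have [M [rho [M0 h]]] := Op_dom as_ bf.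
have b0 := integrable_indic_ball M rho.
split.
  rewrite (_ : Op s f = fun x => (\int[mu]_y (f (gmul G x (s y)) * \1_(norm_ball b) y))%R); last first.
    by apply/funext => x; rewrite OpE.
  apply: (@measurable_dominated_xRintegral _ _ _ _ _ lam mu _
    (fun x => M * \1_(norm_ball rho) x) (fun=> 1) (measurable_Op_kernel as_ bf)) => //.
  - by move=> x; rewrite mulr_ge0// indicE; case: (_ \in _).
  - by move=> x y; rewrite mulr1; exact: h.
  - by apply: (@bounded_integrable _ _ _ _ _ 1) => // y; rewrite normr1.
exists (M * mass), rho => x; rewrite OpE//.
have i1 : mu.-integrable setT (EFin \o (fun y => f (gmul G x (s y)) * \1_(norm_ball b) y)).
  apply: (@bounded_integrable _ _ _ _ _ (M * \1_(norm_ball rho) x)); last exact: h.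
  apply: measurable_funM; first exact: measurable_gmul_comp.
  by apply: measurable_indic; exact: measurable_norm_ball.
apply: (le_trans (le_normr_Rintegral _ i1)) => //.
have -> : M * mass * \1_(norm_ball rho) x = (\int[mu]_y (M * \1_(norm_ball rho) x))%R.
  by rewrite Rintegral_cst// /mass mulrAC.
apply: le_Rintegral => //.
  by move/integrable_norm : i1.
apply: (@bounded_integrable _ _ _ _ _ `|M * \1_(norm_ball rho) x|) => //.
Qed.

Lemma OpD s f g : adm s -> bsupp f -> bsupp g ->
  Op s (fun x => f x + g x) = (fun x => Op s f x + Op s g x).
Proof.
move=> as_ bf bg; apply/funext => x; rewrite /Op RintegralD//; exact: Op_integrable.
Qed.

Lemma OpZ s f k : adm s -> bsupp f -> Op s (fun x => k * f x) = (fun x => k * Op s f x).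
Proof.
move=> as_ bf; apply/funext => x; rewrite /Op RintegralZl//; exact: Op_integrable.
Qed.

Lemma Op_le s f g x : adm s -> bsupp f -> bsupp g -> (forall y, f y <= g y) ->
  Op s f x <= Op s g x.
Proof.
by move=> as_ bf bg fg; apply: le_Rintegral => //; exact: Op_integrable.
Qed.

Lemma Op_le_restrict s f g x : adm s -> bsupp f -> bsupp g ->
  (forall y, `|y| <= b -> f (gmul G x (s y)) <= g (gmul G x (s y))) ->
  Op s f x <= Op s g x.
Proof.
move=> as_ bf bg fg; rewrite !OpE//; apply: le_Rintegral => //.
- have [M M0 [rho [fM _]]] := bsupp_bound bf.
  apply: (@bounded_integrable _ _ _ _ _ M) => [|y].
    apply: measurable_funM; first exact: measurable_gmul_comp.
    by apply: measurable_indic; exact: measurable_norm_ball.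
  by rewrite normrM indicE; case: (_ \in _); rewrite ?normr1 ?normr0 ?mulr1 ?mulr0.
- have [M M0 [rho [fM _]]] := bsupp_bound bg.
  apply: (@bounded_integrable _ _ _ _ _ M) => [|y].
    apply: measurable_funM; first exact: measurable_gmul_comp.
    by apply: measurable_indic; exact: measurable_norm_ball.
  by rewrite normrM indicE; case: (_ \in _); rewrite ?normr1 ?normr0 ?mulr1 ?mulr0.
move=> y _; rewrite !indicE; case: (boolP (y \in _)) => [/set_mem yb|_]; last by rewrite !mulr0.
by rewrite !mulr1 fg.
Qed.

Lemma Op_ge0 s f x : (forall y, 0 <= f y) -> 0 <= Op s f x.
Proof. by move=> f0; apply: Rintegral_ge0. Qed.

Lemma Op_abs s f x : adm s -> bsupp f -> `|Op s f x| <= Op s (fun y => `|f y|) x.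
Proof. by move=> as_ bf; apply: le_normr_Rintegral => //; exact: Op_integrable. Qed.

Lemma Op_bound s f x (M : R) : adm s -> bsupp f -> (forall y, `|f y| <= M) ->
  `|Op s f x| <= M * mass.
Proof.
move=> as_ bf fM; have i1 := Op_integrable x as_ bf.
apply: (le_trans (le_normr_Rintegral _ i1)) => //.
have -> : M * mass = (\int[mu]_y M)%R by rewrite Rintegral_cst.
apply: le_Rintegral => //; first by move/integrable_norm : i1.
by apply: (@bounded_integrable _ _ _ _ _ `|M|).
Qed.

Lemma adm_opp s : adm s -> adm (fun y => - s y).
Proof.
move=> [ms [b' hb']]; split; first exact: measurable_fun_oppV.
by exists b' => y /hb'; rewrite normrN.
Qed.

Lemma measurable_integ_kernel s f g : adm s -> bsupp f -> bsupp g ->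
  measurable_fun setT (fun y => integ (fun x => f (gmul G x (s y)) * g x) * \1_(norm_ball b) y).
Proof.
move=> as_ bf bg; have [M [rho [M0 h]]] := Op_dom as_ bf.
have [N N0 [rho' [gN gr]]] := bsupp_bound bg.
pose F (p : V * V) := f (gmul G p.2 (s p.1)) * \1_(norm_ball b) p.1 * g p.2.
have mF : measurable_fun setT F.
  have mk := measurableT_comp (measurable_Op_kernel as_ bf) (@measurable_swap _ _ V V).
  apply: (measurable_funM mk).
  exact: (measurableT_comp (bsupp_measurable bg) measurable_snd).
rewrite (_ : (fun y => _) = fun y => (\int[lam]_x F (y, x))%R); last first.
  apply/funext => y; rewrite /integ mulrC -RintegralZl//.
    by apply: eq_Rintegral => x _; rewrite /F /=; ring.
  apply: bsupp_integrable; apply: bsupp_mul => //.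
  exact: (bsupp_gmulr G (s y) bf).
apply: (@measurable_dominated_xRintegral _ _ _ _ _ mu lam F (fun=> 1)
  (fun x => M * N * \1_(norm_ball rho) x)) => //.
- by move=> x; rewrite !mulr_ge0// indicE; case: (_ \in _).
- by move=> y x; rewrite mul1r /F /= normrM mulrAC ler_pM.
- by apply: (@bounded_integrable _ _ _ _ _ 1) => // y; rewrite normr1.
- exact: integrable_indic_ball.
Qed.

Lemma integ_Op s f g : adm s -> bsupp f -> bsupp g ->
  integ (fun x => Op s f x * g x) =
  (\int[mu]_y (integ (fun x => f (gmul G x (s y)) * g x) * \1_(norm_ball b) y))%R.
Proof.
move=> as_ bf bg; have [M [rho [M0 h]]] := Op_dom as_ bf.
have [N N0 [rho' [gN gr]]] := bsupp_bound bg.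
pose F (p : V * V) := f (gmul G p.1 (s p.2)) * \1_(norm_ball b) p.2 * g p.1.
transitivity (integ (fun x => (\int[mu]_y F (x, y))%R)).
  apply: eq_integ => x; rewrite OpE// /F /= RintegralZr//.
  apply: (@bounded_integrable _ _ _ _ _ (M * \1_(norm_ball rho) x)); last exact: h.
  apply: measurable_funM; first exact: measurable_gmul_comp.
  by apply: measurable_indic; exact: measurable_norm_ball.
rewrite /integ (@dominated_Fubini _ _ _ _ _ lam mu F
  (fun x => M * N * \1_(norm_ball rho) x) (fun=> 1)); last first.
- by apply: (@bounded_integrable _ _ _ _ _ 1) => // y; rewrite normr1.
- exact: integrable_indic_ball.
- by move=> x y; rewrite mulr1 /F /= normrM mulrAC ler_pM.
- by move=> y.
- by move=> x; rewrite !mulr_ge0// indicE; case: (_ \in _).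
- have mk := measurable_Op_kernel as_ bf; apply: (measurable_funM mk).
  exact: (measurableT_comp (bsupp_measurable bg) measurable_fst).
apply: eq_Rintegral => y _; rewrite /F /= mulrC -RintegralZl//.
  by apply: eq_Rintegral => x _; ring.
apply: bsupp_integrable; apply: bsupp_mul => //.
exact: (bsupp_gmulr G (s y) bf).
Qed.

(** For each y, the right translation by - s y moves the shift from f to g. *)
Lemma Op_adjoint s f g : adm s -> bsupp f -> bsupp g ->
  integ (fun x => Op s f x * g x) = integ (fun x => f x * Op (fun y => - s y) g x).
Proof.
move=> as_ bf bg; rewrite (integ_Op as_ bf bg).
have -> : integ (fun x => f x * Op (fun y => - s y) g x) =
    integ (fun x => Op (fun y => - s y) g x * f x).
  by apply: eq_integ => x; rewrite mulrC.
rewrite (integ_Op (adm_opp as_) bg bf).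
apply: eq_Rintegral => y _; congr (_ * _).
rewrite -(integ_gmulr G (s y) (f := fun x => g (gmul G x (- s y)) * f x)); last first.
  by apply: bsupp_mul => //; exact: (bsupp_gmulr G (- s y) bg).
by apply: eq_integ => x; rewrite gmulK mulrC.
Qed.

Definition norm2 f := Num.sqrt (integ (fun x => f x ^+ 2)).

Lemma norm2_ge0 f : 0 <= norm2 f. Proof. exact: sqrtr_ge0. Qed.

Lemma sqr_norm2 f : norm2 f ^+ 2 = integ (fun x => f x ^+ 2).
Proof. by rewrite sqr_sqrtr// integ_ge0// => x; exact: sqr_ge0. Qed.

Lemma bsupp_sqr f : bsupp f -> bsupp (fun x => f x ^+ 2).
Proof. by move=> bf; have := bsupp_mul bf bf; under eq_fun do rewrite -expr2. Qed.

Lemma norm2_gmulr z f : bsupp f -> norm2 (fun x => f (gmul G x z)) = norm2 f.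
Proof. by move=> bf; rewrite /norm2 (integ_gmulr G z (bsupp_sqr bf)). Qed.

(** For each y, Cauchy-Schwarz and translation invariance bound the integral in x by norm2 f times
    norm2 g; Fubini then integrates this over [mu]. *)
Lemma integ_norm_Op s f g : adm s -> bsupp f -> bsupp g ->
  integ (fun x => `|Op s f x| * `|g x|) <= mass * (norm2 f * norm2 g).
Proof.
move=> as_ bf bg.
have bf' := bsupp_abs bf; have bg' := bsupp_abs bg.
apply: (@le_trans _ _ (integ (fun x => Op s (fun y => `|f y|) x * `|g x|))).
  apply: integ_le => [||x].
  - by apply: bsupp_mul => //; apply: bsupp_abs; exact: Op_bsupp.
  - by apply: bsupp_mul => //; exact: Op_bsupp.
  - by rewrite ler_wpM2r// Op_abs.
rewrite integ_Op//.
have -> : mass * (norm2 f * norm2 g) = (\int[mu]_y (norm2 f * norm2 g))%R.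
  by rewrite Rintegral_cst// mulrC.
have key y : 0 <= integ (fun x => `|f (gmul G x (s y))| * `|g x|) * \1_(norm_ball b) y <=
    norm2 f * norm2 g.
  have i0 : 0 <= integ (fun x => `|f (gmul G x (s y))| * `|g x|).
    by apply: integ_ge0 => x; rewrite mulr_ge0.
  apply/andP; split; first by rewrite mulr_ge0// indicE; case: (_ \in _).
  apply: (@le_trans _ _ (integ (fun x => `|f (gmul G x (s y))| * `|g x|))).
    by rewrite ler_piMr// indicE; case: (_ \in _).
  rewrite -(norm2_gmulr (s y) bf).
  exact: integ_norm_cauchy_schwarz (bsupp_gmulr G (s y) bf) bg.
apply: le_Rintegral => //.
- apply: (@bounded_integrable _ _ _ _ _ (norm2 f * norm2 g)); last first.
    by move=> y; have /andP[k1 k2] := key y; rewrite ger0_norm.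
  exact: measurable_integ_kernel as_ bf' bg'.
- by apply: (@bounded_integrable _ _ _ _ _ `|norm2 f * norm2 g|).
- by move=> y _; have /andP[] := key y.
Qed.

(** By duality: the bilinear bound is tested on g = Op s f. *)
Lemma norm2_Op s f : adm s -> bsupp f -> norm2 (Op s f) <= mass * norm2 f.
Proof.
move=> as_ bf; have bO := Op_bsupp as_ bf.
have := integ_norm_Op as_ bf bO.
have -> : integ (fun x => `|Op s f x| * `|Op s f x|) = norm2 (Op s f) ^+ 2.
  by rewrite sqr_norm2; apply: eq_integ => x; rewrite -normrM -expr2 ger0_norm ?sqr_ge0.
have [->|n0] := eqVneq (norm2 (Op s f)) 0.
  by rewrite mulr_ge0 ?mass_ge0 ?norm2_ge0.
rewrite mulrA expr2 ler_pM2r// lt_neqAle eq_sym n0 norm2_ge0//.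
Qed.

Lemma integ_Op_le s f : adm s -> bsupp f -> (forall x, 0 <= f x) ->
  integ (Op s f) <= mass * integ f.
Proof.
move=> as_ bf f0; have bO := Op_bsupp as_ bf.
have [M M0 [rho [_ hr]]] := bsupp_bound bO.
(* Replaces the constant 1, which is not of bounded support, as the test function; it equals 1
   wherever [Op s f] does not vanish. *)
have b1 : bsupp (\1_(norm_ball rho) : V -> R).
  by apply: (@bsupp_indic _ _ _ rho) => //; exact: measurable_norm_ball.
have -> : integ (Op s f) = integ (fun x => Op s f x * \1_(norm_ball rho) x).
  apply: eq_integ => x; have [->|/hr xr] := eqVneq (Op s f x) 0; first by rewrite mul0r.
  by rewrite indicE mem_set// mulr1.
rewrite integ_Op//.
have -> : mass * integ f = (\int[mu]_y (integ f))%R by rewrite Rintegral_cst// mulrC.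
have key y : 0 <= integ (fun x => f (gmul G x (s y)) * \1_(norm_ball rho) x) *
    \1_(norm_ball b) y <= integ f.
  have i0 : 0 <= integ (fun x => f (gmul G x (s y)) * \1_(norm_ball rho) x).
    by apply: integ_ge0 => x; rewrite mulr_ge0// indicE; case: (_ \in _).
  apply/andP; split; first by rewrite mulr_ge0// indicE; case: (_ \in _).
  apply: (@le_trans _ _ (integ (fun x => f (gmul G x (s y)) * \1_(norm_ball rho) x))).
    by rewrite ler_piMr// indicE; case: (_ \in _).
  have bt := bsupp_gmulr G (s y) bf.
  rewrite -(integ_gmulr G (s y) bf); apply: integ_le => //; first exact: bsupp_mul.
  by move=> x; rewrite ler_piMr// indicE; case: (_ \in _).
apply: le_Rintegral => //.
- apply: (@bounded_integrable _ _ _ _ _ (integ f)).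
    exact: measurable_integ_kernel as_ bf b1.
  by move=> y; have /andP[k1 k2] := key y; rewrite ger0_norm.
- by apply: (@bounded_integrable _ _ _ _ _ `|integ f|).
- by move=> y _; have /andP[] := key y.
Qed.

End AverageOperators.

(** * Averages over the cells of a measurable partition *)

Section ConditionalExpectation.
Context {R : realType} {n : nat} (G : homogeneousGroup R n).
Notation V := 'rV[R]_n.
Notation lam := (@lebesgue R n).
Implicit Types (x y z : V) (A B : set V) (r k : R) (f g h : V -> R).

Lemma measurable_fun_eqV d (T : measurableType d) (f g : T -> V) :
  measurable_fun setT f -> measurable_fun setT g -> measurable [set t | f t = g t].
Proof.
move=> mf mg; have mfg : measurable_fun setT (fun t => f t - g t).
  apply: measurable_fun_rVP => j.
  rewrite (_ : (fun t => _) = fun t => f t 0 j - g t 0 j); last first.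
    by apply/funext => t; rewrite !mxE.
  by apply: measurable_funB; [exact: (measurableT_comp (measurable_rV_coord j) mf)|
    exact: (measurableT_comp (measurable_rV_coord j) mg)].
have -> : [set t | f t = g t] = (fun t => f t - g t) @^-1` [set x | `|x| <= 0].
  apply/seteqP; split => t /=; first by move=> ->; rewrite subrr normr0.
  by rewrite normr_le0 subr_eq0 => /eqP.
by apply: measurable_preimage => //; exact: measurable_norm_ball.
Qed.

Variables (c : V -> V) (w0 : R).
Hypotheses (mc : measurable_fun setT c)
  (cbd : forall rho : R, exists rho', forall x y, c x = c y -> `|x| <= rho -> `|y| <= rho').

(** A partition is given by a map that is constant on its cells. Nesting of two partitions is then
    an implication between equations, and measurability of the cells is that of the map. *)
Definition cell x : set V := [set y | c x = c y].
Definition cellm x : R := integ (\1_(cell x) : V -> R).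
Hypotheses (w0_gt0 : 0 < w0) (cell_lb : forall x, w0 <= cellm x).

Lemma measurable_cell x : measurable (cell x).
Proof. by apply: measurable_fun_eqV => //; exact: measurable_cst. Qed.

Lemma bsupp_cell x : bsupp (\1_(cell x) : V -> R).
Proof.
have [rho' hr] := cbd `|x|.
apply: (@bsupp_indic _ _ _ rho'); first exact: measurable_cell.
by move=> y xy; exact: hr xy _.
Qed.

Lemma eq_cell x y : c x = c y -> cell x = cell y.
Proof. by move=> e; rewrite /cell e. Qed.

Lemma indic_cellC x y : \1_(cell x) y = \1_(cell y) x :> R.
Proof.
by rewrite !indicE; congr (nat_of_bool _)%:R; apply/idP/idP => /set_mem h; apply/mem_set.
Qed.

Lemma indic01 A x : 0 <= (\1_A x : R) <= 1.
Proof. by rewrite indicE; case: (_ \in _); rewrite lexx ler01. Qed.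

Lemma cellm_gt0 x : 0 < cellm x.
Proof. exact: lt_le_trans w0_gt0 (cell_lb x). Qed.

Lemma measurable_cell_indic :
  measurable_fun setT (fun p : V * V => \1_(cell p.1) p.2 : R).
Proof.
rewrite (_ : (fun p => _) = \1_[set p : V * V | c p.1 = c p.2]).
  apply: measurable_indic; apply: measurable_fun_eqV.
    exact: (measurableT_comp mc measurable_fst).
  exact: (measurableT_comp mc measurable_snd).
by apply/funext => p; rewrite !indicE; congr (nat_of_bool _)%:R;
  apply/idP/idP => /set_mem h; apply/mem_set.
Qed.

(** The cell average is written as an integral operator with a symmetric kernel, so that its
    self-adjointness and its measurability in x both come from Fubini. *)
Definition kern x y : R := \1_(cell x) y / cellm x.

Lemma kernC x y : kern x y = kern y x.
Proof.
rewrite /kern indicE (_ : \1_(cell y) x = \1_(cell x) y) ?indicE; last exact: indic_cellC.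
case: (boolP (y \in cell x)) => [/set_mem xy|_]; last by rewrite !mul0r.
by rewrite /cellm (eq_cell xy).
Qed.

Lemma kern_ge0 x y : 0 <= kern x y.
Proof.
by rewrite divr_ge0// ltW// cellm_gt0.
Qed.

Lemma kern_le x y : kern x y <= w0^-1 * \1_(cell x) y.
Proof.
rewrite /kern mulrC ler_wpM2r//.
by rewrite lef_pV2 ?posrE ?cellm_gt0.
Qed.

Lemma kern_neq0 x y : kern x y != 0 -> c x = c y.
Proof.
rewrite /kern indicE; case: (boolP (y \in cell x)) => [/set_mem//|_].
by rewrite mul0r eqxx.
Qed.

Lemma measurable_cellm : measurable_fun setT cellm.
Proof.
rewrite (_ : cellm = fun x => fine (\int[lam]_y (\1_(cell x) y)%:E)%E)//.
apply: measurableT_comp => //.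
apply: (@measurable_fun_fubini_tonelli_F _ _ _ _ _ lam
  (fun p : V * V => (\1_(cell p.1) p.2)%:E)) => //.
by apply/measurable_EFinP; exact: measurable_cell_indic.
Qed.

Lemma measurable_kern : measurable_fun setT (fun p : V * V => kern p.1 p.2).
Proof.
apply: measurable_funM; first exact: measurable_cell_indic.
rewrite (_ : (fun p => _) = (fun p : V * V => cellm p.1 `^ (-1))); last first.
  by apply/funext => p; rewrite powR_inv1// ltW// cellm_gt0.
apply: (measurableT_comp (measurable_powR (-1))).
exact: (measurableT_comp measurable_cellm measurable_fst).
Qed.

Lemma integ_kern x : integ (kern x) = 1.
Proof.
rewrite (_ : kern x = fun y => (cellm x)^-1 * \1_(cell x) y); last first.
  by apply/funext => y; rewrite /kern mulrC.
by rewrite integZ ?mulVf ?gt_eqF ?cellm_gt0//; exact: bsupp_cell.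
Qed.

Definition Ex f x : R := integ (fun y => kern x y * f y).

Lemma kern_dom f : bsupp f -> exists a, [/\ bsupp a, bsupp f &
  forall x y, `|kern x y * f y| <= `|a x| * `|f y| ].
Proof.
move=> bf; have [M M0 [rho [fM fr]]] := bsupp_bound bf.
have [rho' hr] := cbd rho.
exists (fun x => w0^-1 * \1_(norm_ball rho') x); split => //.
  by apply: bsuppZ; apply: (@bsupp_indic _ _ _ rho') => //; exact: measurable_norm_ball.
move=> x y; rewrite normrM; have [->|f0] := eqVneq (f y) 0; first by rewrite normr0 !mulr0.
rewrite ler_wpM2r//; have [->|k0] := eqVneq (kern x y) 0; first by rewrite normr0.
have xy := kern_neq0 k0.
rewrite [X in _ <= `|_ * X|]indicE mem_set; last by apply: (hr y x (esym xy)); exact: fr.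
have w1 : 0 <= w0^-1 by rewrite invr_ge0 ltW.
rewrite mulr1 (ger0_norm (kern_ge0 x y)) (ger0_norm w1).
rewrite (le_trans (kern_le x y))// ler_piMr//.
Qed.

Lemma measurable_kernM f : measurable_fun setT f ->
  measurable_fun setT (fun p : V * V => kern p.1 p.2 * f p.2).
Proof.
move=> mf; apply: measurable_funM; first exact: measurable_kern.
exact: (measurableT_comp mf measurable_snd).
Qed.

Lemma bsupp_kernM f x : bsupp f -> bsupp (fun y => kern x y * f y).
Proof.
move=> bf; have -> : (fun y => kern x y * f y) =
    (fun y => (cellm x)^-1 * (\1_(cell x) y * f y)).
  by apply/funext => y; rewrite /kern mulrA [_^-1 * _]mulrC.
by apply: bsuppZ; apply: bsupp_mul => //; exact: bsupp_cell.
Qed.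

Lemma bsupp_Ex f : bsupp f -> bsupp (Ex f).
Proof.
move=> bf; have [a [ba _ hd]] := kern_dom bf.
have bff := bsupp_abs bf.
apply: (bsupp_le (g := fun x => integ (fun y => `|f y|) * `|a x|)).
- exact: (measurable_integ_param (measurable_kernM (bsupp_measurable bf)) ba bf).
- move=> x; apply: (le_trans (integ_abs (bsupp_kernM x bf))).
  rewrite ger0_norm ?mulr_ge0 ?integ_ge0// mulrC -integZ//.
  apply: integ_le => //; first by apply: bsupp_abs; exact: bsupp_kernM.
  exact: bsuppZ.
- by apply: bsuppZ; exact: bsupp_abs.
Qed.

Lemma Ex_selfadjoint f g : bsupp f -> bsupp g ->
  integ (fun x => Ex f x * g x) = integ (fun x => f x * Ex g x).
Proof.
move=> bf bg; have [a [ba _ hd]] := kern_dom bf.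
transitivity (integ (fun x => integ (fun y => kern x y * f y * g x))).
  apply: eq_integ => x; rewrite mulrC -integZ; last exact: bsupp_kernM.
  by apply: eq_integ => y; rewrite mulrC.
rewrite (@integ_fubini _ _ (fun p => kern p.1 p.2 * f p.2 * g p.1) (fun x => a x * g x) f)//.
- apply: eq_integ => y; rewrite -integZ; last exact: bsupp_kernM.
  by apply: eq_integ => x /=; rewrite kernC; ring.
- apply: measurable_funM; first exact: measurable_kernM (bsupp_measurable bf).
  exact: (measurableT_comp (bsupp_measurable bg) measurable_fst).
- exact: bsupp_mul.
- move=> x y /=; rewrite normrM [in leRHS]normrM [in leRHS]mulrAC ler_wpM2r//.
Qed.

Lemma ExB f g : bsupp f -> bsupp g -> Ex (fun x => f x - g x) = (fun x => Ex f x - Ex g x).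
Proof.
move=> bf bg; apply/funext => x; rewrite /Ex -integB; [|exact: bsupp_kernM..].
by apply: eq_integ => y; rewrite mulrBr.
Qed.

Lemma Ex_ge0 f x : (forall y, 0 <= f y) -> 0 <= Ex f x.
Proof. by move=> f0; apply: integ_ge0 => y; rewrite mulr_ge0// kern_ge0. Qed.

Lemma eq_Ex f x y : c x = c y -> Ex f x = Ex f y.
Proof. by move=> e; rewrite /Ex /kern /cellm (eq_cell e). Qed.

End ConditionalExpectation.

(** * Nested cells from a maximal separated net *)

Section NestedCells.
Context {R : realType} {n : nat} (G : homogeneousGroup R n) (q : quasiNorm G).
Hypothesis qN : forall x, q (- x) = q x.
Notation V := 'rV[R]_n.
Notation lam := (@lebesgue R n).
Implicit Types (x y z w : V) (A B : set V) (r k : R).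

Definition dist x y : R := q (gmul G (- x) y).

Lemma distC x y : dist x y = dist y x.
Proof. by rewrite /dist -qN gmulN opprK. Qed.

Lemma distxx x : dist x x = 0.
Proof. by rewrite /dist gmulNx qnorm0. Qed.

Lemma dist_dl r x y : 0 < r -> dist (dl G r x) (dl G r y) = r * dist x y.
Proof. by move=> r0; rewrite /dist -dlN -dl_gmul// qnorm_dl. Qed.

Lemma dist_gmul x z : dist x (gmul G x z) = q z.
Proof. by rewrite /dist gmulKV. Qed.

Lemma qtriangle : {c : R | 1 <= c & forall x y, q (gmul G x y) <= c * (q x + q y)}.
Proof. by apply: cid2; exact: qnorm_triangle. Qed.

Definition ctri : R := s2val qtriangle.

Lemma ctri_ge1 : 1 <= ctri.
Proof. exact: s2valP qtriangle. Qed.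

Lemma ctri_gt0 : 0 < ctri.
Proof. exact: lt_le_trans ctri_ge1. Qed.

Lemma dist_triangle x y z : dist x z <= ctri * (dist x y + dist y z).
Proof.
rewrite {1}/dist (_ : gmul G (- x) z = gmul G (gmul G (- x) y) (gmul G (- y) z)).
  exact: s2valP' qtriangle _ _.
by rewrite -gmulA gmulVK.
Qed.

Lemma measurable_dist d (T : measurableType d) (f g : T -> V) :
  measurable_fun setT f -> measurable_fun setT g ->
  measurable_fun setT (fun t => dist (f t) (g t)).
Proof.
move=> mf mg; apply: (measurableT_comp (measurable_qnorm q)).
by apply: measurable_fun_gmul => //; exact: measurable_fun_oppV.
Qed.

Lemma measurable_dist_le x r : measurable [set y | dist x y <= r].
Proof.
rewrite (_ : [set y | _] = (fun y => dist x y) @^-1` `]-oo, r]%classic).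
  by apply: measurable_preimage => //; apply: measurable_dist => //; exact: measurable_cst.
by apply/seteqP; split => y; rewrite /= in_itv.
Qed.

Definition ratpt (k : nat) : V :=
  map_mx ratr (odflt (0 : 'rV[rat]_n) (unpickle k)).

(** Density holds in the norm; the Lipschitz bound on the product and [qnorm_le_norm] carry it over
    to the quasi-distance. The radius [e] is chosen so that C (L e)^a <= 1/2. *)
Lemma ratpt_dense x : exists k : nat, dist (ratpt k) x < 1.
Proof.
have [L L0 hL] := locally_lipschitz_gmul G (`|x| + 1).
have [C [a [C0 a0 hC]]] := qnorm_le_norm q L.
pose e := Num.min 1 ((2 * C)^-1 `^ a^-1 / (L + 1)).
have L1 : 0 < L + 1 by rewrite ltr_wpDl.
have e0 : 0 < e by rewrite lt_min ltr01 divr_gt0// powR_gt0// invr_gt0 mulr_gt0.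
have [p hp] := rat_ball_rV x e0.
exists (pickle p); rewrite /ratpt pickleK /=; set y := map_mx ratr p in hp *.
have xy1 : `|x - y| < 1 by rewrite (lt_le_trans hp)// ge_min lexx.
have xy2 : `|x - y| * (L + 1) < (2 * C)^-1 `^ a^-1.
  by rewrite -ltr_pdivlMr// (lt_le_trans hp)// ge_min lexx orbT.
have yx : `|y| <= `|x| + 1.
  by rewrite -(subKr x y) (le_trans (ler_normB _ _))// lerD2l ltW.
have h : `|gmul G (- y) x| <= L * `|x - y|.
  have := hL (- y) (- y) x y; rewrite gmulNx !subr0 subrr normr0 add0r normrN.
  by apply => //; rewrite lerDl.
rewrite /dist (le_lt_trans (hC _ _))//.
  by rewrite (le_trans h)// ler_piMr// ltW.
have h' : `|gmul G (- y) x| <= (2 * C)^-1 `^ a^-1.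
  rewrite (le_trans h)// (le_trans _ (ltW xy2))// mulrC ler_wpM2l//.
  by rewrite lerDl.
apply: (@le_lt_trans _ _ (C * (2 * C)^-1)).
  rewrite ler_pM2l//; apply: (@le_trans _ _ (((2 * C)^-1 `^ a^-1) `^ a)).
    by apply: ge0_ler_powR; rewrite ?nnegrE ?powR_ge0// ltW.
  by rewrite -powRrM mulVf ?gt_eqF// powRr1// invr_ge0 mulr_ge0// ltW.
by rewrite invfM mulrCA mulfV ?gt_eqF// mulr1 invf_lt1// ltr1n.
Qed.

(** Greedy selection along the enumeration of the rational points. Whether a point is kept depends
    on those kept earlier, hence a list as the result of the recursion; the points kept altogether
    form a maximal 1-separated set of rational points. *)
Fixpoint kept_before (k : nat) : seq nat :=
  if k is k'.+1 then
    if all (fun m => 1 <= dist (ratpt m) (ratpt k')) (kept_before k')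
    then k' :: kept_before k' else kept_before k'
  else [::].

Definition kept (k : nat) := all (fun m => 1 <= dist (ratpt m) (ratpt k)) (kept_before k).

Lemma mem_kept_before (m k : nat) : (m \in kept_before k) = (m < k)%N && kept m.
Proof.
elim: k => [//|k IH] /=; rewrite -/(kept k) ltnS leq_eqVlt.
case: (boolP (kept k)) => hk; rewrite ?inE IH.
  by have [->|mk] := eqVneq m k; rewrite /= ?hk.
by have [->|mk] := eqVneq m k; rewrite /= ?(negbTE hk) ?ltnn.
Qed.

Lemma kept_separated (m k : nat) : kept m -> kept k -> m != k -> 1 <= dist (ratpt m) (ratpt k).
Proof.
wlog mk : m k / (m < k)%N.
  move=> H hm hk; rewrite neq_ltn => /orP[mk|km].
    by apply: H => //; rewrite ltn_eqF.
  by rewrite distC; apply: H => //; rewrite ltn_eqF.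
by move=> hm /allP hk _; apply: hk; rewrite mem_kept_before mk.
Qed.

(** A rational point within 1 of x is either kept or within 1 of a kept one; in the second case the
    quasi-triangle inequality gives ctri (1 + 1). *)
Lemma kept_cover x : exists k : nat, kept k /\ dist (ratpt k) x <= 2 * ctri.
Proof.
have [k hk] := ratpt_dense x; have c1 := ctri_ge1.
case: (boolP (kept k)) => [kk|].
  by exists k; split => //; rewrite (le_trans (ltW hk))//; lra.
move=> /allPn[m]; rewrite mem_kept_before => /andP[_ km]; rewrite -ltNge => mk.
exists m; split => //; rewrite (le_trans (dist_triangle _ (ratpt k) _))//.
rewrite mulrC ler_pM2r ?ctri_gt0//; lra.
Qed.

(** Two net points within this distance of a common point would be at distance at most ctri (net_in
    + net_in) = 1/2 from each other, below their separation 1. *)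
Definition net_in : R := (4 * ctri)^-1.

Definition near_net x : Prop := exists m : nat, kept m /\ dist (ratpt m) x <= net_in.

(* Points within [net_in] of a net point are sent to it, so that every fiber of
   [net_proj] contains a ball. *)
Definition net_sel (k : nat) x : Prop :=
  kept k /\ ((near_net x /\ dist (ratpt k) x <= net_in) \/
             (~ near_net x /\ dist (ratpt k) x <= 2 * ctri)).

Lemma net_sel_ex x : exists k : nat, `[< net_sel k x >].
Proof.
have [nx|nx] := pselect (near_net x).
  by have [m [km mx]] := nx; exists m; apply/asboolP; split => //; left.
by have [k [kk kx]] := kept_cover x; exists k; apply/asboolP; split => //; right.
Qed.

Definition net_index x : nat := ex_minn (net_sel_ex x).

Definition net_proj x : V := ratpt (net_index x).

Lemma net_indexP x : net_sel (net_index x) x.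
Proof. by rewrite /net_index; case: ex_minnP => m /asboolP. Qed.

Lemma net_in_gt0 : 0 < net_in.
Proof. by rewrite invr_gt0 mulr_gt0// ctri_gt0. Qed.

Lemma net_proj_dist x : dist (net_proj x) x <= 2 * ctri.
Proof.
have [_ [[_ h]|[_ h]]] := net_indexP x => //.
have c1 := ctri_ge1; rewrite (le_trans h)// /net_in.
rewrite (@le_trans _ _ 1)//; last lra.
rewrite invf_le1 ?mulr_gt0 ?ctri_gt0//; lra.
Qed.

Lemma net_proj_fix x w : dist (net_proj x) w <= net_in -> net_proj w = net_proj x.
Proof.
move=> xw; have [kx _] := net_indexP x.
have nw : near_net w by exists (net_index x).
have [kw [[_ hw]|[//]]] := net_indexP w.
congr ratpt; apply/eqP; apply: contraT => ne.
have := kept_separated kw kx ne.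
have c0 := ctri_gt0.
have := dist_triangle (ratpt (net_index w)) w (ratpt (net_index x)).
rewrite [X in _ <= ctri * (_ + X)]distC => h1 h2.
have : ctri * (dist (ratpt (net_index w)) w + dist (ratpt (net_index x)) w) <= 2^-1.
  rewrite (@le_trans _ _ (ctri * (net_in + net_in)))//.
    by rewrite ler_pM2l//; apply: lerD; [exact: hw|exact: xw].
  rewrite /net_in; have -> : ctri * ((4 * ctri)^-1 + (4 * ctri)^-1) = 2^-1.
    by field; rewrite gt_eqF.
  exact: lexx.
move=> h3; have := le_trans h2 (le_trans h1 h3).
by rewrite leNgt invf_lt1 ?ltr1n.
Qed.

Lemma measurable_net_sel (k : nat) : measurable [set x | net_sel k x].
Proof.
have mn : measurable [set x | near_net x].
  rewrite (_ : [set x | _] = \bigcup_m (if kept m then [set x | dist (ratpt m) x <= net_in] else set0)).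
    by apply: bigcupT_measurable => m; case: (kept m) => //; exact: measurable_dist_le.
  apply/seteqP; split => [x [m [km mx]]|x [m _]].
    by exists m => //; rewrite km.
  by case: (boolP (kept m)) => // km mx; exists m.
case: (boolP (kept k)) => kk; last first.
  rewrite (_ : [set x | _] = set0)//.
  by apply/seteqP; split => // x [h]; rewrite h in kk.
rewrite (_ : [set x | _] = ([set x | near_net x] `&` [set x | dist (ratpt k) x <= net_in])
   `|` (~` [set x | near_net x] `&` [set x | dist (ratpt k) x <= 2 * ctri])).
  apply: measurableU; apply: measurableI => //; try exact: measurable_dist_le.
  exact: measurableC.
by apply/seteqP; split => x /=; rewrite /net_sel; tauto.
Qed.

Lemma measurable_net_proj : measurable_fun setT net_proj.
Proof.
move=> _ Y mY; rewrite setTI.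
have mi (k : nat) : measurable [set x | net_index x = k].
  rewrite (_ : [set x | _] = [set x | net_sel k x] `&`
     \bigcap_(m in [set m | (m < k)%N]) ~` [set x | net_sel m x]).
    apply: measurableI; first exact: measurable_net_sel.
    by apply: bigcap_measurableType => m _; apply: measurableC; exact: measurable_net_sel.
  apply/seteqP; split => x /=.
    rewrite /net_index; case: ex_minnP => m /asboolP sm mm <-; split => // j /= jm sj.
    by have := mm j (asboolT sj); rewrite leqNgt jm.
  move=> [sk hk]; rewrite /net_index; case: ex_minnP => m /asboolP sm mm.
  apply/eqP; rewrite eqn_leq mm ?asboolT//= leqNgt; apply/negP => mk.
  exact: hk mk sm.
rewrite (_ : net_proj @^-1` Y = \bigcup_(k in [set k | Y (ratpt k)]) [set x | net_index x = k]).
  by apply: bigcup_measurable => k _; exact: mi.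
apply/seteqP; split => [x Yx|x [k /= Yk xk]]; first by exists (net_index x).
by rewrite /net_proj xk.
Qed.

Section Levels.
Variables (theta ratio : R).
Hypotheses (theta_gt0 : 0 < theta) (ratio_big : 32 * ctri ^+ 4 <= ratio).

Definition scale (i : nat) : R := theta * ratio ^+ i.

Lemma ratio_ge1 : 1 <= ratio.
Proof.
apply: le_trans ratio_big; have := exprn_ege1 4 ctri_ge1; lra.
Qed.

Lemma ratio_gt0 : 0 < ratio.
Proof. exact: lt_le_trans ratio_ge1. Qed.

Lemma scale_gt0 i : 0 < scale i.
Proof. by rewrite mulr_gt0// exprn_gt0// ratio_gt0. Qed.

Lemma scaleS i : scale i.+1 = ratio * scale i.
Proof. by rewrite /scale exprS mulrCA. Qed.

Lemma scale_le i j : (i <= j)%N -> scale i <= scale j.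
Proof. by move=> ij; rewrite ler_pM2l// ler_weXn2l// ratio_ge1. Qed.

Definition proj_at (i : nat) x : V :=
  dl G (scale i) (net_proj (dl G (scale i)^-1 x)).

Lemma proj_at_dist i x : dist (proj_at i x) x <= 2 * ctri * scale i.
Proof.
have s0 := scale_gt0 i.
rewrite -[x in leLHS](dlVK G s0) dist_dl// mulrC ler_pM2r//.
by rewrite dlVK// net_proj_dist.
Qed.

Lemma proj_at_fix i x w : dist (proj_at i x) w <= net_in * scale i ->
  proj_at i w = proj_at i x.
Proof.
have s0 := scale_gt0 i.
rewrite -[w in dist _ w](dlVK G s0) dist_dl// mulrC ler_pM2r// => /net_proj_fix e.
by rewrite /proj_at e.
Qed.

Lemma measurable_proj_at i : measurable_fun setT (proj_at i).
Proof.
apply: measurableT_comp; first exact: measurable_dl.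
apply: measurableT_comp; first exact: measurable_net_proj.
exact: measurable_dl.
Qed.

(** Level i + 1 projects the centre of level i and not the point itself. This makes the cells nested
    by construction, at the price of an error that accumulates over the levels and is controlled by
    [cen_dist]. *)
Fixpoint cen (i : nat) x : V :=
  if i is j.+1 then proj_at i (cen j x) else proj_at 0 x.

Lemma measurable_cen i : measurable_fun setT (cen i).
Proof.
elim: i => [|i IH]; first exact: measurable_proj_at.
exact: (measurableT_comp (measurable_proj_at i.+1) IH).
Qed.

Lemma cen_nested i j x y : (i <= j)%N -> cen i x = cen i y -> cen j x = cen j y.
Proof.
move=> /subnK <-; elim: (j - i)%N => [//|k IH] h.
by rewrite addSn /= IH.
Qed.

(** The error of level i + 1 is at most ctri times the sum of 2 ctri scale(i + 1) and the error of
    level i; the constant 4 ctri^2 reproduces itself because 2 ctri <= ratio. *)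
Lemma cen_dist i x : dist (cen i x) x <= 4 * ctri ^+ 2 * scale i.
Proof.
have c1 := ctri_ge1; have c0 := ctri_gt0.
elim: i => [|i IH].
  apply: (le_trans (proj_at_dist 0 x)); rewrite ler_pM2r ?scale_gt0//.
  rewrite expr2; nra.
rewrite [cen _ _]/=; apply: (le_trans (dist_triangle _ (cen i x) _)).
apply: (@le_trans _ _ (ctri * (2 * ctri * scale i.+1 + 4 * ctri ^+ 2 * scale i))).
  by rewrite ler_pM2l// lerD// proj_at_dist.
have s0 := scale_gt0 i; rewrite scaleS.
have -> : ctri * (2 * ctri * (ratio * scale i) + 4 * ctri ^+ 2 * scale i) =
  (2 * ctri ^+ 2 * ratio + 4 * ctri ^+ 3) * scale i by ring.
have -> : 4 * ctri ^+ 2 * (ratio * scale i) = 4 * ctri ^+ 2 * ratio * scale i by ring.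
rewrite ler_pM2r//.
have c2 : 1 <= ctri ^+ 2 by rewrite exprn_ege1.
have c3 : 0 < ctri ^+ 3 by rewrite exprn_gt0.
have r0 := ratio_gt0.
have c2r : 2 * ctri <= ratio.
  apply: le_trans ratio_big.
  have : ctri <= ctri ^+ 4 by rewrite -[leLHS]expr1 ler_weXn2l.
  by move: (ctri ^+ 4) (ctri) c0 => a b; lra.
have : ctri ^+ 2 * (2 * ctri) <= ctri ^+ 2 * ratio by rewrite ler_pM2l// exprn_gt0.
move: (ratio) (ctri) => a b; nra.
Qed.

(** The centre of w at the previous level must stay within net_in scale(i) of [cen i x], where the
    projection is constant. The given radius uses up half of this, and the accumulated error 4
    ctri^3 scale(i - 1) fits into the other half exactly when 32 ctri^4 <= ratio; this is the origin
    of [ratio_big]. *)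
Lemma cen_ball i x w : dist (cen i x) w <= net_in / (2 * ctri) * scale i -> cen i w = cen i x.
Proof.
have c1 := ctri_ge1; have c0 := ctri_gt0; have n0 := net_in_gt0.
have s0 := scale_gt0 i.
have n1 : net_in / (2 * ctri) <= net_in.
  by rewrite ler_pdivrMr ?mulr_gt0// ler_peMr//; lra.
case: i s0 => [|i] s0 h.
  by apply: proj_at_fix; rewrite (le_trans h)// ler_pM2r.
apply: proj_at_fix; apply: (le_trans (dist_triangle _ w _)).
apply: (@le_trans _ _ (ctri * (net_in / (2 * ctri) * scale i.+1 + 4 * ctri ^+ 2 * scale i))).
  by rewrite ler_pM2l// lerD// distC cen_dist.
have si := scale_gt0 i; rewrite scaleS.
have -> : ctri * (net_in / (2 * ctri) * (ratio * scale i) + 4 * ctri ^+ 2 * scale i) =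
   (net_in / 2 * ratio + 4 * ctri ^+ 3) * scale i by field; rewrite gt_eqF.
rewrite mulrA ler_pM2r//.
suff : 8 * ctri ^+ 3 <= net_in * ratio by lra.
rewrite /net_in [leRHS]mulrC ler_pdivlMr ?mulr_gt0//.
apply: le_trans ratio_big; rewrite le_eqVlt; apply/orP; left; apply/eqP; ring.
Qed.

End Levels.

End NestedCells.

(** * Integration against a measure with a density *)

Section DensityIntegral.
Import HBNNSimple.
Context d (T : measurableType d) (R : realType).
Variables (l m : {measure set T -> \bar R}) (h : T -> R).
Hypotheses (mh : measurable_fun setT h) (h0 : forall x, 0 <= h x)
  (mE : forall A, measurable A -> m A = (\int[l]_(x in A) (h x)%:E)%E).

(** Verified on simple functions; both sides pass to the limit by monotone convergence. *)
Lemma ge0_integral_density (f : T -> \bar R) : measurable_fun setT f ->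
  (forall x, 0 <= f x)%E ->
  (\int[m]_x f x = \int[l]_x (f x * (h x)%:E))%E.
Proof.
move=> mf f0.
pose f_ := nnsfun_approx measurableT mf.
have mhE : measurable_fun setT (fun x => (h x)%:E) by exact/measurable_EFinP.
transitivity (limn (fun k => \int[m]_x (f_ k x)%:E)%E).
  rewrite -monotone_convergence//.
  - by apply: eq_integral => x _; apply/esym/cvg_lim => //; exact: cvg_nnsfun_approx.
  - by move=> k; exact/measurable_EFinP.
  - by move=> k x _; rewrite lee_fin.
  - by move=> x _ i j ij; rewrite lee_fin; exact/lefP/nd_nnsfun_approx.
transitivity (limn (fun k => \int[l]_x ((f_ k x)%:E * (h x)%:E))%E); last first.
  rewrite -monotone_convergence//.
  - apply: eq_integral => x _; apply/cvg_lim => //.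
    apply: cvgeZr => //; exact: cvg_nnsfun_approx.
  - by move=> k; apply: emeasurable_funM => //; exact/measurable_EFinP.
  - by move=> k x _; rewrite mule_ge0// lee_fin.
  - move=> x _ i j ij; rewrite lee_wpmul2r ?lee_fin//.
    exact/lefP/nd_nnsfun_approx.
congr (limn _); apply/funext => k.
have fE x : f_ k x = \sum_(y \in range (f_ k)) (y * \1_(f_ k @^-1` [set y]) x) by rewrite {1}fimfunE.
under eq_integral do rewrite fE -fsumEFin//.
rewrite ge0_integral_fsum//; last 2 first.
- by move=> y; apply/measurable_EFinP; exact: measurable_funM.
- by move=> y x _; rewrite nnfun_muleindic_ge0.
under [RHS]eq_integral => x _.
  rewrite fE -fsumEFin// ge0_mule_fsuml; last by move=> y; exact: nnfun_muleindic_ge0.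
  over.
rewrite ge0_integral_fsum//; last 2 first.
- move=> y; apply: emeasurable_funM => //; apply/measurable_EFinP; exact: measurable_funM.
- move=> y x _; apply: mule_ge0; last by rewrite lee_fin.
  by rewrite EFinM; exact: nnfun_muleindic_ge0.
apply: eq_fsbigr => y /set_mem [x0 _ yx0].
have mA : measurable (f_ k @^-1` [set y]) by [].
have y0 : 0 <= y by rewrite -yx0.
rewrite (_ : (fun x => _) = (fun x => y%:E * (\1_(f_ k @^-1` [set y]) x)%:E)%E); last first.
  by apply/funext => x; rewrite EFinM.
rewrite ge0_integralZl//; last exact/measurable_EFinP.
rewrite integral_indic// setIT mE//.
rewrite [RHS](_ : _ = \int[l]_x (y%:E * ((\1_(f_ k @^-1` [set y]) x)%:E * (h x)%:E)))%E; last first.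
  by apply: eq_integral => x _; rewrite EFinM muleA.
rewrite ge0_integralZl//; last 2 first.
- by apply: emeasurable_funM => //; exact/measurable_EFinP.
- by move=> x _; rewrite mule_ge0 ?lee_fin.
congr (_ * _)%E; rewrite integral_mkcond; apply: eq_integral => x _.
by rewrite patchE indicE; case: ifP => xA; rewrite ?mul1e ?mul0e.
Qed.

Lemma integrable_density : (m setT < +oo)%E -> l.-integrable setT (EFin \o h).
Proof.
move=> mfin; apply/integrableP; split; first exact/measurable_EFinP.
by under eq_integral do rewrite gee0_abs ?lee_fin//; rewrite -mE.
Qed.

Lemma Rintegral_density (f : T -> R) (M : R) : (m setT < +oo)%E ->
  measurable_fun setT f -> (forall x, `|f x| <= M) ->
  (\int[m]_x f x = \int[l]_x (f x * h x))%R.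
Proof.
move=> mfin mf fM.
have fp : measurable_fun setT (fun x => Num.max (f x) 0) by exact: measurable_maxr.
have fn : measurable_fun setT (fun x => Num.max (- f x) 0).
  by apply: measurable_maxr => //; exact: measurableT_comp.
have i1 (g : T -> R) : measurable_fun setT g -> (forall x, `|g x| <= M) -> m.-integrable setT (EFin \o g).
  move=> mg gM; apply: measurable_bounded_integrable => //.
  by exists M; split; [exact: num_real|move=> N MN x _; exact: le_trans (gM x) (ltW MN)].
have M0 (x : T) : 0 <= M by rewrite (le_trans _ (fM x)).
have bp x : `|Num.max (f x) 0| <= M.
  by rewrite ger0_norm ?le_max ?lexx ?orbT// ge_max (M0 x) andbT (le_trans (ler_norm _)).
have bn x : `|Num.max (- f x) 0| <= M.
  by rewrite ger0_norm ?le_max ?lexx ?orbT// ge_max (M0 x) andbT (le_trans (ler_norm _))// normrN.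
have ih := integrable_density mfin.
have i2 (g : T -> R) : measurable_fun setT g -> (forall x, `|g x| <= M) ->
    l.-integrable setT (EFin \o (fun x => g x * h x)).
  move=> mg gM; apply: (le_integrable _ _ _ (integrableZl _ M ih)) => //.
    by apply/measurable_EFinP; exact: measurable_funM.
  by move=> x _; rewrite lee_fin !normrM ler_wpM2r// (le_trans (gM x))// ler_norm.
have fE x : f x = Num.max (f x) 0 - Num.max (- f x) 0.
  by rewrite !maxEle oppr_le0; case: (ltrgtP (f x) 0) => [_|_|->];
    rewrite ?subr0 ?sub0r ?opprK ?oppr0.
have main (g : T -> R) : measurable_fun setT g -> (forall x, 0 <= g x) ->
    (\int[m]_x g x = \int[l]_x (g x * h x))%R.
  move=> mg g0; rewrite /Rintegral ge0_integral_density//.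
  by apply/measurable_EFinP.
transitivity (\int[m]_x (Num.max (f x) 0 - Num.max (- f x) 0))%R.
  by apply: eq_Rintegral => x _; exact: fE.
rewrite RintegralB//; [|exact: i1..].
rewrite !main//; try by move=> x; rewrite le_max lexx orbT.
rewrite -RintegralB//; [|exact: i2..].
by apply: eq_Rintegral => x _; rewrite -mulrBl -fE.
Qed.

End DensityIntegral.

(** * Iterated convolutions as words in f -> f * mu and its adjoint *)

Section IteratedConvolution.
Context {R : realType} {n : nat} (G : homogeneousGroup R n).
Notation V := 'rV[R]_n.
Notation lam := (@lebesgue R n).
Variables (mu : {finite_measure set V -> \bar R}) (b : R).
Hypothesis mub : mu (~` norm_ball b) = 0.
Implicit Types (x y z : V) (A B : set V) (r k : R) (f g v w : V -> R).

Definition T0 f : V -> R := Op G mu (fun y => - y) f.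
Definition T1 f : V -> R := Op G mu (fun y => y) f.

Lemma adm_id : adm b (fun y : V => y).
Proof. by split => //; exists b. Qed.

Lemma adm_neg : adm b (fun y : V => - y).
Proof. exact: adm_opp adm_id. Qed.

Lemma bsupp_T0 f : bsupp f -> bsupp (T0 f).
Proof. by move=> bf; exact: Op_bsupp mub _ _ adm_neg bf. Qed.

Lemma bsupp_T1 f : bsupp f -> bsupp (T1 f).
Proof. by move=> bf; exact: Op_bsupp mub _ _ adm_id bf. Qed.

(** [word j] is convolution with mu^(j+1): [T1] stands for a factor mu~ and [T0] for a factor mu.
    The parity test is that of [iter_mconv]. *)
Fixpoint word (j : nat) f : V -> R :=
  if j is i.+1 then (if odd i then T1 (word i f) else T0 (word i f)) else T1 f.

Lemma bsupp_word j f : bsupp f -> bsupp (word j f).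
Proof.
move=> bf; elim: j => [|j IH] /=; first exact: bsupp_T1.
by case: (odd j); [exact: bsupp_T1|exact: bsupp_T0].
Qed.

Lemma Rintegral_pushforward d1 d2 (X : measurableType d1) (Y : measurableType d2)
    (m : {measure set X -> \bar R}) (phi : X -> Y) (f : Y -> R) :
  measurable_fun setT phi -> measurable_fun setT f ->
  m.-integrable setT (EFin \o (f \o phi)) ->
  fine (\int[pushforward m phi]_y (f y)%:E)%E = (\int[m]_x f (phi x))%R.
Proof.
move=> mphi mf intf; rewrite (integral_pushforward mphi (f := EFin \o f))//.
exact/measurable_EFinP.
Qed.

Lemma reflection_finite : {nu : {finite_measure set V -> \bar R} |
  (nu : set V -> \bar R) = reflection G mu &
  forall f x, bsupp f -> (\int[nu]_y f (gmul G x (- y)) = T1 f x)%R}.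
Proof.
have mo : measurable_fun setT (ginv G) by exact: measurable_oppV.
pose m0 : {measure set V -> \bar R} :=
  measure_function_pushforward__canonical__measure_function_Measure mu mo.
have fin : fin_num_fun m0.
  by move=> A mA; apply: fin_num_measure; exact: measurable_preimage.
exists (finite_pack fin) => // f x bf.
have [M M0 [rho [fM _]]] := bsupp_bound bf.
rewrite /Rintegral /finite_pack.
rewrite (@Rintegral_pushforward _ _ _ _ mu (ginv G) (fun y => f (gmul G x (- y))))//.
- by apply: eq_Rintegral => y _; rewrite /ginv opprK.
- apply: (measurableT_comp (bsupp_measurable bf)).
  by apply: measurable_fun_gmul => //; exact: measurable_oppV.
apply: (@bounded_integrable _ _ _ _ _ M) => [|y]; last exact: fM.
apply: (measurableT_comp (bsupp_measurable bf)).
by apply: measurable_fun_gmul => //; apply: measurable_fun_oppV.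
Qed.

(** The inverse of a product is the reversed product of inverses, so by Fubini convolving with m *
    nu is convolving with m and then with nu. The structure of a finite measure is built along the
    induction, as each next product needs it. *)
Lemma iter_mconv_word j : {m : {finite_measure set V -> \bar R} |
  (m : set V -> \bar R) = iter_mconv G mu j &
  forall f x, bsupp f -> (\int[m]_y f (gmul G x (- y)) = word j f x)%R}.
Proof.
have [refl reflE reflI] := reflection_finite.
elim: j => [|j [m mE mI]]; first by exists refl.
pose nu : {finite_measure set V -> \bar R} := if odd j then refl else mu.
have nuE : (nu : set V -> \bar R) = if odd j then reflection G mu else mu.
  by rewrite /nu; case: (odd j).
have nuI f x : bsupp f -> (\int[nu]_y f (gmul G x (- y)))%R =
    if odd j then T1 f x else T0 f x.
  by rewrite /nu; case: (odd j) => bf //; exact: reflI.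
have mg := measurable_gmul G.
pose m0 : {measure set V -> \bar R} :=
  measure_function_pushforward__canonical__measure_function_Measure (m \x nu)%E mg.
have fin : fin_num_fun m0.
  move=> A mA; rewrite ge0_fin_numE//.
  apply: (@le_lt_trans _ _ ((m \x nu)%E setT)).
      have -> : m0 A = (m \x nu)%E ((fun p => gmul G p.1 p.2) @^-1` A) by [].
    by apply: le_measure; rewrite ?inE//; exact: (measurable_preimage mg mA).
  rewrite -setXTT product_measure1E// ltey_eq fin_numM// fin_num_measure//.
exists (finite_pack fin).
  by rewrite /finite_pack /m0 /= /mconv mE nuE; case: (odd j).
move=> f x bf; rewrite /Rintegral /finite_pack.
have [M M0 [rho [fM _]]] := bsupp_bound bf.
have mf1 : measurable_fun setT (fun y => f (gmul G x (- y))).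
  apply: (measurableT_comp (bsupp_measurable bf)).
  by apply: measurable_fun_gmul => //; exact: measurable_oppV.
have mF : measurable_fun setT (fun p : V * V => f (gmul G x (- gmul G p.1 p.2))).
  exact: (measurableT_comp mf1 mg).
have iF : (m \x nu)%E.-integrable setT (EFin \o (fun p : V * V => f (gmul G x (- gmul G p.1 p.2)))).
  apply: (@dominated_integrable _ _ _ _ _ m nu _ (fun=> M) (fun=> 1)) => //.
  - by move=> y z; rewrite mulr1.
  - by apply: (@bounded_integrable _ _ _ _ _ M) => // y; rewrite ger0_norm.
  - by apply: (@bounded_integrable _ _ _ _ _ 1) => // y; rewrite normr1.
rewrite (@Rintegral_pushforward _ _ _ _ (m \x nu)%E _ (fun y => f (gmul G x (- y))))//.
rewrite /Rintegral -(integral21_prod_meas1 iF) /=.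
transitivity (\int[nu]_z word j f (gmul G x (- z)))%R; last first.
  by rewrite nuI; [case: (odd j)|exact: bsupp_word].
congr fine; apply: eq_integral => z _; rewrite -mI// /Rintegral fineK; last first.
  apply: integrable_fin_num => //; apply: (@bounded_integrable _ _ _ _ _ M) => //.
  apply: (measurableT_comp (bsupp_measurable bf)).
  by apply: measurable_fun_gmul => //; exact: measurable_oppV.
by apply: eq_integral => y _; rewrite /= gmulN gmulA.
Qed.

End IteratedConvolution.

(** * Hoelder regularity under right translations *)

Section Regularity.
Context {R : realType} {n : nat} (G : homogeneousGroup R n) (q : quasiNorm G).
Hypothesis qN : forall x, q (- x) = q x.
Notation V := 'rV[R]_n.
Notation lam := (@lebesgue R n).
Variables (mu : {finite_measure set V -> \bar R}) (b : R).
Hypothesis mub : mu (~` norm_ball b) = 0.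
Implicit Types (x y z : V) (A B : set V) (r k : R) (f g v w : V -> R).

Notation T0 := (T0 G mu).
Notation T1 := (T1 G mu).

(* [U w] is Hoelder continuous for right translations, in the weak sense needed
   to pair it with functions having mean zero on small cells. *)
Definition regular (U : (V -> R) -> V -> R) := forall rho : R,
  exists C gam : R, [/\ 0 <= C, 0 < gam &
  forall v w z, bsupp v -> bsupp w -> q z <= rho ->
    integ (fun x => `|U w (gmul G x z) - U w x| * `|v x|) <=
    C * q z `^ gam * (norm2 w * norm2 v)].

Lemma bsupp_regular_arg f v z : bsupp f -> bsupp v ->
  bsupp (fun x => `|f (gmul G x z) - f x| * `|v x|).
Proof.
move=> bf bv; apply: bsupp_mul; apply: bsupp_abs => //.
by apply: bsuppB => //; exact: (bsupp_gmulr G z bf).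
Qed.

(** Substituting y -> y z in the integral of w(x z y^-1) h(y) moves the translation onto the
    density: U w (x z) - U w x is the integral of w(x y^-1) (h(y z) - h(y)). Cauchy-Schwarz in x for
    each y then leaves the L^1 modulus of continuity of h. *)
Lemma density_regular (U : (V -> R) -> V -> R) (m : {finite_measure set V -> \bar R})
    (h : V -> R) (C gam : R) :
  (forall f x, bsupp f -> (\int[m]_y f (gmul G x (- y)) = U f x)%R) ->
  (forall f, bsupp f -> bsupp (U f)) ->
  measurable_fun setT h -> (forall x, 0 <= h x) ->
  (forall A, measurable A -> m A = \int[lam]_(x in A) (h x)%:E)%E ->
  0 < gam -> 0 <= C ->
  (forall y, (\int[lam]_x (`|h (gmul G x (- y)) - h x|)%:E <= (C * q y `^ gam)%:E)%E) ->
  regular U.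
Proof.
move=> mI bU mh h0 mE gam0 C0 hC rho; exists C, gam; split => // v w z bv bw _.
have mfin : (m setT < +oo)%E by rewrite -ge0_fin_numE// fin_num_measure.
have ih : lam.-integrable setT (EFin \o h) := integrable_density mh h0 mE mfin.
have mhz : measurable_fun setT (fun y => h (gmul G y z)).
  by apply: (measurableT_comp mh); exact: measurable_gmulr.
have ihz : lam.-integrable setT (EFin \o (fun y => h (gmul G y z))).
  apply/integrableP; split; first exact/measurable_EFinP.
  case/integrableP : ih => _; congr (_ < _)%E.
  rewrite -[LHS]mul1e -(@ge0_integral_scaled _ _ (gmul G ^~ z) 1 (fun y => `|(h y)%:E|%E))//.
  - exact: measurable_gmulr.
  - by move=> A mA; rewrite mul1e haar_right.
  - by apply: measurableT_comp => //; exact/measurable_EFinP.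
have [M M0 [rw [wM wr]]] := bsupp_bound bw.
have mw x : measurable_fun setT (fun y => w (gmul G x (- y))).
  apply: (measurableT_comp (bsupp_measurable bw)); apply: measurable_fun_gmul => //.
  exact: measurable_oppV.
have ifh (f h' : V -> R) : measurable_fun setT f -> (forall x, `|f x| <= M) ->
    measurable_fun setT h' -> lam.-integrable setT (EFin \o h') ->
    lam.-integrable setT (EFin \o (fun y => f y * h' y)).
  move=> mf fM mh' ih'; apply: (le_integrable _ _ _ (integrableZl _ M ih')) => //.
    by apply/measurable_EFinP; exact: measurable_funM.
  by move=> x _; rewrite lee_fin !normrM ler_wpM2r// (le_trans (fM x))// ler_norm.
pose D y := h (gmul G y z) - h y.
have mD : measurable_fun setT D by exact: measurable_funB.
have iD : lam.-integrable setT (EFin \o D).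
  by have := integrableB measurableT ihz ih; rewrite (_ : (_ \- _)%E = EFin \o D).
have UE x : U w x = (\int[lam]_y (w (gmul G x (- y)) * h y))%R.
  by rewrite -mI//; apply: Rintegral_density mfin _ _.
have UzE x : U w (gmul G x z) = (\int[lam]_y (w (gmul G x (- y)) * h (gmul G y z)))%R.
  rewrite UE; have := @integ_scaled _ _ (gmul G ^~ z) 1 (fun y => w (gmul G (gmul G x z) (- y)) * h y).
  rewrite /integ mul1r => <-//.
  - by apply: eq_Rintegral => y _ /=; rewrite gmulN gmulA gmulK.
  - exact: measurable_gmulr.
  - by move=> A mA; rewrite mul1e haar_right.
  - exact: ifh.
have dU x : `|U w (gmul G x z) - U w x| <= (\int[lam]_y (`|w (gmul G x (- y))| * `|D y|))%R.
  rewrite UzE UE -RintegralB//; [|exact: ifh..].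
  have i3 : lam.-integrable setT (EFin \o (fun y =>
      w (gmul G x (- y)) * h (gmul G y z) - w (gmul G x (- y)) * h y)).
    have := integrableB measurableT (ifh _ _ (mw x) (fun y => wM _) mhz ihz)
      (ifh _ _ (mw x) (fun y => wM _) mh ih).
    by rewrite (_ : (_ \- _)%E = EFin \o (fun y =>
      w (gmul G x (- y)) * h (gmul G y z) - w (gmul G x (- y)) * h y)).
  apply: (le_trans (le_normr_Rintegral _ i3)) => //.
  rewrite le_eqVlt; apply/orP; left; apply/eqP; apply: eq_Rintegral => y _.
  by rewrite -mulrBr normrM.
pose F (p : V * V) := `|w (gmul G p.1 (- p.2))| * `|D p.2| * `|v p.1|.
have mF : measurable_fun setT F.
  apply: measurable_funM; [apply: measurable_funM|].
  - apply: measurableT_comp => //; apply: (measurableT_comp (bsupp_measurable bw)).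
    apply: measurable_fun_gmul; first exact: measurable_fst.
    by apply: measurable_fun_oppV; exact: measurable_snd.
  - by apply: measurableT_comp => //; exact: (measurableT_comp mD measurable_snd).
  - apply: measurableT_comp => //.
    exact: (measurableT_comp (bsupp_measurable bv) measurable_fst).
have bv' := bsuppZ M (bsupp_abs bv).
have iaD : lam.-integrable setT (EFin \o (fun y => `|D y|)) by move/integrable_norm : iD.
have domF x y : `|F (x, y)| <= M * `|v x| * `|D y|.
  by rewrite /F /= !normrM !normr_id mulrAC ler_wpM2r// ler_wpM2r.
have a0 x : 0 <= M * `|v x| by rewrite mulr_ge0.
apply: (@le_trans _ _ (integ (fun x => (\int[lam]_y F (x, y))%R))).
  apply: integ_le => [||x].
  - by apply: bsupp_regular_arg => //; exact: bU.
  - apply: (bsupp_le (g := fun x => (\int[lam]_y `|D y|)%R * (M * `|v x|))).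
    + exact: (@measurable_dominated_xRintegral _ _ _ _ _ lam lam F _ _ mF a0
        (fun y => normr_ge0 (D y)) domF (bsupp_integrable bv') iaD).
    + move=> x.
      have iF := @dominated_xintegrable _ _ _ _ _ lam F (fun x => M * `|v x|)
        (fun y => `|D y|) mF domF iaD x.
      apply: (le_trans (le_normr_Rintegral _ iF)) => //.
      rewrite [leRHS]ger0_norm; last by rewrite mulr_ge0// Rintegral_ge0.
      rewrite mulrC -RintegralZl//; apply: le_Rintegral => //.
        by move/integrable_norm : iF.
      by have := integrableZl measurableT (M * `|v x|) iaD.
    + exact: bsuppZ.
  - rewrite (_ : (\int[lam]_y F (x, y))%R =
        (\int[lam]_y (`|w (gmul G x (- y))| * `|D y|))%R * `|v x|).
      by rewrite ler_wpM2r.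
    rewrite -RintegralZr//.
    apply: ifh => //; try by move=> y; rewrite normr_id.
      by apply: measurableT_comp.
    exact: measurableT_comp.
rewrite {1}/integ (@dominated_Fubini _ _ _ _ _ lam lam F (fun x => M * `|v x|) (fun y => `|D y|))//;
  last exact: (bsupp_integrable bv').
apply: (@le_trans _ _ (\int[lam]_y (norm2 w * norm2 v * `|D y|))%R).
  apply: le_Rintegral => //.
  - apply: (@le_integrable _ _ _ lam setT measurableT _ (EFin \o (fun y =>
        (\int[lam]_x `|M * `|v x| |)%R * `|D y|))).
    + apply/measurable_EFinP.
      apply: (@measurable_dominated_xRintegral _ _ _ _ _ lam lam (fun p => F (p.2, p.1))
        (fun y => `|D y|) (fun x => M * `|v x|)) => //.
      * exact: (measurableT_comp mF (@measurable_swap _ _ V V)).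
      * by move=> y x /=; rewrite mulrC.
      * exact: (bsupp_integrable bv').
    + move=> y _; rewrite lee_fin.
      have iF := @dominated_yintegrable _ _ _ _ _ lam F (fun x => M * `|v x|)
        (fun y => `|D y|) mF domF (bsupp_integrable bv') y.
      apply: (le_trans (le_normr_Rintegral _ iF)) => //.
      rewrite [leRHS]ger0_norm; last by rewrite mulr_ge0// Rintegral_ge0.
      rewrite -RintegralZr//; last exact: (bsupp_integrable (bsupp_abs bv')).
      apply: le_Rintegral => //.
      * by move/integrable_norm : iF.
      * have := integrableZr measurableT `|D y| (bsupp_integrable (bsupp_abs bv')).
        by apply: eq_integrable.
      * by move=> x _ /=; rewrite [`|M * _|]ger0_norm.
    + by have := integrableZl measurableT (\int[lam]_x `|M * `|v x| |)%R iaD.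
  - by have := integrableZl measurableT (norm2 w * norm2 v) iaD.
  move=> y _.
  rewrite (_ : (\int[lam]_x F (x, y))%R = `|D y| * integ (fun x => `|w (gmul G x (- y))| * `|v x|)).
    rewrite mulrC ler_wpM2r// -(norm2_gmulr G (- y) bw).
    exact: integ_norm_cauchy_schwarz (bsupp_gmulr G (- y) bw) bv.
  rewrite -integZ; first by apply: eq_Rintegral => x _; rewrite /F /=; ring.
  by apply: bsupp_mul; apply: bsupp_abs => //; exact: (bsupp_gmulr G (- y) bw).
rewrite RintegralZl// mulrC ler_wpM2r//.
  by rewrite mulr_ge0// norm2_ge0.
have := hC (- z); rewrite qN opprK.
rewrite -lee_fin; apply: le_trans; rewrite /Rintegral fineK//.
by have := integrable_fin_num measurableT iaD.
Qed.

(** Fubini with y outermost: the left side is at most the average over [mu] of the differences at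
    fixed y, and only those y in the ball carrying [mu] count. *)
Lemma integ_OpB_le (s1 s2 : V -> V) g v K : adm b s1 -> adm b s2 -> bsupp g -> bsupp v ->
  0 <= K ->
  (forall y, `|y| <= b -> integ (fun x =>
     `|g (gmul G x (s1 y)) - g (gmul G x (s2 y))| * `|v x|) <= K) ->
  integ (fun x => `|Op G mu s1 g x - Op G mu s2 g x| * `|v x|) <= mass mu * K.
Proof.
move=> as1 as2 bg bv K0 hK; have [M M0 [rho [gM _]]] := bsupp_bound bg.
pose F (p : V * V) := `|g (gmul G p.1 (s1 p.2)) * \1_(norm_ball b) p.2 -
  g (gmul G p.1 (s2 p.2)) * \1_(norm_ball b) p.2| * `|v p.1|.
have mF : measurable_fun setT F.
  apply: measurable_funM.
    have := measurable_funB (measurable_Op_kernel G as1 bg) (measurable_Op_kernel G as2 bg).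
    by move=> mB; exact: (measurableT_comp (@normr_measurable _ setT) mB).
  by apply: measurableT_comp => //; exact: (measurableT_comp (bsupp_measurable bv) measurable_fst).
have domF x y : `|F (x, y)| <= (M + M) * `|v x| * 1.
  rewrite /F /= mulr1 normrM !normr_id ler_wpM2r//.
  rewrite (le_trans (ler_normB _ _))// lerD// normrM -[leRHS]mulr1 ler_pM//;
  by rewrite indicE; case: (_ \in _); rewrite ?normr1 ?normr0.
have a0 x : 0 <= (M + M) * `|v x| by rewrite mulr_ge0// addr_ge0.
have ia : lam.-integrable setT (EFin \o (fun x => (M + M) * `|v x|)).
  exact: bsupp_integrable (bsuppZ _ (bsupp_abs bv)).
have i1 : mu.-integrable setT (EFin \o (fun=> 1 : R)).
  by apply: (@bounded_integrable _ _ _ mu _ 1) => // y; rewrite normr1.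
have kint s x : adm b s -> mu.-integrable setT
    (EFin \o (fun y => g (gmul G x (s y)) * \1_(norm_ball b) y)).
  move=> as_; apply: (@bounded_integrable _ _ _ mu _ M).
    apply: measurable_funM; first exact: (measurable_gmul_comp G x as_ bg).
    by apply: measurable_indic; exact: measurable_norm_ball.
  move=> y; rewrite normrM -[leRHS]mulr1 ler_pM// indicE.
  by case: (_ \in _); rewrite ?normr1 ?normr0.
apply: (@le_trans _ _ (integ (fun x => (\int[mu]_y F (x, y))%R))).
  apply: integ_le => [||x].
  - by apply: bsupp_mul; apply: bsupp_abs => //; apply: bsuppB;
      exact: Op_bsupp mub _ _ as1 bg || exact: Op_bsupp mub _ _ as2 bg.
  - apply: (bsupp_le (g := fun x => (\int[mu]_y 1)%R * ((M + M) * `|v x|))).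
    + exact: (@measurable_dominated_xRintegral _ _ _ _ _ lam mu F _ (fun=> 1) mF a0
        (fun=> ler01) domF ia i1).
    + move=> x.
      have iF := @dominated_xintegrable _ _ _ _ _ mu F (fun x => (M + M) * `|v x|)
        (fun=> 1) mF domF i1 x.
      apply: (le_trans (le_normr_Rintegral _ iF)) => //.
      rewrite [leRHS]ger0_norm; last by rewrite mulr_ge0// Rintegral_ge0.
      rewrite mulrC -RintegralZl//; apply: le_Rintegral => //.
        by move/integrable_norm : iF.
      by have := integrableZl measurableT ((M + M) * `|v x|) i1.
    + by apply: bsuppZ; apply: bsuppZ; exact: bsupp_abs.
  - rewrite /F /= RintegralZr//; last first.
      have := integrable_norm (integrableB measurableT (kint _ x as1) (kint _ x as2)).
      by apply: eq_integrable.
    rewrite ler_wpM2r// (OpE G mub x as1 bg) (OpE G mub x as2 bg) -RintegralB//; [|exact: kint..].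
    apply: le_normr_Rintegral => //.
    have := integrableB measurableT (kint _ x as1) (kint _ x as2).
    by apply: eq_integrable.
rewrite {1}/integ (@dominated_Fubini _ _ _ _ _ lam mu F (fun x => (M + M) * `|v x|) (fun=> 1))//.
rewrite [leRHS](_ : _ = (\int[mu]_y K)%R); last first.
  by rewrite /Rintegral integral_cst// fineM// ?fin_num_measure// mulrC.
have iK : mu.-integrable setT (EFin \o (fun=> K)).
  by apply: (@bounded_integrable _ _ _ mu _ K) => // y; rewrite ger0_norm.
have FK y : (\int[lam]_x F (x, y))%R <= K.
  rewrite /F /= !indicE; case: (boolP (y \in _)) => [/set_mem yb|_].
    by under eq_Rintegral do rewrite !mulr1; exact: hK.
  under eq_Rintegral do rewrite !mulr0 subr0 normr0 mul0r.
  by rewrite /Rintegral integral0.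
have F0 y : 0 <= (\int[lam]_x F (x, y))%R.
  by apply: Rintegral_ge0 => // x _; rewrite mulr_ge0.
apply: le_Rintegral => //.
apply: (@bounded_integrable _ _ _ mu _ K); last by move=> y; rewrite ger0_norm.
apply: (@measurable_dominated_xRintegral _ _ _ _ _ mu lam (fun p => F (p.2, p.1))
  (fun=> 1) (fun x => (M + M) * `|v x|)) => //.
- exact: (measurableT_comp mF (@measurable_swap _ _ V V)).
- by move=> y x /=; rewrite mulrC.
Qed.

(* [T1 (U w) (x z) - T1 (U w) x] averages [U w (x y (y^-1 z y)) - U w (x y)]. *)
Lemma regular_T1 (U : (V -> R) -> V -> R) :
  (forall f, bsupp f -> bsupp (U f)) -> regular U -> regular (fun f => T1 (U f)).
Proof.
move=> bU rU rho.
have [S _ hS] := qnorm_ub q b.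
have [C1 [a [C10 a0 hc]]] := qnorm_conj_le q S rho.
(* Conjugation enlarges the admissible translations, which is why [regular] quantifies over their
   size: this radius is the bound on q(y^-1 z y) for q z <= rho. *)
have [C [gam [C0 gam0 hU]]] := rU (C1 * `|rho| `^ a).
exists (mass mu * (C * C1 `^ gam)), (a * gam); split.
- by rewrite !mulr_ge0 ?mass_ge0// powR_ge0.
- exact: mulr_gt0.
move=> v w z bv bw zr.
have bg : bsupp (U w) by exact: bU.
have q0 x := qnorm_ge0 q x.
have asz : adm b (fun y => gmul G z y).
  split; first exact: measurable_gmull.
  have [K _ hK] := gmul_bound G (Num.max `|z| b).
  by exists K => y yb; apply: hK; rewrite le_max ?lexx// yb orbT.
have -> : (fun x => `|T1 (U w) (gmul G x z) - T1 (U w) x| * `|v x|) =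
    (fun x => `|Op G mu (fun y => gmul G z y) (U w) x - Op G mu id (U w) x| * `|v x|).
  apply/funext => x; congr (`|_ - _| * _).
  by apply: eq_Rintegral => y _; rewrite gmulA.
have -> : mass mu * (C * C1 `^ gam) * q z `^ (a * gam) * (norm2 w * norm2 v) =
    mass mu * (C * (C1 * q z `^ a) `^ gam * (norm2 w * norm2 v)).
  by rewrite powRM ?powR_ge0 ?(ltW C10)// -powRrM; ring.
apply: (integ_OpB_le asz (adm_id b) bg bv) => [|y yb].
  by rewrite !mulr_ge0 ?powR_ge0 ?norm2_ge0.
have bvy : bsupp (fun x => v (gmul G x (- y))) := bsupp_gmulr G (- y) bv.
have -> : integ (fun x => `|U w (gmul G x (gmul G z y)) - U w (gmul G x y)| * `|v x|) =
   integ (fun x => `|U w (gmul G x (gmul G (- y) (gmul G z y))) - U w x| * `|v (gmul G x (- y))|).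
  rewrite -(integ_gmulr G y (bsupp_regular_arg (gmul G (- y) (gmul G z y)) bg bvy)).
  by apply: eq_integ => x; rewrite gmulK !gmulA gmulK.
have cz := hc y z (hS _ yb) zr.
rewrite (le_trans (hU _ _ _ bvy bw _))//.
  apply: (le_trans cz); rewrite ler_pM2l//.
  by apply: ge0_ler_powR; rewrite ?nnegrE ?(ltW a0)// (le_trans zr)// ler_norm.
rewrite norm2_gmulr// ler_wpM2r ?mulr_ge0 ?norm2_ge0// ler_wpM2l//.
by apply: ge0_ler_powR; rewrite ?nnegrE ?mulr_ge0 ?powR_ge0 ?(ltW gam0) ?(ltW C10).
Qed.

End Regularity.

(** * Pairing with functions of mean zero on small cells *)

Section MeanZero.
Context {R : realType} {n : nat} (G : homogeneousGroup R n) (q : quasiNorm G).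
Notation V := 'rV[R]_n.
Notation lam := (@lebesgue R n).
Variables (c : V -> V) (w0 sigma : R).
Hypotheses (mc : measurable_fun setT c)
  (cbd : forall rho : R, exists rho', forall x y, c x = c y -> `|x| <= rho -> `|y| <= rho')
  (w0_gt0 : 0 < w0) (cell_lb : forall x, w0 <= cellm c x)
  (cell_small : forall x y, c x = c y -> dist q x y <= sigma).
Implicit Types (x y z : V) (r k : R) (f g v w : V -> R).

Lemma bsupp_qball (s : R) : bsupp (\1_(qball q s) : V -> R).
Proof.
have [k hk] := qball_norm_ball q s.
by apply: (@bsupp_indic _ _ _ k) => //; exact: measurable_qball.
Qed.

(** Against v one may replace f by f - Ex c f. The cell of x has measure at least w0 and consists of
    points x z with q z <= sigma, so |f - Ex c f| at x is at most 1/w0 times the integral of |f(x z)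
    - f(x)| over these z. Exchanging the integrals in x and z brings in the hypothesis on each z. *)
Lemma mean_zero_pairing f v (K : R) : bsupp f -> bsupp v -> (forall x, Ex c v x = 0) ->
  (forall z, q z <= sigma ->
    integ (fun x => `|f (gmul G x z) - f x| * `|v x|) <= K) -> 0 <= K ->
  `|integ (fun x => f x * v x)| <= integ (\1_(qball q sigma) : V -> R) / w0 * K.
Proof.
move=> bf bv v0 hK K0.
have bE := bsupp_Ex mc cbd w0_gt0 cell_lb bf.
have b1 := bsupp_qball sigma.
have -> : integ (fun x => f x * v x) = integ (fun x => (f x - Ex c f x) * v x).
  transitivity (integ (fun x => f x * v x) - integ (fun x => Ex c f x * v x)).
    rewrite (Ex_selfadjoint mc cbd w0_gt0 cell_lb bf bv).
    rewrite [X in _ - X](_ : _ = 0) ?subr0// -[RHS](@integ_eq0 R n).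
    by apply: eq_integ => x; rewrite v0 mulr0.
  rewrite -integB; [|exact: bsupp_mul..].
  by apply: eq_integ => x; rewrite mulrBl.
have [M M0 [rho [fM _]]] := bsupp_bound bf.
pose H (p : V * V) := `|f (gmul G p.1 p.2) - f p.1| * `|v p.1| * \1_(qball q sigma) p.2.
have mH : measurable_fun setT H.
  have mf := bsupp_measurable bf.
  apply: measurable_funM; last exact: (measurableT_comp (bsupp_measurable b1) measurable_snd).
  apply: measurable_funM.
    apply: measurableT_comp => //; apply: measurable_funB.
      exact: (measurableT_comp mf (measurable_gmul G)).
    exact: (measurableT_comp mf measurable_fst).
  by apply: measurableT_comp => //; exact: (measurableT_comp (bsupp_measurable bv) measurable_fst).
have bMv : bsupp (fun x => (M + M) * v x) by exact: bsuppZ.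
have domH x y : `|H (x, y)| <= `|(M + M) * v x| * `|\1_(qball q sigma) y : R|.
  rewrite /H /= !normrM ler_wpM2r// !normr_id ler_wpM2r//.
  by rewrite (le_trans (ler_normB _ _))// (le_trans _ (ler_norm _))// lerD.
have bH x : bsupp (fun z => H (x, z)).
  apply: (bsupp_le (g := fun z => ((M + M) * v x) * \1_(qball q sigma) z)).
  - exact: (measurableT_comp mH (measurable_pair1 x)).
  - by move=> z; rewrite [leRHS]normrM.
  - exact: bsuppZ.
apply: (le_trans (integ_abs _)).
  by apply: bsupp_mul => //; exact: bsuppB.
have step1 x : `|(f x - Ex c f x) * v x| <= w0^-1 * integ (fun z => H (x, z)).
  have bk : bsupp (kern c x).
    rewrite (_ : kern c x = fun y => (cellm c x)^-1 * \1_(cell c x) y).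
      by apply: bsuppZ; exact: bsupp_cell mc cbd x.
    by apply/funext => y; rewrite /kern mulrC.
  have kb := bsupp_kernM mc cbd x bf.
  have bfk : bsupp (fun y => f x * kern c x y) by exact: bsuppZ.
  have -> : f x - Ex c f x = integ (fun y => f x * kern c x y - kern c x y * f y).
    by rewrite integB// integZ// (integ_kern mc cbd w0_gt0 cell_lb) mulr1.
  pose P z := `|f (gmul G x z) - f x| * \1_(qball q sigma) z.
  have osc (h : V -> V) : measurable_fun setT h -> measurable_fun setT (fun y => `|f (h y) - f x|).
    move=> mh; apply: measurableT_comp => //; apply: measurable_funB => //.
    exact: (measurableT_comp (bsupp_measurable bf) mh).
  have osc_le y : `| `|f y - f x| | <= M + M.
    by rewrite normr_id (le_trans (ler_normB _ _))// lerD.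
  have bP : bsupp P.
    by apply: (bsuppM (M := M + M)) => //; apply: osc; exact: measurable_gmull.
  have -> : integ (fun z => H (x, z)) = `|v x| * integ P.
    by rewrite -integZ//; apply: eq_integ => z; rewrite /H /P /=; ring.
  rewrite normrM mulrC mulrCA ler_wpM2l//.
  apply: (le_trans (integ_abs _)); first exact: bsuppB.
  rewrite -(integ_gmull G (- x) bP) -integZ; last exact: (bsupp_gmull G (- x) bP).
  apply: integ_le => [||y].
  - by apply: bsupp_abs; exact: bsuppB.
  - by apply: bsuppZ; exact: (bsupp_gmull G (- x) bP).
  have -> : f x * kern c x y - kern c x y * f y = - (kern c x y * (f y - f x)) by ring.
  rewrite /P gmulVK normrN normrM mulrC mulrCA ler_wpM2l//.
  rewrite ger0_norm; last exact: (kern_ge0 w0_gt0 cell_lb).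
  apply: (le_trans (kern_le w0_gt0 cell_lb x y)).
  rewrite ler_wpM2l ?invr_ge0 ?(ltW w0_gt0)// indicE.
  case: (boolP (y \in cell c x)) => [/set_mem xy|_].
    by rewrite indicE mem_set//; exact: cell_small.
  by rewrite indicE; case: (_ \in _).
apply: (@le_trans _ _ (w0^-1 * integ (fun x => integ (fun z => H (x, z))))).
  have bHi : bsupp (fun x => integ (fun z => H (x, z))).
    apply: (bsupp_le (g := fun x => integ (\1_(qball q sigma) : V -> R) * `|(M + M) * v x|)).
    - exact: (measurable_integ_param mH bMv b1 domH).
    - move=> x; apply: (le_trans (integ_abs (bH x))).
      rewrite [leRHS]ger0_norm; last first.
        by rewrite mulr_ge0// integ_ge0// => z; rewrite indicE; case: (_ \in _).
      rewrite mulrC -integZ//; apply: integ_le => [||z].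
      + exact: bsupp_abs.
      + exact: bsuppZ.
      + by rewrite (le_trans (domH x z))// ler_wpM2l// ger0_norm// indicE; case: (_ \in _).
    - by apply: bsuppZ; exact: bsupp_abs.
  rewrite -integZ//; apply: integ_le => //.
  - by apply: bsupp_abs; apply: bsupp_mul => //; exact: bsuppB.
  - exact: bsuppZ.
rewrite (integ_fubini mH bMv b1 domH) -mulrA mulrCA ler_wpM2l ?invr_ge0 ?(ltW w0_gt0)//.
rewrite mulrC -integZ//; apply: integ_le.
- apply: (bsupp_le (g := fun z => integ (fun x => `|(M + M) * v x|) * \1_(qball q sigma) z)).
  + have mH' := measurableT_comp mH (@measurable_swap _ _ V V).
    by apply: (measurable_integ_param mH' b1 bMv) => y x; rewrite mulrC; exact: domH.
  + move=> z; apply: (le_trans (integ_abs _)).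
      apply: (bsupp_le (g := fun x => (M + M) * v x)) => //.
        exact: (measurableT_comp mH (measurable_pair2 z)).
      move=> x; rewrite (le_trans (domH x z))// ler_piMr//.
      by rewrite indicE; case: (_ \in _); rewrite ?normr1 ?normr0.
    rewrite normrM ger0_norm; last by rewrite integ_ge0.
    rewrite mulrC -integZ; last exact: bsupp_abs.
    apply: integ_le => [||x].
    * apply: bsupp_abs; apply: (bsupp_le (g := fun x => (M + M) * v x)) => //.
        exact: (measurableT_comp mH (measurable_pair2 z)).
      move=> x; rewrite (le_trans (domH x z))// ler_piMr//.
      by rewrite indicE; case: (_ \in _); rewrite ?normr1 ?normr0.
    * by apply: bsuppZ; exact: bsupp_abs.
    * by rewrite (le_trans (domH x z))// mulrC.
  + exact: bsuppZ.
- exact: bsuppZ.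
move=> z; rewrite /H /= indicE; case: (boolP (z \in _)) => [/set_mem zs|_].
  by rewrite mulr1; under eq_integ do rewrite mulr1; exact: hK.
by under eq_integ do rewrite mulr0; rewrite integ_eq0 mulr0.
Qed.

End MeanZero.

(** * L^2 decay from a regular power of T1 T0 *)

Section PowerIteration.
Context {R : realType} {n : nat} (G : homogeneousGroup R n) (q : quasiNorm G).
Notation V := 'rV[R]_n.
Notation lam := (@lebesgue R n).
Variables (mu : {finite_measure set V -> \bar R}) (b : R).
Hypothesis mub : mu (~` norm_ball b) = 0.
Implicit Types (x y z : V) (r k : R) (f g v w : V -> R).

Notation T0 := (T0 G mu).
Notation T1 := (T1 G mu).

Definition TT f : V -> R := T1 (T0 f).

Lemma bsupp_TT (i : nat) v : bsupp v -> bsupp (iter i TT v).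
Proof.
move=> bv; elim: i => //= i IH.
by apply: (bsupp_T1 _ mub); exact: (bsupp_T0 _ mub).
Qed.

Lemma T0_adjoint f g : bsupp f -> bsupp g ->
  integ (fun x => T0 f x * g x) = integ (fun x => f x * T1 g x).
Proof.
move=> bf bg; rewrite (Op_adjoint G mub (adm_neg b) bf bg).
apply: eq_integ => x; congr (_ * _); apply: eq_Rintegral => y _.
by rewrite opprK.
Qed.

Lemma TT_pairing f g : bsupp f -> bsupp g ->
  integ (fun x => TT f x * g x) = integ (fun x => T0 f x * T0 g x).
Proof.
move=> bf bg; rewrite [RHS](_ : _ = integ (fun x => T0 g x * T0 f x)); last first.
  by apply: eq_integ => x; rewrite mulrC.
rewrite T0_adjoint//; last exact: (bsupp_T0 _ mub).
by apply: eq_integ => x; rewrite mulrC.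
Qed.

Lemma TT_selfadjoint (i : nat) f g : bsupp f -> bsupp g ->
  integ (fun x => iter i TT f x * g x) = integ (fun x => f x * iter i TT g x).
Proof.
move=> bf bg; elim: i => //= i IH in f bf *.
rewrite -iterS iterSr IH; last exact: (bsupp_TT 1).
rewrite (TT_pairing bf (bsupp_TT i bg)).
rewrite [RHS](_ : _ = integ (fun x => TT (iter i TT g) x * f x)); last first.
  by apply: eq_integ => x; rewrite mulrC.
rewrite (TT_pairing (bsupp_TT i bg) bf).
by apply: eq_integ => x; rewrite mulrC.
Qed.

Lemma norm2_TT (i : nat) v : bsupp v -> norm2 (iter i TT v) <= (mass mu ^+ 2) ^+ i * norm2 v.
Proof.
move=> bv; elim: i => [|i IH] /=; first by rewrite mul1r.
have bi := bsupp_TT i bv.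
rewrite (le_trans (norm2_Op G mub (adm_id b) (bsupp_T0 _ mub bi)))//.
rewrite exprS -mulrA expr2 -mulrA ler_wpM2l ?mass_ge0//.
rewrite (le_trans (norm2_Op G mub (adm_neg b) bi))// ler_wpM2l ?mass_ge0//.
Qed.

Lemma word_TT (i : nat) f : word G mu (i.*2) f = iter i TT (T1 f).
Proof. by elim: i => //= i IH; rewrite odd_double /= IH. Qed.

(* <A^m v, v>^2 <= |A^m v|^2 |v|^2 = <A^(2m) v, v> |v|^2 for the self-adjoint
   operator A = T1 T0. *)
Lemma T0_power (s : nat) v : bsupp v ->
  (norm2 (T0 v) ^+ 2) ^+ (2 ^ s) <=
  integ (fun x => iter (2 ^ s) TT v x * v x) * (norm2 v ^+ 2) ^+ (2 ^ s - 1).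
Proof.
move=> bv; elim: s => [|s IH].
  by rewrite expn0 subnn expr0 expr1 mulr1 sqr_norm2 /= TT_pairing//.
rewrite expnS mulnC exprM.
have bi := bsupp_TT (2 ^ s) bv.
set X := integ _ in IH.
have X2 : X ^+ 2 <= integ (fun x => iter (2 ^ s * 2) TT v x * v x) * norm2 v ^+ 2.
  rewrite (le_trans (integ_cauchy_schwarz bi bv))//.
  rewrite [norm2 _ ^+ 2]sqr_norm2 muln2 -addnn iterD TT_selfadjoint//.
apply: (@le_trans _ _ ((X * (norm2 v ^+ 2) ^+ (2 ^ s - 1)) ^+ 2)).
  apply: lerXn2r => //; rewrite ?nnegrE ?exprn_ge0 ?sqr_ge0//.
    exact: norm2_ge0.
  by rewrite (le_trans _ IH)// exprn_ge0// sqr_ge0.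
rewrite exprMn; apply: (le_trans (ler_wpM2r _ X2)); first by rewrite sqr_ge0.
move: (norm2 v ^+ 2) => N2.
rewrite -mulrA -exprM -exprS le_eqVlt; apply/orP; left; apply/eqP; congr (_ * _ ^+ _).
by have := expn_gt0 2 s; lia.
Qed.

(** The regular word is (T1 T0)^i T1. Since 2^i >= i + 1, it can be split off from the left of (T1
    T0)^(2^i), what remains being [w] = T0 (T1 T0)^(2^i - i - 1) v. Pairing with v of mean zero
    gains sigma^gam, and [T0_power] with s = i transfers the gain to T0 v. *)
Lemma T0_decay (i : nat) : regular q (word G mu i.*2) ->
  exists (C gam : R) (s : nat), [/\ 0 <= C, 0 < gam &
  forall (c : V -> V) (w0 sigma : R) v,
    measurable_fun setT c ->
    (forall rho : R, exists rho', forall x y, c x = c y -> `|x| <= rho -> `|y| <= rho') ->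
    0 < w0 -> (forall x, w0 <= cellm c x) ->
    (forall x y, c x = c y -> dist q x y <= sigma) -> sigma <= 1 ->
    bsupp v -> (forall x, Ex c v x = 0) ->
    (norm2 (T0 v) ^+ 2) ^+ (2 ^ s) <=
    C * (integ (\1_(qball q sigma) : V -> R) / w0 * sigma `^ gam) * (norm2 v ^+ 2) ^+ (2 ^ s)].
Proof.
move=> /(_ 1)[C [gam [C0 gam0 hC]]].
pose M := (2 ^ i)%N; pose D := mass mu * (mass mu ^+ 2) ^+ (M - i.+1).
have iM : (i.+1 <= M)%N by rewrite /M ltn_expl.
have D0 : 0 <= D by rewrite mulr_ge0 ?exprn_ge0 ?sqr_ge0 ?mass_ge0.
exists (C * D), gam, i; split => //; first exact: mulr_ge0.
move=> c w0 sigma v mc cbd w00 cl cs s1 bv v0.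
apply: (le_trans (T0_power i bv)); rewrite -/M.
pose w := T0 (iter (M - i.+1) TT v).
have bw : bsupp w by apply: (bsupp_T0 _ mub); exact: bsupp_TT.
have wE : iter M TT v = word G mu i.*2 w.
  by rewrite word_TT /w -[T1 (T0 _)]/(TT _) -iterS -iterD; congr (iter _ _ _); lia.
have wD : norm2 w <= D * norm2 v.
  rewrite (le_trans (norm2_Op G mub (adm_neg b) (bsupp_TT _ bv)))//.
  by rewrite /D -mulrA ler_wpM2l ?mass_ge0// norm2_TT.
have sg0 : 0 <= sigma by rewrite -(distxx q 0) cs.
have main : `|integ (fun x => iter M TT v x * v x)| <=
    integ (\1_(qball q sigma) : V -> R) / w0 * (C * sigma `^ gam * (D * norm2 v ^+ 2)).
  rewrite wE.
  apply: (mean_zero_pairing mc cbd w00 cl cs (bsupp_word G mub i.*2 bw) bv v0).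
  - move=> z zs; apply: (le_trans (hC _ _ _ bv bw (le_trans zs s1))).
    apply: ler_pM.
    + by rewrite mulr_ge0// powR_ge0.
    + by rewrite mulr_ge0// norm2_ge0.
    + rewrite ler_wpM2l//; apply: ge0_ler_powR; rewrite ?nnegrE ?(ltW gam0)//.
      exact: qnorm_ge0.
    + by rewrite expr2 mulrA ler_wpM2r ?norm2_ge0.
  - by apply: mulr_ge0; apply: mulr_ge0 => //; rewrite ?powR_ge0// sqr_ge0.
apply: (le_trans (ler_wpM2r _ (le_trans (ler_norm _) main))); first by rewrite exprn_ge0 ?sqr_ge0.
rewrite -[X in _ <= _ * _ ^+ X](subnK (n := M) (m := 1)) ?(leq_trans _ iM)//.
rewrite exprD expr1 le_eqVlt; apply/orP; left; apply/eqP; ring.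
Qed.

End PowerIteration.

(** * The decay at all scales, by dilation *)

Section ScaledOperators.
Context {R : realType} {n : nat} (G : homogeneousGroup R n) (q : quasiNorm G).
Hypothesis qN : forall x, q (- x) = q x.
Notation V := 'rV[R]_n.
Notation lam := (@lebesgue R n).
Variables (mu : {finite_measure set V -> \bar R}) (b : R).
Hypothesis mub : mu (~` norm_ball b) = 0.
Variable (ratio : R).
Hypothesis ratio_big : 32 * ctri q ^+ 4 <= ratio.
Implicit Types (x y z : V) (r k theta : R) (f g v w : V -> R).

Definition vol r : R := integ (\1_(qball q r) : V -> R).

Definition Tr r f : V -> R := Op G mu (fun y => - dl G r y) f.

Lemma vol_dl r s : 0 < r -> vol (r * s) = jac G r * vol s.
Proof.
move=> r0; rewrite -{2}(invrK r) -(integ_dl G (r := r^-1)) ?invr_gt0//; last exact: bsupp_qball.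
apply: eq_integ => x; rewrite !indicE; congr (_%:R); congr nat_of_bool.
apply/idP/idP => /set_mem h; apply/mem_set; move: h; rewrite /qball /=.
  by rewrite qnorm_dl ?invr_gt0// ler_pdivrMl.
by rewrite qnorm_dl ?invr_gt0// ler_pdivrMl.
Qed.

Lemma vol1_gt0 : 0 < vol 1.
Proof.
have [k k0 kP] := @haar_ball_pos R n.
have [M M0 hM] := qnorm_ub q k.
have : 0 < vol (M * 1).
  rewrite mulr1; have /andP[l0 lfin] := kP.
  apply: (@lt_le_trans _ _ (integ (\1_(norm_ball k) : V -> R))).
    rewrite /integ /Rintegral integral_indic ?setIT//; last exact: measurable_norm_ball.
    by rewrite fine_gt0// l0.
  apply: integ_le => [||x].
  - by apply: (@bsupp_indic _ _ _ k) => //; exact: measurable_norm_ball.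
  - exact: bsupp_qball.
  rewrite indicE; case: (boolP (x \in _)) => [/set_mem xk|_]; last by case/andP: (@indic01 R n (qball q M) x).
  by rewrite indicE mem_set//; exact: hM.
by rewrite vol_dl// pmulr_rgt0// jac_gt0.
Qed.

Lemma vol_gt0 r : 0 < r -> 0 < vol r.
Proof. by move=> r0; rewrite -(mulr1 r) vol_dl// mulr_gt0 ?jac_gt0// vol1_gt0. Qed.

Lemma vol_ratio r s t : 0 < r -> 0 < s -> 0 < t -> vol (r * t) / vol (s * t) = jac G (r / s).
Proof.
move=> r0 s0 t0; have v0 := vol_gt0 (mulr_gt0 s0 t0).
have -> : r * t = (r / s) * (s * t) by field; rewrite gt_eqF.
by rewrite vol_dl ?divr_gt0// mulfK// gt_eqF.
Qed.

Lemma indic_dist x r y :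
  \1_[set y | dist q x y <= r] y = \1_(qball q r) (gmul G (- x) y) :> R.
Proof. by rewrite !indicE. Qed.

Lemma bsupp_dist x r : bsupp (\1_[set y | dist q x y <= r] : V -> R).
Proof.
rewrite (_ : \1__ = fun y => \1_(qball q r) (gmul G (- x) y)).
  exact: (bsupp_gmull G (- x) (bsupp_qball q r)).
by apply/funext => y; rewrite indic_dist.
Qed.

Lemma integ_dist x r : integ (\1_[set y | dist q x y <= r] : V -> R) = vol r.
Proof.
rewrite /vol -(integ_gmull G (- x) (bsupp_qball q r)).
by apply: eq_integ => y; exact: indic_dist.
Qed.

Lemma adm_dl r : adm b (fun y => - dl G r y).
Proof.
split; first by apply: measurable_fun_oppV; exact: measurable_dl.
have [C C0 hC] := dl_norm_le G r; exists (C * b) => y yb.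
by rewrite normrN (le_trans (hC y))// ler_wpM2l.
Qed.

Lemma bsupp_Tr r f : bsupp f -> bsupp (Tr r f).
Proof. by move=> bf; exact: Op_bsupp mub _ _ (adm_dl r) bf. Qed.

(** Conjugating with a dilation brings the average at scale r to scale 1, where [T0_decay] was
    proved. *)
Lemma Tr_conj r f x : 0 < r -> Tr r f x = T0 G mu (fun y => f (dl G r y)) (dl G r^-1 x).
Proof.
move=> r0; rewrite /Tr /T0 /Op; apply: eq_Rintegral => y _.
by rewrite dl_gmul// dlVK// dlN.
Qed.

Lemma norm2_dl r f : 0 < r -> bsupp f ->
  norm2 (fun y => f (dl G r y)) ^+ 2 = jac G r^-1 * norm2 f ^+ 2.
Proof. by move=> r0 bf; rewrite !sqr_norm2 (integ_dl G r0 (bsupp_sqr bf)). Qed.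

(** In units of its scale, a cell contains a ball of radius [kap], by [cen_ball], and has diameter
    at most [diam] = ctri (4 ctri^2 + 4 ctri^2), by [cen_dist] applied to two points. *)
Definition kap : R := net_in q / (2 * ctri q).
Definition diam : R := 8 * ctri q ^+ 3.

Lemma kap_gt0 : 0 < kap.
Proof. by rewrite divr_gt0 ?net_in_gt0// mulr_gt0 ?ctri_gt0. Qed.

Lemma diam_gt0 : 0 < diam.
Proof. by rewrite mulr_gt0 ?exprn_gt0 ?ctri_gt0. Qed.

Notation cell_ theta i := (cen q theta ratio i).

Section Cells.
Variables (theta : R) (i : nat).
Hypothesis theta_gt0 : 0 < theta.
Notation sc := (scale theta ratio).
Notation ci := (cen q theta ratio i).

Lemma sc_gt0 j : 0 < sc j.
Proof. exact: scale_gt0 theta_gt0 ratio_big _. Qed.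

Lemma cell_diam x y : ci x = ci y -> dist q x y <= diam * sc i.
Proof.
move=> xy; apply: (le_trans (dist_triangle q x (ci x) y)).
have h1 := cen_dist theta_gt0 ratio_big i x.
have h2 := cen_dist theta_gt0 ratio_big i y.
rewrite distC// {2}xy.
apply: (@le_trans _ _ (ctri q * (4 * ctri q ^+ 2 * sc i + 4 * ctri q ^+ 2 * sc i))).
  by rewrite ler_pM2l ?ctri_gt0// lerD.
rewrite /diam le_eqVlt; apply/orP; left; apply/eqP; ring.
Qed.

Lemma cell_bounded (rho : R) : exists rho', forall x y, ci x = ci y -> `|x| <= rho -> `|y| <= rho'.
Proof.
have [M M0 hM] := qnorm_ub q rho.
have [N N0 hN] := qnorm_proper q (ctri q * (M + diam * sc i)).
exists N => x y xy xr; apply: hN.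
have -> : q y = dist q 0 y by rewrite /dist oppr0 gmul0x.
apply: (le_trans (dist_triangle q 0 x y)); rewrite ler_pM2l ?ctri_gt0//.
rewrite lerD//; last exact: cell_diam.
by rewrite /dist oppr0 gmul0x hM.
Qed.

Lemma cellm_ge x : vol (kap * sc i) <= cellm ci x.
Proof.
rewrite -(integ_dist (ci x)); apply: integ_le => [||y].
- exact: bsupp_dist.
- exact: (bsupp_cell (measurable_cen q theta ratio i) cell_bounded x).
rewrite indicE; case: (boolP (y \in _)) => [/set_mem/= yd|_].
  by rewrite indicE mem_set//= /cell /= (cen_ball qN theta_gt0 ratio_big yd).
by case/andP: (@indic01 R n (cell ci x) y).
Qed.

Lemma cell_vol_gt0 : 0 < vol (kap * sc i).
Proof. by rewrite vol_gt0// mulr_gt0 ?kap_gt0// sc_gt0. Qed.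

Lemma bsupp_E f : bsupp f -> bsupp (Ex ci f).
Proof.
exact: (bsupp_Ex (measurable_cen q theta ratio i) cell_bounded cell_vol_gt0 cellm_ge).
Qed.

Lemma E_ge0 f x : (forall y, 0 <= f y) -> 0 <= Ex ci f x.
Proof. exact: (Ex_ge0 cell_vol_gt0 cellm_ge). Qed.

Lemma E_B f g : bsupp f -> bsupp g -> Ex ci (fun x => f x - g x) = (fun x => Ex ci f x - Ex ci g x).
Proof.
exact: (ExB (measurable_cen q theta ratio i) cell_bounded).
Qed.

Lemma E_adj f g : bsupp f -> bsupp g ->
  integ (fun x => Ex ci f x * g x) = integ (fun x => f x * Ex ci g x).
Proof.
exact: (Ex_selfadjoint (measurable_cen q theta ratio i) cell_bounded cell_vol_gt0 cellm_ge).
Qed.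

(* The dilated function [v (dl G r _)] has mean zero on the fibers of [ci (dl G r _)]. *)
Lemma dilated_decay (r : R) v (C gam : R) (s : nat) : 0 < r ->
  (forall (c : V -> V) (w0 sigma : R) v,
    measurable_fun setT c ->
    (forall rho : R, exists rho', forall x y, c x = c y -> `|x| <= rho -> `|y| <= rho') ->
    0 < w0 -> (forall x, w0 <= cellm c x) ->
    (forall x y, c x = c y -> dist q x y <= sigma) -> sigma <= 1 ->
    bsupp v -> (forall x, Ex c v x = 0) ->
    (norm2 (T0 G mu v) ^+ 2) ^+ (2 ^ s) <=
    C * (vol sigma / w0 * sigma `^ gam) * (norm2 v ^+ 2) ^+ (2 ^ s)) ->
  diam * sc i / r <= 1 -> bsupp v -> (forall x, Ex ci v x = 0) ->
  (norm2 (Tr r v) ^+ 2) ^+ (2 ^ s) <=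
  C * (jac G (diam / kap) * (diam * sc i / r) `^ gam) * (norm2 v ^+ 2) ^+ (2 ^ s).
Proof.
move=> r0 hC sr1 bv v0.
have ri0 : 0 < r^-1 by rewrite invr_gt0.
have jr0 := jac_gt0 G r0; have jri0 := jac_gt0 G ri0.
have jj : jac G r * jac G r^-1 = 1 by rewrite -jacM// divff ?jac1// gt_eqF.
pose c x := ci (dl G r x); pose w x := v (dl G r x).
have bw : bsupp w := bsupp_dl G r0 bv.
have mc : measurable_fun setT c.
  exact: (measurableT_comp (measurable_cen q theta ratio i) (measurable_dl G r)).
have bcell x := bsupp_cell (measurable_cen q theta ratio i) cell_bounded x.
have cE x y : \1_(cell c x) y = \1_(cell ci (dl G r x)) (dl G r y) :> R by rewrite !indicE.
have cmE x : cellm c x = jac G r^-1 * cellm ci (dl G r x).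
  rewrite /cellm -(integ_dl G r0 (bcell _)).
  by apply: eq_integ => y; exact: cE.
have hNT : norm2 (Tr r v) ^+ 2 = jac G r * norm2 (T0 G mu w) ^+ 2.
  rewrite !sqr_norm2; have b0 := bsupp_sqr (bsupp_T0 G mub bw).
  rewrite -[X in jac _ X](invrK r) -(integ_dl G ri0 b0).
  by apply: eq_integ => x; congr (_ ^+ 2); exact: Tr_conj.
rewrite hNT.
have hw : norm2 w ^+ 2 = jac G r^-1 * norm2 v ^+ 2 := norm2_dl r0 bv.
have cb (rho : R) : exists rho', forall x y, c x = c y -> `|x| <= rho -> `|y| <= rho'.
  have [K K0 hK] := dl_norm_le G r; have [L L0 hL] := dl_norm_le G r^-1.
  have [rho' h] := cell_bounded (K * rho).
  exists (L * rho') => x y xy xr; rewrite -(dlK G r0 y) (le_trans (hL _))// ler_wpM2l//.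
  by apply: h xy _; rewrite (le_trans (hK _))// ler_wpM2l.
have w00 : 0 < jac G r^-1 * vol (kap * sc i) by rewrite mulr_gt0// cell_vol_gt0.
have := hC c (jac G r^-1 * vol (kap * sc i)) (diam * sc i / r) w mc cb w00.
rewrite hw => H.
move: (norm2 (T0 G mu w) ^+ 2) (norm2 v ^+ 2) H => X Y H.
have e1 : 1 = jac G r ^+ (2 ^ s) * jac G r^-1 ^+ (2 ^ s) by rewrite -exprMn jj expr1n.
rewrite exprMn -[leRHS]mul1r e1 -mulrA ler_pM2l ?exprn_gt0//.
apply: (le_trans (H _ _ _ _ _)) => //; rewrite ?(exprMn _ (jac G r^-1)).
- by move=> x; rewrite cmE ler_pM2l// cellm_ge.
- move=> x y /cell_diam; rewrite dist_dl// mulrC => h.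
  by rewrite ler_pdivlMr.
- move=> x; rewrite /Ex (_ : integ _ = jac G r * (jac G r^-1 * integ (fun y => kern ci (dl G r x) y * v y))).
    by have := v0 (dl G r x); rewrite /Ex => ->; rewrite !mulr0.
  have bk := bsupp_kernM (measurable_cen q theta ratio i) cell_bounded (dl G r x) bv.
  rewrite -(integ_dl G r0 bk) -integZ; last exact: (bsupp_dl G r0 bk).
  apply: eq_integ => y; rewrite /kern cE cmE invfM /w.
  have -> : (jac G r^-1)^-1 = jac G r by rewrite -[LHS]mul1r -jj mulfK ?gt_eqF.
  ring.
have -> : vol (diam * sc i / r) / (jac G r^-1 * vol (kap * sc i)) = jac G (diam / kap).
  have alg (a c1 d1 : R) : a != 0 -> a * c1 / (a * d1) = c1 / d1.
    by move=> a0; rewrite invfM mulrACA mulfV ?mul1r.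
  rewrite -(vol_ratio diam_gt0 kap_gt0 (sc_gt0 i)) [diam * _ / r]mulrC (vol_dl _ ri0).
  by rewrite alg// gt_eqF.
by rewrite le_eqVlt; apply/orP; left; apply/eqP; ring.
Qed.

End Cells.

(** Relative to the averaging scale, the cells have diameter at most diam ratio^-M. If this is at
    most 1, [dilated_decay] applies, and the N-th root of its bound, N = 2^s, gives the exponent e =
    gam / N and rho = ratio^-e. Otherwise M is small and the trivial L^2 bound is enough, because
    (diam ratio^-M)^e >= 1. *)
Lemma scaled_decay (j : nat) : regular q (word G mu j.*2) ->
  exists Cd rho : R, [/\ 0 <= Cd, 0 < rho < 1 &
  forall theta (i M : nat) v, 0 < theta -> bsupp v ->
    (forall x, Ex (cen q theta ratio i) v x = 0) ->
    norm2 (Tr (scale theta ratio (i + M)) v) ^+ 2 <= Cd * rho ^+ M * norm2 v ^+ 2].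
Proof.
move=> /(T0_decay mub)[C [gam [s [C0 gam0 hC]]]].
have r1 : 1 <= ratio := ratio_ge1 ratio_big.
have rr1 : 1 < ratio.
  by apply: lt_le_trans ratio_big; have := exprn_ege1 4 (ctri_ge1 q); lra.
have r0 : 0 < ratio by exact: lt_le_trans r1.
have ri0 : 0 < ratio^-1 by rewrite invr_gt0.
pose N := (2 ^ s)%N; have N0 : (0 < N)%N by rewrite expn_gt0.
have NR : 0 < N%:R :> R by rewrite ltr0n.
pose e := gam / N%:R; have e0 : 0 < e by rewrite divr_gt0.
pose K := C * jac G (diam / kap).
have j0 : 0 < jac G (diam / kap) by rewrite jac_gt0// divr_gt0 ?diam_gt0// kap_gt0.
have K0 : 0 <= K by rewrite mulr_ge0// ltW.
have d0 := diam_gt0.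
exists (K `^ N%:R^-1 * diam `^ e + mass mu ^+ 2 * diam `^ e), (ratio^-1 `^ e); split.
- by rewrite addr_ge0// mulr_ge0 ?powR_ge0// sqr_ge0.
- by rewrite powR_gt0//= powR_lt1 ?ltW ?invr_lt1// ?unitf_gt0.
move=> theta i M v th0 bv v0.
have s0 := sc_gt0 th0 i; have sM0 := sc_gt0 th0 (i + M).
have sE : diam * scale theta ratio i / scale theta ratio (i + M) = diam * ratio^-1 ^+ M.
  rewrite /scale exprD exprVn; field.
  by rewrite !gt_eqF ?exprn_gt0.
have rM : ratio^-1 `^ e ^+ M = (ratio^-1 ^+ M) `^ e.
  by rewrite -powR_mulrn ?powR_ge0// -powRrM mulrC powRrM powR_mulrn// ltW.
have Y0 := sqr_ge0 (norm2 v).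
rewrite rM !mulrDl; have [s1|s1] := leP (diam * ratio^-1 ^+ M) 1.
  apply: (@le_trans _ _ (K `^ N%:R^-1 * diam `^ e * (ratio^-1 ^+ M) `^ e * norm2 v ^+ 2)); last first.
    by rewrite lerDl !mulr_ge0 ?powR_ge0 ?mass_ge0 ?norm2_ge0.
  rewrite -(@ler_pXn2r _ N)// ?nnegrE ?sqr_ge0// ?mulr_ge0 ?powR_ge0 ?norm2_ge0//.
  have := @dilated_decay theta i th0 (scale theta ratio (i + M)) v C gam s sM0.
  rewrite sE => /(_ _ s1 bv v0) H; apply: (le_trans (H _)).
    by move=> c w0 sigma w; exact: hC.
  rewrite !exprMn powRM ?(ltW d0)// ?exprn_ge0 ?(ltW ri0)//.
  have pN (a : R) : 0 <= a -> (a `^ e) ^+ N = a `^ gam.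
    by move=> a0; rewrite -powR_mulrn ?powR_ge0// -powRrM /e divfK// gt_eqF.
  rewrite !pN ?(ltW d0)// ?exprn_ge0 ?(ltW ri0)//.
  rewrite -[in leRHS](powR_mulrn N) ?powR_ge0// -powRrM mulVf ?gt_eqF// powRr1//.
  by rewrite le_eqVlt; apply/orP; left; apply/eqP; rewrite /K -/N; ring.
apply: (@le_trans _ _ (mass mu ^+ 2 * diam `^ e * (ratio^-1 ^+ M) `^ e * norm2 v ^+ 2)); last first.
  by apply: ler_wpDl => //; rewrite !mulr_ge0 ?powR_ge0 ?mass_ge0 ?norm2_ge0.
apply: (@le_trans _ _ (mass mu ^+ 2 * norm2 v ^+ 2)).
  rewrite -exprMn; apply: lerXn2r; rewrite ?nnegrE ?norm2_ge0//.
    by rewrite mulr_ge0 ?mass_ge0 ?norm2_ge0.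
  exact: (norm2_Op G mub (adm_dl _) bv).
rewrite ler_wpM2r// -mulrA ler_peMr ?sqr_ge0//.
rewrite -powRM ?(ltW d0)// ?exprn_ge0 ?(ltW ri0)//.
by rewrite -(powR1l e) ge0_ler_powR ?nnegrE ?(ltW e0) ?(ltW s1)// ltW// (lt_trans _ s1).
Qed.

End ScaledOperators.

Lemma weighted_cauchy_schwarz (R : realFieldType) (I : Type) (s : seq I) (w a : I -> R) :
  (forall i, 0 < w i) ->
  (\sum_(i <- s) a i) ^+ 2 <= (\sum_(i <- s) w i) * (\sum_(i <- s) a i ^+ 2 / w i).
Proof.
move=> w0; elim: s => [|i s IH]; first by rewrite !big_nil mul0r expr0n.
rewrite !big_cons.
have W0 : 0 <= \sum_(j <- s) w j by apply: sumr_ge0 => j _; exact: ltW.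
have Q0 : 0 <= \sum_(j <- s) a j ^+ 2 / w j.
  by apply: sumr_ge0 => j _; rewrite divr_ge0 ?sqr_ge0// ltW.
move: (\sum_(j <- s) a j) (\sum_(j <- s) w j) (\sum_(j <- s) a j ^+ 2 / w j) IH W0 Q0 => S W Q SWQ W0 Q0.
have [t ->] : exists t, a i = t * w i by exists (a i / w i); rewrite divfK// gt_eqF.
have wi := w0 i; rewrite exprMn [w i ^+ 2]expr2 mulrA mulfK ?gt_eqF//.
move: (w i) wi => v v0.
(* After multiplication by W this follows from S^2 <= W Q and (W t - S)^2 >= 0; W = 0 forces S =
   0. *)
suff : 2 * S * t <= W * t ^+ 2 + Q by nra.
have [W1|W1] := leP W 0.
  have WE : W = 0 by apply/eqP; rewrite eq_le W1.
  have S0 : S = 0.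
    by apply/eqP; rewrite -(sqrf_eq0 S) eq_le sqr_ge0 andbT (le_trans SWQ)// WE mul0r.
  by rewrite S0 WE; nra.
have : 0 <= W * (W * t ^+ 2 + Q - 2 * S * t) by have := sqr_ge0 (W * t - S); nra.
by rewrite pmulr_rge0//; lra.
Qed.

(** * Martingale differences and the square sum of the remainders *)

Section Filtration.
Context {R : realType} {n : nat}.
Notation V := 'rV[R]_n.
Notation lam := (@lebesgue R n).
Implicit Types (x y z : V) (r k : R) (f g v w : V -> R).
Variables (c : nat -> V -> V) (E : nat -> (V -> R) -> V -> R).
Hypotheses
  (nested : forall i j x y, (i <= j)%N -> c i x = c i y -> c j x = c j y)
  (bE : forall i f, bsupp f -> bsupp (E i f))
  (E_cell : forall i f x y, c i x = c i y -> E i f x = E i f y)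
  (E_inv : forall i h x, (forall y z, c i y = c i z -> h y = h z) -> E i h x = h x)
  (E_tower : forall i j f x, (i <= j)%N -> bsupp f -> E j (E i f) x = E j f x)
  (E_adj : forall i f g, bsupp f -> bsupp g ->
    integ (fun x => E i f x * g x) = integ (fun x => f x * E i g x))
  (E_B : forall i f g, bsupp f -> bsupp g ->
    E i (fun x => f x - g x) = (fun x => E i f x - E i g x)).

Lemma E_tower_inv i j f x : (i <= j)%N -> E i (E j f) x = E j f x.
Proof. by move=> ij; apply: E_inv => u w /(nested ij) uw; exact: E_cell. Qed.

(** Martingale differences of a filtration that becomes coarser with the index. They are numbered by
    the level on whose cells they have mean zero; number 0 is the part of f below the finest
    cells. *)
Definition mdiff (l : nat) f : V -> R :=
  if l is k.+1 then (fun x => E k f x - E k.+1 f x) else (fun x => f x - E 0 f x).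

Lemma bsupp_mdiff l f : bsupp f -> bsupp (mdiff l f).
Proof.
move=> bf; case: l => [|l]; first exact: (bsuppB bf (bE 0 bf)).
exact: (bsuppB (bE l bf) (bE l.+1 bf)).
Qed.

Lemma mdiff_mean_zero l f x : bsupp f -> E l (mdiff l f) x = 0.
Proof.
move=> bf; case: l => [|l].
  by rewrite (E_B 0 bf (bE 0 bf)) E_tower_inv// subrr.
by rewrite (E_B l.+1 (bE l bf) (bE l.+1 bf)) (E_tower _ (leqnSn l) bf) (E_tower_inv _ _ (leqnn l.+1)) subrr.
Qed.

Lemma sum_mdiff i f x : \sum_(l < i.+1) mdiff l f x = f x - E i f x.
Proof.
elim: i => [|i IH]; first by rewrite big_ord1.
by rewrite big_ord_recr IH /= subrKA.
Qed.

Lemma integ_sqrB f g : bsupp f -> bsupp g ->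
  integ (fun x => f x * g x) = integ (fun x => g x ^+ 2) ->
  norm2 (fun x => f x - g x) ^+ 2 = norm2 f ^+ 2 - norm2 g ^+ 2.
Proof.
move=> bf bg cross; rewrite !sqr_norm2.
transitivity (integ (fun x => (f x ^+ 2 - f x * g x) - (f x * g x - g x ^+ 2))).
  by apply: eq_integ => x; ring.
have b1 := bsupp_sqr bf; have b2 := bsupp_mul bf bg; have b3 := bsupp_sqr bg.
rewrite (integB (bsuppB b1 b2) (bsuppB b2 b3)) (integB b1 b2) (integB b2 b3).
by rewrite cross subrr subr0.
Qed.

(** The E i are orthogonal projections onto decreasing spaces, so each difference contributes the
    drop in the squared norm of the averages, and the sum telescopes. *)
Lemma sum_norm2_mdiff i f : bsupp f ->
  \sum_(l < i.+1) norm2 (mdiff l f) ^+ 2 = norm2 f ^+ 2 - norm2 (E i f) ^+ 2.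
Proof.
move=> bf; elim: i => [|i IH].
  rewrite big_ord1; apply: (integ_sqrB bf (bE 0 bf)).
  transitivity (integ (fun x => f x * E 0 (E 0 f) x)).
    by apply: eq_integ => x; rewrite E_tower_inv.
  by rewrite -(E_adj 0 bf (bE 0 bf)); under eq_integ do rewrite -expr2.
rewrite big_ord_recr IH [mdiff _ _]/= (integ_sqrB (bE i bf) (bE i.+1 bf)).
  by rewrite /= addrA subrK.
rewrite (E_adj i bf (bE i.+1 bf)).
transitivity (integ (fun x => f x * E i.+1 (E i.+1 f) x)).
  by apply: eq_integ => x; rewrite E_tower_inv// E_tower_inv.
by rewrite -(E_adj i.+1 bf (bE i.+1 bf)); under eq_integ do rewrite -expr2.
Qed.

Variable T : nat -> (V -> R) -> V -> R.
Hypotheses (bT : forall i f, bsupp f -> bsupp (T i f))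
  (TD : forall i f g, bsupp f -> bsupp g ->
    T i (fun x => f x + g x) = (fun x => T i f x + T i g x))
  (TZ : forall i f k, bsupp f -> T i (fun x => k * f x) = (fun x => k * T i f x)).

Lemma T_sum i (F : nat -> V -> R) m x : (forall l, bsupp (F l)) ->
  T i (fun x => \sum_(l < m) F l x) x = \sum_(l < m) T i (F l) x.
Proof.
move=> bF; elim: m => [|m IH].
  rewrite big_ord0; have -> : (fun x => \sum_(l < 0) F l x) = (fun x => 0 * F 0 x).
    by apply/funext => y; rewrite big_ord0 mul0r.
  by rewrite TZ// mul0r.
have -> : (fun x => \sum_(l < m.+1) F l x) = (fun x => \sum_(l < m) F l x + F m x).
  by apply/funext => y; rewrite big_ord_recr.
have bS : bsupp (fun x => \sum_(l < m) F l x) by apply: bsupp_sum => l.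
by rewrite (TD i bS (bF m)) big_ord_recr IH.
Qed.

Lemma sum_geo_le (s : R) (m : nat) : 0 <= s < 1 -> \sum_(l < m) s ^+ l <= (1 - s)^-1.
Proof.
move=> /andP[s0 s1]; have d0 : 0 < 1 - s by rewrite subr_gt0.
rewrite -[leRHS]mul1r ler_pdivlMr// mulrC -opprB mulNr -subrX1 opprB.
by rewrite lerBlDr lerDl exprn_ge0.
Qed.

Lemma sum_geo_shift (s : R) (l m : nat) :
  \sum_(i < m | (l <= i)%N) s ^+ (i - l) = \sum_(j < m - l) s ^+ j.
Proof.
elim: m => [|m IH]; first by rewrite sub0n !big_ord0.
rewrite big_mkcond big_ord_recr /= -big_mkcond IH; case: leqP => lm.
  by rewrite subSn// big_ord_recr.
have [e1 e2] : (m.+1 - l = 0 /\ m - l = 0)%N by lia.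
by rewrite e1 e2 big_ord0 addr0.
Qed.

(** f - E i f is the sum of the differences of levels l <= i, and the one of level l is i - l + M
    levels below the scale of T (i + M), so it decays by rho^(i - l + M). Cauchy-Schwarz with
    weights s^(i - l), s = sqrt rho, spends half of rho^(i - l) on the sum over l; the other half
    makes the sum over i converge. Each of the two geometric series costs 1/(1 - s), and
    orthogonality of the differences concludes. *)
Lemma L2_tail (L M : nat) (Cd rho : R) f : 0 <= Cd -> 0 < rho < 1 -> bsupp f ->
  (forall (i M : nat) v, bsupp v -> (forall x, E i v x = 0) ->
    norm2 (T (i + M) v) ^+ 2 <= Cd * rho ^+ M * norm2 v ^+ 2) ->
  \sum_(i < L.+1) norm2 (T (i + M) (fun x => f x - E i f x)) ^+ 2 <=
  Cd / (1 - Num.sqrt rho) ^+ 2 * rho ^+ M * norm2 f ^+ 2.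
Proof.
move=> Cd0 /andP[rho0 rho1] bf hT.
pose s := Num.sqrt rho; have s0 : 0 < s by rewrite sqrtr_gt0.
have s2 : s ^+ 2 = rho by rewrite sqr_sqrtr// ltW.
have s1 : s < 1 by rewrite -(@ltr_pXn2r _ 2)// ?nnegrE ?(ltW s0)// s2 expr1n.
have d0 : 0 < 1 - s by rewrite subr_gt0.
have bm l := bsupp_mdiff l bf.
pose N l := norm2 (mdiff l f) ^+ 2.
have N0 l : 0 <= N l by exact: sqr_ge0.
have step (i : nat) : norm2 (T (i + M) (fun x => f x - E i f x)) ^+ 2 <=
    Cd * rho ^+ M / (1 - s) * \sum_(l < i.+1) s ^+ (i - l) * N l.
  rewrite sqr_norm2.
  apply: (@le_trans _ _ (integ (fun x => \sum_(l < i.+1)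
      ((1 - s)^-1 * s ^- (i - l)) * T (i + M) (mdiff l f) x ^+ 2))).
    apply: integ_le => [||x].
    - by apply: bsupp_sqr; apply: bT; exact: (bsuppB bf (bE i bf)).
    - by apply: bsupp_sum => l; apply: bsuppZ; apply: bsupp_sqr; exact: bT.
    have -> : (fun x => f x - E i f x) = (fun x => \sum_(l < i.+1) mdiff l f x).
      by apply/funext => y; rewrite sum_mdiff.
    rewrite (T_sum (i + M) i.+1 x (F := fun l => mdiff l f))//.
    have := weighted_cauchy_schwarz (index_enum 'I_i.+1)
      (fun l : 'I_i.+1 => T (i + M) (mdiff l f) x) (fun l => exprn_gt0 (i - l) s0).
    move=> /le_trans; apply.
    have -> : \sum_(l < i.+1) (1 - s)^-1 * s ^- (i - l) * T (i + M) (mdiff l f) x ^+ 2 =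
       (1 - s)^-1 * \sum_(l < i.+1) (T (i + M) (mdiff l f) x ^+ 2 / s ^+ (i - l)).
      by rewrite big_distrr; apply: eq_bigr => l _ /=; ring.
    apply: ler_wpM2r.
      by apply: sumr_ge0 => l _; rewrite divr_ge0 ?sqr_ge0// exprn_ge0// ltW.
    rewrite (reindex_inj rev_ord_inj) /=.
    rewrite (eq_bigr (fun l : 'I_i.+1 => s ^+ l)).
      by apply: sum_geo_le; rewrite (ltW s0).
    by move=> l _; rewrite subSS subKn// -ltnS.
  rewrite integ_sum; last by move=> l; apply: bsuppZ; apply: bsupp_sqr; exact: bT.
  rewrite big_distrr; apply: ler_sum => l _.
  have li : (l <= i)%N by rewrite -ltnS.
  rewrite integZ; last by apply: bsupp_sqr; exact: bT.
  rewrite -sqr_norm2.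
  have := hT l (i - l + M)%N _ (bm l) (fun x => mdiff_mean_zero l x bf).
  rewrite addnA subnKC// => h.
  apply: (le_trans (ler_wpM2l _ h)).
    by rewrite mulr_ge0 ?invr_ge0 ?exprn_ge0 ?(ltW s0) ?(ltW d0).
  have sn : s ^- (i - l) * rho ^+ (i - l) = s ^+ (i - l).
    by rewrite -s2 -exprM mul2n -addnn exprD mulKf// expf_neq0// gt_eqF.
  rewrite le_eqVlt; apply/orP; left; apply/eqP; rewrite /N /= exprD -[X in _ = _ * (X * _)]sn; ring.
apply: (@le_trans _ _ (\sum_(i < L.+1) Cd * rho ^+ M / (1 - s) * \sum_(l < L.+1 | (l <= i)%N) s ^+ (i - l) * N l)).
  apply: ler_sum => i _; apply: (le_trans (step i)).
  rewrite ler_wpM2l ?divr_ge0 ?mulr_ge0 ?exprn_ge0 ?(ltW rho0) ?(ltW d0)//.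
  rewrite le_eqVlt; apply/orP; left; apply/eqP.
  rewrite (big_ord_widen_cond L.+1 xpredT (fun l : nat => s ^+ (i - l) * N l))//.
rewrite -big_distrr /= (exchange_big_dep xpredT)//=.
apply: (@le_trans _ _ (Cd * rho ^+ M / (1 - s) * \sum_(l < L.+1) (1 - s)^-1 * N l)).
  rewrite ler_wpM2l ?divr_ge0 ?mulr_ge0 ?exprn_ge0 ?(ltW rho0) ?(ltW d0)//.
  apply: ler_sum => l _; rewrite -big_distrl /= ler_wpM2r//.
  by rewrite sum_geo_shift sum_geo_le// (ltW s0).
rewrite -big_distrr /= sum_norm2_mdiff//.
rewrite [leLHS](_ : _ = Cd / (1 - s) ^+ 2 * rho ^+ M * (norm2 f ^+ 2 - norm2 (E L f) ^+ 2)); last first.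
  by rewrite expr2 invfM; ring.
rewrite ler_wpM2l// ?lerBlDr ?lerDl ?sqr_ge0//.
by rewrite mulr_ge0 ?divr_ge0 ?sqr_ge0 ?exprn_ge0// ltW.
Qed.

(** * Stopping levels and the critical parts of the averages *)

Section Stopping.
Variables (f : V -> R) (tau : R) (L : nat).
Hypotheses (bf : bsupp f) (f0 : forall x, 0 <= f x) (tau0 : 0 < tau)
  (E_ge0 : forall i x, 0 <= E i f x).

(* [s] is the last level at which the averages of [f] exceed [tau]. *)
Definition stops (s : nat) x : bool := [&& (s <= L)%N, tau < E s f x &
  all (fun j => E j f x <= tau) (iota s.+1 (L - s))].

Definition stop_at s x : R := (stops s x)%:R.

Lemma stops_ex i x : (i <= L)%N -> tau < E i f x -> exists2 s, (i <= s)%N & stops s x.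
Proof.
move=> iL ti; pose P j := (j <= L)%N && (tau < E j f x).
have ex : exists j, P j by exists i; rewrite /P iL.
have ub j : P j -> (j <= L)%N by case/andP.
case: (ex_maxnP ex ub) => s /andP[sL ts] smax; exists s.
  by apply: smax; rewrite /P iL.
rewrite /stops sL ts; apply/allP => j; rewrite mem_iota => /andP[sj jL].
have jL' : (j <= L)%N by move: jL; rewrite addSn subnKC// ltnS.
rewrite leNgt; apply/negP => tj; have : P j by rewrite /P jL'.
by move=> /smax; rewrite leqNgt sj.
Qed.

Lemma stops_uniq s t x : stops s x -> stops t x -> s = t.
Proof.
wlog st : s t / (s <= t)%N.
  by move=> h; case: (leqP s t) => [|/ltnW] st hs ht; [exact: h|symmetry; exact: h].
move=> /and3P[sL ts /allP hs] /and3P[tL tf _].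
apply/eqP; rewrite eqn_leq st leqNgt; apply/negP => lt.
have := hs t; rewrite mem_iota lt addSn subnKC// ltnS tL => /(_ isT).
by rewrite leNgt tf.
Qed.

Lemma stop_at_cell i s x y : (i <= s)%N -> c i x = c i y -> stop_at s x = stop_at s y.
Proof.
move=> is_ /(nested is_) xy; rewrite /stop_at /stops (E_cell f xy).
congr (_ && (_ && _))%:R; apply: eq_in_all => j; rewrite mem_iota => /andP[sj _].
by rewrite (E_cell f (nested (ltnW sj) xy)).
Qed.

Lemma stop_at_ge0 s x : 0 <= stop_at s x.
Proof. by rewrite /stop_at ler0n. Qed.

Lemma measurable_stop_at s : measurable_fun setT (stop_at s).
Proof.
have mE j : measurable_fun setT (E j f) by exact: bsupp_measurable (bE j bf).
have ms : measurable_fun setT (stops s : V -> bool).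
  apply: measurable_and; first exact: measurable_cst.
  apply: measurable_and; first exact: measurable_fun_ltr.
  elim: (iota _ _) => [|j l IH]; first exact: measurable_cst.
  by apply: measurable_and => //; exact: measurable_fun_ler.
rewrite (_ : stop_at s = \1_(stops s @^-1` [set true])).
  by apply: measurable_indic; exact: measurable_preimage.
apply/funext => x; rewrite indicE /stop_at.
by case h : (stops s x); [rewrite mem_set|rewrite memNset//= h].
Qed.

Lemma stop_at_le s x : tau * stop_at s x <= stop_at s x * E s f x.
Proof.
rewrite /stop_at; case h : (stops s x); last by rewrite mulr0 mul0r.
by case/and3P : h => _ /ltW; rewrite mulr1 mul1r.
Qed.

Lemma bsupp_stop_at s : bsupp (stop_at s).
Proof.
apply: (bsupp_le (g := fun x => tau^-1 * E s f x)).
- exact: measurable_stop_at.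
- move=> x; rewrite ger0_norm ?stop_at_ge0// ger0_norm; last first.
    by rewrite mulr_ge0// invr_ge0 ltW.
  rewrite ler_pdivlMl// (le_trans (stop_at_le s x))// /stop_at.
  by case: (stops s x); rewrite ?mul1r ?mul0r.
- by apply: bsuppZ; exact: bE.
Qed.

Lemma sum_stop_at_le1 x : \sum_(s < L.+1) stop_at s x <= 1.
Proof.
case: (pselect (exists s : nat, (s < L.+1)%N && stops s x)) => [[s /andP[sL hs]]|no].
  rewrite (bigD1 (Ordinal sL))//= big1 ?addr0.
    by rewrite /stop_at hs.
  move=> t ts; rewrite /stop_at; case h : (stops t x) => //.
  by case/eqP : ts; apply: val_inj; rewrite /= (stops_uniq hs h).
rewrite big1// => t _; rewrite /stop_at; case h : (stops t x) => //.
by exfalso; apply: no; exists t; rewrite ltn_ord h.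
Qed.

(** The set stopped at a level s >= i is a union of cells of level i, so its indicator is fixed by E
    i, and self-adjointness removes the average. *)
Lemma integ_stop_at_E i s : (i <= s)%N ->
  integ (fun x => stop_at s x * E i f x) = integ (fun x => stop_at s x * f x).
Proof.
move=> is_; rewrite -(E_adj i (bsupp_stop_at s) bf).
apply: eq_integ => x; rewrite E_inv// => y z; exact: stop_at_cell.
Qed.

Lemma integ_stop_at s : tau * integ (stop_at s) <= integ (fun x => stop_at s x * f x).
Proof.
have bs := bsupp_stop_at s.
rewrite -(integ_stop_at_E (leqnn s)) -integZ//; apply: integ_le => [||x].
- exact: bsuppZ.
- by apply: bsupp_mul => //; exact: bE.
- exact: stop_at_le.
Qed.

Lemma sum_integ_stop_at : \sum_(s < L.+1) integ (fun x => stop_at s x * f x) <= integ f.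
Proof.
have bs (s : nat) := bsupp_mul (bsupp_stop_at s) bf.
rewrite -integ_sum; last by move=> s; exact: bs.
apply: integ_le => [||x] //; first by apply: bsupp_sum => s; exact: bs.
by rewrite -big_distrl /= ler_piMl// sum_stop_at_le1.
Qed.

(* The part of [E i f] living where the stopping level is in [[i, i + M)]; the
   factor [M] in its total mass is paid for by the decay [rho ^+ M] of the rest. *)
Definition critical (M i : nat) x : R :=
  (\sum_(s < L.+1 | (i <= s < i + M)%N) stop_at s x) * E i f x.

Lemma critical_ge0 M i x : 0 <= critical M i x.
Proof. by rewrite mulr_ge0// sumr_ge0// => s _; exact: stop_at_ge0. Qed.

Lemma bsupp_critical M i : bsupp (critical M i).
Proof.
apply: bsupp_mul; last exact: bE.
by apply: bsupp_sum => s; exact: bsupp_stop_at.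
Qed.

(** After the averages are removed, a stopping level s is counted only for the indices i in the
    interval from s + 1 - M to s, of which there are at most M; the stopped sets themselves are
    disjoint. *)
Lemma sum_integ_critical M : \sum_(i < L.+1) integ (critical M i) <= M%:R * integ f.
Proof.
have bs (s : nat) := bsupp_mul (bsupp_stop_at s) bf.
have -> : \sum_(i < L.+1) integ (critical M i) = \sum_(i < L.+1)
    \sum_(s < L.+1 | (i <= s < i + M)%N) integ (fun x => stop_at s x * f x).
  apply: eq_bigr => i _; rewrite /critical.
  under eq_integ do rewrite big_distrl.
  rewrite integ_sum; last by move=> s; apply: bsupp_mul; [exact: bsupp_stop_at|exact: bE].
  by apply: eq_bigr => s /andP[is_ _]; rewrite integ_stop_at_E.
rewrite (exchange_big_dep xpredT)//=.
apply: (@le_trans _ _ (\sum_(s < L.+1) M%:R * integ (fun x => stop_at s x * f x))).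
  apply: ler_sum => s _; rewrite sumr_const -[leLHS]mulr_natl.
  rewrite ler_wpM2r ?integ_ge0 ?ler_nat//.
    by move=> x; rewrite mulr_ge0// stop_at_ge0.
  rewrite cardE -(size_map val) -[leqRHS](size_iota (s.+1 - M)); apply: uniq_leq_size.
    by rewrite (map_inj_uniq val_inj) enum_uniq.
  move=> k /mapP[i]; rewrite mem_enum => /andP[h1 h2] -> /=; rewrite mem_iota; move: h1 h2; move: (nat_of_ord i) => j; lia.
by rewrite -big_distrr /= ler_wpM2l// sum_integ_stop_at.
Qed.

End Stopping.

End Filtration.

(** * The weak-type bound for the maximal average over finitely many scales *)

Section WeakType.
Context {R : realType} {n : nat} (G : homogeneousGroup R n) (q : quasiNorm G).
Hypothesis qN : forall x, q (- x) = q x.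
Notation V := 'rV[R]_n.
Notation lam := (@lebesgue R n).
Variables (mu : {finite_measure set V -> \bar R}) (b : R).
Hypothesis mub : mu (~` norm_ball b) = 0.
Variables (ratio theta : R).
Hypotheses (ratio_big : 32 * ctri q ^+ 4 <= ratio) (theta_gt0 : 0 < theta).
Implicit Types (x y z : V) (r k : R) (f g v w : V -> R).
Notation sc := (scale theta ratio).
Notation T i := (Tr G mu (sc i)).

(** Stands in for the enlargement of a set by balls of radius r: as a convolution, its measurability
    and its integral come from Fubini. *)
Definition nearby r g x : R := integ (fun y => g y * \1_(qball q r) (gmul G (- x) y)).

Lemma nearby_dom r g : bsupp g -> exists rho : R, forall x y,
  `|g y * \1_(qball q r) (gmul G (- x) y)| <= `|\1_(norm_ball rho) x : R| * `|g y|.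
Proof.
move=> bg; have [M M0 [rho [gM gr]]] := bsupp_bound bg.
have [S S0 hS] := qnorm_ub q rho.
have [N N0 hN] := qnorm_proper q (ctri q * (S + r)).
exists N => x y; rewrite normrM mulrC; have [->|g0] := eqVneq (g y) 0.
  by rewrite normr0 !mulr0.
rewrite ler_wpM2r// !indicE; case: (boolP (gmul G (- x) y \in _)) => [/set_mem yd|_].
  rewrite mem_set//; apply: hN.
  have -> : q x = dist q 0 x by rewrite /dist oppr0 gmul0x.
  apply: (le_trans (dist_triangle q 0 y x)); rewrite ler_pM2l ?ctri_gt0//.
  rewrite lerD//; last by rewrite distC.
  by rewrite /dist oppr0 gmul0x hS// gr.
by rewrite normr0.
Qed.

Lemma measurable_nearby_kernel r g : measurable_fun setT g ->
  measurable_fun setT (fun p : V * V => g p.2 * \1_(qball q r) (gmul G (- p.1) p.2)).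
Proof.
move=> mg; apply: measurable_funM; first exact: (measurableT_comp mg measurable_snd).
apply: (measurableT_comp (bsupp_measurable (bsupp_qball q r))).
apply: measurable_fun_gmul; last exact: measurable_snd.
by apply: measurable_fun_oppV; exact: measurable_fst.
Qed.

Lemma bsupp_norm_ball (rho : R) : bsupp (\1_(norm_ball rho) : V -> R).
Proof. by apply: (@bsupp_indic _ _ _ rho) => //; exact: measurable_norm_ball. Qed.

Lemma bsupp_nearby r g : bsupp g -> bsupp (nearby r g).
Proof.
move=> bg; have [rho h] := nearby_dom r bg.
have mk := measurable_nearby_kernel r (bsupp_measurable bg).
apply: (bsupp_le (g := fun x => integ (fun y => `|g y|) * \1_(norm_ball rho) x)).
- exact: (measurable_integ_param mk (bsupp_norm_ball rho) bg h).
- move=> x; have bgx : bsupp (fun y => g y * \1_(qball q r) (gmul G (- x) y)).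
    by apply: bsupp_mul => //; exact: (bsupp_gmull G (- x) (bsupp_qball q r)).
  apply: (le_trans (integ_abs bgx)).
  rewrite normrM ger0_norm ?integ_ge0// mulrC -integZ; last exact: bsupp_abs.
  apply: integ_le => [||y]; [exact: bsupp_abs| |exact: h].
  by apply: bsuppZ; exact: bsupp_abs.
- by apply: bsuppZ; exact: bsupp_norm_ball.
Qed.

Lemma integ_nearby r g : bsupp g -> integ (nearby r g) = vol q r * integ g.
Proof.
move=> bg; have [rho h] := nearby_dom r bg.
have mk := measurable_nearby_kernel r (bsupp_measurable bg).
rewrite /nearby (integ_fubini mk (bsupp_norm_ball rho) bg h) -integZ//.
apply: eq_integ => y /=; rewrite mulrC.
rewrite [integ _](_ : _ = integ (fun x => g y * \1_(qball q r) (gmul G (- y) x))); last first.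
  apply: eq_integ => x; congr (_ * _); rewrite !indicE; congr (nat_of_bool _)%:R.
  have e : q (gmul G (- x) y) = q (gmul G (- y) x) by rewrite -qN gmulN opprK.
  by apply/idP/idP => /set_mem hq; apply/mem_set; move: hq; rewrite /qball /= e.
rewrite integZ; last exact: (bsupp_gmull G (- y) (bsupp_qball q r)).
by rewrite (integ_gmull G (- y) (bsupp_qball q r)).
Qed.

Lemma nearby_ge0 r g x : (forall y, 0 <= g y) -> 0 <= nearby r g x.
Proof.
by move=> g0; apply: integ_ge0 => y; rewrite mulr_ge0//; case/andP: (@indic01 R n (qball q r) (gmul G (- x) y)).
Qed.

Variables (c : nat -> V -> V) (E : nat -> (V -> R) -> V -> R).
Hypotheses
  (nested : forall i j x y, (i <= j)%N -> c i x = c i y -> c j x = c j y)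
  (bE : forall i f, bsupp f -> bsupp (E i f))
  (E_cell : forall i f x y, c i x = c i y -> E i f x = E i f y)
  (E_inv : forall i h x, (forall y z, c i y = c i z -> h y = h z) -> E i h x = h x)
  (E_tower : forall i j f x, (i <= j)%N -> bsupp f -> E j (E i f) x = E j f x)
  (E_adj : forall i f g, bsupp f -> bsupp g ->
    integ (fun x => E i f x * g x) = integ (fun x => f x * E i g x))
  (E_B : forall i f g, bsupp f -> bsupp g ->
    E i (fun x => f x - g x) = (fun x => E i f x - E i g x))
  (E_ge0 : forall i f x, (forall y, 0 <= f y) -> 0 <= E i f x)
  (c_ball : forall i x y, dist q (c i x) y <= kap q * sc i -> c i y = c i x)
  (c_diam : forall i x y, c i x = c i y -> dist q x y <= diam q * sc i).

Let sc0 i : 0 < sc i := scale_gt0 theta_gt0 ratio_big i.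

Section Fixed.
Variables (f : V -> R) (tau : R) (L M : nat).
Hypotheses (bf : bsupp f) (f0 : forall x, 0 <= f x) (tau0 : 0 < tau) (M0 : (0 < M)%N).
Variable (Dq : R).
Hypotheses (Dq_gt0 : 0 < Dq)
  (DqP : forall y r, `|y| <= b -> 0 < r -> ctri q * (q (dl G r y) + diam q * r) <= Dq * r).

Notation stop_at := (stop_at E f tau L).
Notation stops := (stops E f tau L).
Notation critical := (critical E f tau L).

Let bs s : bsupp (stop_at s) := bsupp_stop_at bE L bf tau0 (fun i x => E_ge0 i x f0) s.
Let bc i : bsupp (critical M i) := bsupp_critical bE L bf tau0 (fun i x => E_ge0 i x f0) M i.

(* At least 1 at every point that an average at scale at most [sc s] can join
   to a cell stopped at level [s]. *)
Definition bad x : R :=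
  \sum_(s < L.+1) (vol q (kap q * sc s))^-1 * nearby (Dq * sc s) (stop_at s) x.

Lemma bad_term_ge0 (s : nat) x : 0 <= (vol q (kap q * sc s))^-1 * nearby (Dq * sc s) (stop_at s) x.
Proof.
rewrite mulr_ge0 ?invr_ge0 ?(ltW (vol_gt0 q (mulr_gt0 (kap_gt0 q) (sc0 s))))//.
by apply: nearby_ge0 => y; exact: stop_at_ge0.
Qed.

(** With z its whole cell is stopped. The cell contains a ball of radius kap sc(s), all of it within
    Dq sc(s) of x, and the normalisation in [bad] is the volume of that ball. *)
Lemma bad_ge1 (s : nat) x z : stops s z -> dist q x z <= (Dq / ctri q - diam q) * sc s -> 1 <= bad x.
Proof.
move=> sz xz; have sL : (s < L.+1)%N by case/and3P: sz.
have w0 : 0 < vol q (kap q * sc s) by rewrite vol_gt0// mulr_gt0// kap_gt0.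
rewrite /bad (bigD1 (Ordinal sL))//= -[leLHS]addr0 lerD//; last first.
  by apply: sumr_ge0 => t _; exact: bad_term_ge0.
rewrite ler_pdivlMl// mulr1 -(integ_dist q (c s z)).
apply: integ_le => [||y].
- exact: bsupp_dist.
- by apply: bsupp_mul => //; exact: (bsupp_gmull G (- x) (bsupp_qball q _)).
rewrite indicE; case: (boolP (y \in _)) => [/set_mem/= yc|_]; last first.
  by rewrite mulr_ge0 ?stop_at_ge0//; case/andP: (@indic01 R n (qball q (Dq * sc s)) (gmul G (- x) y)).
have zy := c_ball yc.
rewrite (stop_at_cell nested E_cell f tau L (leqnn s) zy) /stop_at sz mul1r.
rewrite indicE mem_set// /qball /=.
apply: (le_trans (dist_triangle q x z y)).
rewrite -ler_pdivlMl ?ctri_gt0//.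
have zy' := c_diam (esym zy).
apply: (le_trans (lerD xz zy')); rewrite le_eqVlt; apply/orP; left; apply/eqP; ring.
Qed.

(** The volumes of balls of radii Dq sc(s) and kap sc(s) have a ratio independent of s; Chebyshev's
    inequality on each stopped set supplies 1/tau. *)
Lemma integ_bad : integ bad <= jac G (Dq / kap q) * tau^-1 * integ f.
Proof.
rewrite integ_sum; last by move=> s; apply: bsuppZ; exact: bsupp_nearby.
apply: (@le_trans _ _ (\sum_(s < L.+1) jac G (Dq / kap q) * tau^-1 * integ (fun x => stop_at s x * f x))).
  apply: ler_sum => s _; rewrite integZ; last exact: bsupp_nearby.
  rewrite integ_nearby// mulrA [_^-1 * _]mulrC (vol_ratio q Dq_gt0 (kap_gt0 q) (sc0 s)).
  rewrite -mulrA ler_wpM2l ?jac_ge0// ler_pdivlMl//.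
  exact: (integ_stop_at nested bE E_cell E_inv E_adj L bf tau0 (fun i x => E_ge0 i x f0) s).
rewrite -big_distrr /= ler_wpM2l//.
  by rewrite mulr_ge0 ?jac_ge0// invr_ge0 ltW.
exact: (sum_integ_stop_at bE L bf f0 tau0 (fun i x => E_ge0 i x f0)).
Qed.

(** Let z be a point entering the average at x. Either E i f z <= tau, or z stops at some level s >=
    i. For s < i + M the value is part of [critical]. For s >= i + M the averaging scale does not
    exceed that of the stopped cell, so x is close to it and bad x >= 1. *)
Lemma T_average_le (i : nat) x : (i <= L)%N -> bad x < 1 ->
  T (i + M) (E i f) x <= tau * mass mu + T (i + M) (critical M i) x.
Proof.
move=> iL bx; have asc := adm_dl G b (sc (i + M)).
have [K1 K10 hK1] := dl_norm_le G (sc (i + M)).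
have [K _ hK] := gmul_bound G (Num.max `|x| (K1 * b)).
(* The constant tau, cut off to a ball that contains every point entering the average at x, since
   the operators act on functions of bounded support. *)
have bI := bsuppZ tau (bsupp_norm_ball K).
have bEf := bE i bf.
apply: (@le_trans _ _ (T (i + M) (fun z => tau * \1_(norm_ball K) z + critical M i z) x)); last first.
  rewrite /Tr (OpD G mu asc bI (bc i)) lerD2r.
  apply: (le_trans (ler_norm _)); apply: (Op_bound G mu x asc bI) => y.
  rewrite normrM (gtr0_norm tau0) ler_piMr ?(ltW tau0)//.
  by rewrite indicE; case: (_ \in _); rewrite ?normr1 ?normr0.
rewrite /Tr; have := @Op_le_restrict _ _ G _ _ mub _ _ _ x asc bEf (bsuppD bI (bc i)); apply.
move=> y yb; set z := gmul G x _.
have Kz : norm_ball K z.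
  have yK : `|- dl G (sc (i + M)) y| <= K1 * b by rewrite normrN (le_trans (hK1 y))// ler_wpM2l.
  by apply: hK; rewrite le_max ?lexx// yK orbT.
rewrite indicE mem_set// mulr1.
have [Ez|Ez] := leP (E i f z) tau.
  by rewrite (le_trans Ez)// lerDl critical_ge0// => j w; exact: E_ge0.
have [s is_ sz] := stops_ex iL Ez.
have sL : (s < L.+1)%N by case/and3P: sz.
have [siM|iMs] := ltnP s (i + M).
  apply: ler_wpDl; first exact: ltW.
  rewrite /critical ler_peMl ?E_ge0// (bigD1 (Ordinal sL)) /= ?is_ ?siM//.
  rewrite {1}/stop_at sz lerDl sumr_ge0// => t _; exact: stop_at_ge0.
exfalso; move: bx; apply/negP; rewrite -leNgt; apply: (bad_ge1 sz).
rewrite /z dist_gmul qN.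
have scs : sc (i + M) <= sc s := scale_le theta_gt0 ratio_big iMs.
have := DqP yb (sc0 (i + M)); rewrite qnorm_dl//.
rewrite -ler_pdivlMl ?ctri_gt0// => h.
apply: (@le_trans _ _ ((Dq / ctri q - diam q) * sc (i + M))).
  by rewrite mulrBl lerBrDr (le_trans h)// mulrA [_^-1 * _]mulrC.
rewrite ler_wpM2l// -(ler_pM2r (sc0 (i + M))) mul0r mulrBl subr_ge0.
apply: le_trans (_ : (ctri q)^-1 * (Dq * sc (i + M)) <= _); last by rewrite mulrA [_^-1 * _]mulrC.
by rewrite (le_trans _ h)// lerDr mulr_ge0 ?qnorm_ge0// ltW.
Qed.

(** The exceptional set is represented by a function W that is at least 1 on it, so its measure is
    at most integ W and several causes simply add up: [bad], a Chebyshev majorant W1 in L^1 for the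
    critical parts, and one in L^2, W2, for the remainders f - E i f. Where all three are below 1, T
    f is at most mass tau + tau + tau. *)
Lemma weak_type (Cd rho : R) : 0 <= Cd -> 0 < rho < 1 ->
  (forall (i M : nat) v, bsupp v -> (forall x, E i v x = 0) ->
    norm2 (T (i + M) v) ^+ 2 <= Cd * rho ^+ M * norm2 v ^+ 2) ->
  exists W : V -> R, [/\ bsupp W, forall x, 0 <= W x,
    forall i x, (i <= L)%N -> (mass mu + 2) * tau < T (i + M) f x -> 1 <= W x &
    integ W <= (jac G (Dq / kap q) + mass mu) * M%:R / tau * integ f +
      Cd / (1 - Num.sqrt rho) ^+ 2 * rho ^+ M / tau ^+ 2 * integ (fun x => f x ^+ 2)].
Proof.
move=> Cd0 rho01 hT.
have bT i g : bsupp g -> bsupp (T i g) := bsupp_Tr G mub (sc i) (f := g).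
have TD i g h : bsupp g -> bsupp h -> T i (fun x => g x + h x) = (fun x => T i g x + T i h x).
  by move=> bg bh; exact: (OpD G mu (adm_dl G b (sc i)) bg bh).
have TZ i g k : bsupp g -> T i (fun x => k * g x) = (fun x => k * T i g x).
  by move=> bg; exact: (OpZ G mu k (adm_dl G b (sc i)) bg).
pose D i x := f x - E i f x; have bD i : bsupp (D i) by exact: (bsuppB bf (bE i bf)).
pose W1 x := \sum_(i < L.+1) tau^-1 * T (i + M) (critical M i) x.
pose W2 x := \sum_(i < L.+1) tau ^- 2 * T (i + M) (D i) x ^+ 2.
have bW1 : bsupp W1 by apply: bsupp_sum => i; apply: bsuppZ; exact: bT.
have bW2 : bsupp W2 by apply: bsupp_sum => i; apply: bsuppZ; apply: bsupp_sqr; exact: bT.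
have bB : bsupp bad by apply: bsupp_sum => s; apply: bsuppZ; exact: bsupp_nearby.
have bad0 x : 0 <= bad x by apply: sumr_ge0 => s _; exact: bad_term_ge0.
have ti : 0 <= tau^-1 by rewrite invr_ge0 ltW.
have W1t0 i x : 0 <= tau^-1 * T (i + M) (critical M i) x.
  rewrite mulr_ge0//; apply: Op_ge0 => y.
  by apply: critical_ge0 => j z; exact: E_ge0.
have W2t0 (i : nat) x : 0 <= tau ^- 2 * T (i + M) (D i) x ^+ 2.
  by rewrite mulr_ge0 ?sqr_ge0// invr_ge0 sqr_ge0.
have W10 x : 0 <= W1 x by apply: sumr_ge0.
have W20 x : 0 <= W2 x by apply: sumr_ge0.
exists (fun x => bad x + W1 x + W2 x); split.
- exact: (bsuppD (bsuppD bB bW1) bW2).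
- by move=> x; rewrite !addr_ge0.
- move=> i x iL hx; have [b1|b1] := leP 1 (bad x).
    by rewrite (le_trans b1)// -addrA lerDl addr_ge0.
  have iL1 : (i < L.+1)%N by [].
  have TE : T (i + M) f x = T (i + M) (E i f) x + T (i + M) (D i) x.
    rewrite -[RHS]/((fun x => T (i + M) (E i f) x + T (i + M) (D i) x) x) -TD//; last exact: bE.
    by congr (Tr _ _ _ _ _); apply/funext => y; rewrite /D addrC subrK.
  have h1 := T_average_le iL b1.
  have [h2|h2] := leP (T (i + M) (critical M i) x) tau; last first.
    rewrite (@le_trans _ _ (W1 x))//; last by rewrite -addrA addrCA lerDl addr_ge0.
    rewrite /W1 (bigD1 (Ordinal iL1))//= -[leLHS]addr0 lerD//; last exact: sumr_ge0.
    by rewrite ler_pdivlMl// mulr1 ltW.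
  have h3 : tau <= T (i + M) (D i) x.
    move: hx h1 h2; rewrite TE.
    move: (T (i + M) (E i f) x) (T (i + M) (D i) x) (T (i + M) (critical M i) x) (mass mu) (tau).
    by move=> X Y Z m t; lra.
  rewrite (@le_trans _ _ (W2 x))//; last by rewrite lerDr addr_ge0.
  rewrite /W2 (bigD1 (Ordinal iL1))//= -[leLHS]addr0 lerD//; last exact: sumr_ge0.
  rewrite ler_pdivlMl ?exprn_gt0// mulr1; apply: lerXn2r => //; rewrite nnegrE ?(ltW tau0)//.
  exact: le_trans (ltW tau0) h3.
rewrite (integD (bsuppD bB bW1) bW2) (integD bB bW1) lerD//; last first.
  rewrite /W2 integ_sum; last by move=> i; apply: bsuppZ; apply: bsupp_sqr; exact: bT.
  have := L2_tail nested bE E_cell E_inv E_tower E_adj E_B bT TD TZ L M Cd0 rho01 bf hT.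
  rewrite sqr_norm2 => h.
  have -> : \sum_(i < L.+1) integ (fun x => tau ^- 2 * T (i + M) (D i) x ^+ 2) =
      tau ^- 2 * \sum_(i < L.+1) norm2 (T (i + M) (D i)) ^+ 2.
    rewrite big_distrr; apply: eq_bigr => i _ /=.
    by rewrite integZ ?sqr_norm2//; apply: bsupp_sqr; exact: bT.
  rewrite mulrAC [leRHS]mulrC ler_wpM2l//.
  by rewrite invr_ge0 sqr_ge0.
rewrite !mulrDl lerD//.
  apply: (le_trans integ_bad).
  rewrite ler_wpM2r ?integ_ge0//; rewrite ler_wpM2r// ler_peMr ?jac_ge0//.
  by rewrite ler1n.
rewrite /W1 integ_sum; last by move=> i; apply: bsuppZ; exact: bT.
apply: (@le_trans _ _ (\sum_(i < L.+1) tau^-1 * mass mu * integ (critical M i))).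
  apply: ler_sum => i _; rewrite integZ; last exact: bT.
  rewrite -mulrA ler_wpM2l//.
  apply: (integ_Op_le G mub (adm_dl G b _) (bc i)) => x.
  by apply: critical_ge0 => j z; exact: E_ge0.
rewrite -big_distrr /= [_^-1 * _]mulrC.
have := sum_integ_critical nested bE E_cell E_inv E_adj L bf f0 tau0 (fun i x => E_ge0 i x f0) M.
move=> /(ler_wpM2l (mulr_ge0 (mass_ge0 mu) ti)) /le_trans; apply.
rewrite le_eqVlt; apply/orP; left; apply/eqP; ring.
Qed.

End Fixed.
End WeakType.

Lemma powR_subr1 (R : realType) (x p : R) : 0 < x -> x `^ p = x `^ (p - 1) * x.
Proof.
move=> x0; rewrite -{3}(powRr1 (ltW x0)) -powRD ?subrK//.
by apply/implyP => _; rewrite gt_eqF.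
Qed.

(** Multiplied by 1 - s, the sum becomes geometric up to the boundary term m s^m, which has the good
    sign. *)
Lemma sum_sgeo_le (R : realType) (s : R) (m : nat) : 0 <= s < 1 ->
  \sum_(l < m) l.+1%:R * s ^+ l <= (1 - s) ^- 2.
Proof.
move=> s01; have /andP[s0 s1] := s01; have d0 : 0 < 1 - s by rewrite subr_gt0.
have e : (1 - s) * (\sum_(l < m) l.+1%:R * s ^+ l) + m%:R * s ^+ m = \sum_(l < m) s ^+ l.
  elim: m => [|m IH]; first by rewrite !big_ord0; ring.
  by rewrite !big_ord_recr /= -IH exprS -[m.+1%:R]natr1; ring.
have h := sum_geo_le m s01.
rewrite -(ler_pM2l d0) expr2 invfM mulrA mulfV ?gt_eqF// mul1r.
by apply: le_trans h; rewrite -e lerDl mulr_ge0// exprn_ge0.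
Qed.

(** * From the weak type to L^p by slicing according to height *)

Section StrongType.
Context {R : realType} {n : nat}.
Notation V := 'rV[R]_n.
Implicit Types (x y z : V) (r : R) (f g v w : V -> R).
Variables (m C rho p : R).
Hypotheses (m_ge0 : 0 <= m) (C_ge0 : 0 <= C) (rho01 : 0 < rho < 1) (p_gt1 : 1 < p).

(** One quarter of the exponent in the gain 2^-(p-1) per doubling of the height. Of damp^(4 l), half
    pays for lowering the threshold of slice l, and damp^(2 l) remains for the summation over l. *)
Definition damp : R := 2 `^ (- ((p - 1) / 4)).

Lemma damp_gt0 : 0 < damp.
Proof. by rewrite powR_gt0. Qed.

Lemma damp_lt1 : damp < 1.
Proof.
have e0 : 0 < (p - 1) / 4 by rewrite divr_gt0// subr_gt0.
rewrite /damp powRN invf_lt1 ?powR_gt0// -[X in X < _](powR1l ((p - 1) / 4)).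
by rewrite gt0_ltr_powR// ?nnegrE// ltr1n.
Qed.

Lemma damp4 (l : nat) : (2 ^- l) `^ (p - 1) = damp ^+ (4 * l) :> R.
Proof.
rewrite -[in LHS]powR_mulrn// -powRN -powRrM /damp -powR_mulrn ?powR_ge0// -powRrM.
congr (_ `^ _); by rewrite natrM; field.
Qed.

(** m accounts for the part of f truncated at the threshold; the rest is the sum of the shares (m +
    2) damp^l allotted to the slices above it. *)
Definition wconst : R := m + (m + 2) / (1 - damp).

Lemma wconst_gt0 : 0 < wconst.
Proof.
have := damp_lt1 => t1; rewrite ltr_wpDl// divr_gt0 ?subr_gt0//; move: m_ge0; lra.
Qed.

Lemma m_le_wconst : m <= wconst.
Proof.
have := damp_lt1 => t1; rewrite lerDl divr_ge0 ?subr_ge0 ?(ltW t1)//; move: m_ge0; lra.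
Qed.

Lemma half_power : exists M0 : nat, (0 < M0)%N /\ rho ^+ M0 <= 2^-1.
Proof.
have /andP[r0 r1] := rho01.
have [|i hi] := small_expr (ltW r0) r1 (e := 2^-1); first by rewrite invr_gt0.
exists i.+1; split => //; rewrite exprS (le_trans _ (ltW hi))//.
by rewrite ler_piMl ?exprn_ge0 ?(ltW r0) ?(ltW r1).
Qed.

Section Operators.
Variables (T : nat -> (V -> R) -> V -> R) (L : nat).
Hypotheses (bT : forall i f, bsupp f -> bsupp (T i f))
  (TD : forall i f g, bsupp f -> bsupp g ->
    T i (fun x => f x + g x) = (fun x => T i f x + T i g x))
  (TZ : forall i f (k : R), bsupp f -> T i (fun x => k * f x) = (fun x => k * T i f x))
  (T_le : forall i f g x, bsupp f -> bsupp g -> (forall y, f y <= g y) -> T i f x <= T i g x)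
  (T_ge0 : forall i f x, (forall y, 0 <= f y) -> 0 <= T i f x)
  (T_ub : forall i f x (k : R), bsupp f -> (forall y, 0 <= f y <= k) -> T i f x <= m * k)
  (T_weak : forall f tau (M : nat), bsupp f -> (forall x, 0 <= f x) -> 0 < tau -> (0 < M)%N ->
    exists W : V -> R, [/\ bsupp W, forall x, 0 <= W x,
      forall i x, (i <= L)%N -> (m + 2) * tau < T i f x -> 1 <= W x &
      integ W <= C * (M%:R / tau * integ f +
        rho ^+ M / tau ^+ 2 * integ (fun x => f x ^+ 2))]).

Definition maxT f x : R := \big[Num.max/0]_(i < L.+1) T i f x.

Lemma maxT_ge0 f x : 0 <= maxT f x.
Proof. by rewrite /maxT; elim/big_rec: _ => // i y _ y0; rewrite le_max y0 orbT. Qed.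

Lemma maxT_ub f x i : (i <= L)%N -> T i f x <= maxT f x.
Proof.
move=> iL; have iL1 : (i < L.+1)%N by [].
rewrite /maxT; have := @le_bigmax _ _ _ 0 (fun i : 'I_L.+1 => T i f x) (Ordinal iL1).
exact.
Qed.

Lemma maxT_cases f x : maxT f x = 0 \/ exists2 i, (i <= L)%N & maxT f x = T i f x.
Proof.
rewrite /maxT; elim/big_ind: _ => [|u w hu hw|i _]; first by left.
- by rewrite maxEle; case: ifP.
- by right; exists i => //; rewrite -ltnS.
Qed.

Lemma maxT_attained f x (k : R) : 0 <= k -> k < maxT f x -> exists2 i, (i <= L)%N & k < T i f x.
Proof.
move=> k0; have [->|[i iL ->]] := maxT_cases f x; last by exists i.
by rewrite ltNge k0.
Qed.

Lemma bsupp_maxT f : bsupp f -> bsupp (maxT f).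
Proof.
move=> bf; apply: (bsupp_le (g := fun x => \sum_(i < L.+1) `|T i f x|)).
- rewrite /maxT; elim: (index_enum _) => [|i s IH].
    by under eq_fun do rewrite big_nil; exact: measurable_cst.
  under eq_fun do rewrite big_cons.
  by apply: measurable_maxr => //; exact: bsupp_measurable (bT _ bf).
- move=> x; rewrite !ger0_norm ?maxT_ge0//; last by apply: sumr_ge0.
  apply/bigmax_leP; split => [|i _]; first exact: sumr_ge0.
  by rewrite (bigD1 i)//= (le_trans (ler_norm _))// lerDl sumr_ge0.
- by apply: bsupp_sum => i; apply: bsupp_abs; exact: bT.
Qed.

Section Pieces.
Variables (f : V -> R) (b0 : R) (J : nat).
Hypotheses (bf : bsupp f) (f0 : forall x, 0 <= f x) (b00 : 0 < b0)
  (fJ : forall x, f x <= b0 * 2 ^+ J).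

Definition bt (j : nat) : R := b0 * 2 ^+ j.

Lemma bt_gt0 j : 0 < bt j.
Proof. by rewrite mulr_gt0// exprn_gt0. Qed.

Lemma bt_le i j : (i <= j)%N -> bt i <= bt j.
Proof. by move=> ij; rewrite ler_pM2l// ler_weXn2l// ler1n. Qed.

Definition inslice (j : nat) x : bool := (bt j < f x) && (f x <= bt j.+1).
Definition slice (j : nat) x : R := (inslice j x)%:R.

Lemma slice01 j x : 0 <= slice j x <= 1.
Proof. by rewrite /slice; case: inslice; rewrite ?lexx ?ler01. Qed.

Lemma measurable_slice j : measurable_fun setT (slice j).
Proof.
have mf := bsupp_measurable bf.
have ms : measurable_fun setT (inslice j : V -> bool).
  apply: measurable_and; first exact: measurable_fun_ltr.
  exact: measurable_fun_ler.
rewrite (_ : slice j = \1_(inslice j @^-1` [set true])).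
  by apply: measurable_indic; exact: measurable_preimage.
apply/funext => x; rewrite indicE /slice.
by case h : (inslice j x); [rewrite mem_set|rewrite memNset//= h].
Qed.

Lemma inslice_uniq i j x : inslice i x -> inslice j x -> i = j.
Proof.
wlog ij : i j / (i <= j)%N.
  by move=> h; case: (leqP i j) => [|/ltnW] ij hi hj; [exact: h|symmetry; exact: h].
move=> /andP[_ hi] /andP[hj _]; apply/eqP; rewrite eqn_leq ij leqNgt; apply/negP => lt.
by have := lt_le_trans hj (le_trans hi (bt_le lt)); rewrite ltxx.
Qed.

Lemma inslice_ex i x : bt i < f x -> exists2 j, (i <= j < i + J)%N & inslice j x.
Proof.
move=> ix; have ex : exists j, f x <= bt j by exists J; exact: fJ.
case: (ex_minnP ex) => -[|j] hj jmin.
  exfalso; have := lt_le_trans ix (le_trans hj (bt_le (leq0n i))).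
  by rewrite ltxx.
have jf : bt j < f x by rewrite ltNge; apply/negP => /jmin; rewrite ltnn.
exists j; last by rewrite /inslice jf.
apply/andP; split.
  rewrite leqNgt; apply/negP => ji.
  by have := lt_le_trans ix (le_trans hj (bt_le ji)); rewrite ltxx.
by apply: ltn_addl; apply: jmin; exact: fJ.
Qed.

Lemma sum_slice_le1 l x : \sum_(k < J) slice (k + l) x <= 1.
Proof.
case: (pselect (exists k : 'I_J, inslice (k + l) x)) => [[k hk]|no].
  rewrite (bigD1 k)//= big1 ?addr0; first by case/andP: (slice01 (k + l) x).
  move=> i ik; rewrite /slice; case h : (inslice (i + l) x) => //.
  case/eqP : ik; apply: val_inj; have := inslice_uniq hk h.
  by move=> /eqP; rewrite eqn_add2r => /eqP.
rewrite big1// => i _; rewrite /slice; case h : (inslice (i + l) x) => //.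
by exfalso; apply: no; exists i.
Qed.

Definition piece j x : R := slice j x * f x.

Lemma piece_ge0 j x : 0 <= piece j x.
Proof. by rewrite mulr_ge0//; case/andP: (slice01 j x). Qed.

Lemma bsupp_piece j : bsupp (piece j).
Proof.
apply: (bsuppM (M := 1)) => //; first exact: measurable_slice.
by move=> x; have /andP[s0 s1] := slice01 j x; rewrite ger0_norm.
Qed.

Lemma piece_sqr_le j x : piece j x ^+ 2 <= bt j.+1 * piece j x.
Proof.
rewrite expr2 ler_wpM2r ?piece_ge0// /piece /slice; case h : (inslice j x).
  by rewrite mul1r; case/andP: h.
by rewrite mul0r ltW// bt_gt0.
Qed.

Lemma le_sum_piece (k : nat) x : f x <= Num.min (f x) (bt k) + \sum_(l < J) piece (k + l) x.
Proof.
have [fk|fk] := leP (f x) (bt k).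
  by rewrite lerDl sumr_ge0// => l _; exact: piece_ge0.
apply: ler_wpDl; first exact: ltW (bt_gt0 k).
have [j /andP[kj jk] hj] := inslice_ex fk.
have jJ : (j - k < J)%N by rewrite ltn_subLR.
rewrite (bigD1 (Ordinal jJ))//= /piece subnKC// /slice hj mul1r lerDl sumr_ge0// => l _.
exact: piece_ge0.
Qed.

(** The slice l steps above bt k gets the share damp^l bt k of the threshold and the gap M = M0 (l +
    1). Its height bounds the square integral by 2^(l + 1) bt k times the integral, and rho^M <=
    2^-(l + 1) cancels that factor. What remains are the losses l + 1 and damp^(-2 l). *)
Lemma slice_weak (M0 k : nat) : (0 < M0)%N -> rho ^+ M0 <= 2^-1 ->
  exists W : V -> R, [/\ bsupp W, forall x, 0 <= W x,
    forall x, wconst * bt k < maxT f x -> 1 <= W x &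
    integ W <= \sum_(l < J) C * (M0%:R + 1) * l.+1%:R * damp ^- (2 * l) / bt k * integ (piece (k + l))].
Proof.
move=> M00 rM0; have t0 := damp_gt0; have t1 := damp_lt1; have bk := bt_gt0 k.
have /andP[rho0 rho1] := rho01.
have tau0 l : 0 < damp ^+ l * bt k by rewrite mulr_gt0// exprn_gt0.
have /choice[W hW] : forall l : nat, exists W : V -> R, [/\ bsupp W, forall x, 0 <= W x,
      forall i x, (i <= L)%N -> (m + 2) * (damp ^+ l * bt k) < T i (piece (k + l)) x -> 1 <= W x &
      integ W <= C * ((M0 * l.+1)%:R / (damp ^+ l * bt k) * integ (piece (k + l)) +
        rho ^+ (M0 * l.+1) / (damp ^+ l * bt k) ^+ 2 * integ (fun x => piece (k + l) x ^+ 2))].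
  move=> l; apply: T_weak => //.
  - exact: bsupp_piece.
  - exact: piece_ge0.
  - by rewrite muln_gt0 M00.
exists (fun x => \sum_(l < J) W l x); split.
- by apply: bsupp_sum => l; case: (hW l).
- by move=> x; apply: sumr_ge0 => l _; case: (hW l).
- move=> x hx; have [|i iL hi] := maxT_attained _ hx.
    by rewrite mulr_ge0 ?(ltW bk) ?(ltW wconst_gt0).
  case: (pselect (exists l : 'I_J, (m + 2) * (damp ^+ l * bt k) < T i (piece (k + l)) x)).
    move=> [l hl]; rewrite (bigD1 l)//=; have [_ _ h _] := hW l.
    rewrite -[leLHS]addr0 lerD//; first exact: h iL hl.
    by apply: sumr_ge0 => j _; case: (hW j).
  move=> no; exfalso; move: hi; apply/negP; rewrite -leNgt.
  pose g x := Num.min (f x) (bt k).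
  have g0 y : 0 <= g y by rewrite le_min f0 ltW.
  have bg : bsupp g.
    apply: (bsupp_le (g := f)) => //.
      by apply: measurable_minr => //; exact: bsupp_measurable bf.
    by move=> y; rewrite !ger0_norm// ge_min lexx.
  have bS : bsupp (fun x => \sum_(l < J) piece (k + l) x).
    by apply: bsupp_sum => l; exact: bsupp_piece.
  apply: (@le_trans _ _ (T i (fun x => g x + \sum_(l < J) piece (k + l) x) x)).
    by apply: T_le => //; [exact: bsuppD|move=> y; exact: le_sum_piece].
  rewrite TD// (T_sum TD TZ i J x (F := fun l => piece (k + l))); last first.
    by move=> l; exact: bsupp_piece.
  rewrite /wconst mulrDl lerD//.
    by apply: T_ub => // y; rewrite g0 ge_min lexx orbT.
  apply: (@le_trans _ _ (\sum_(l < J) (m + 2) * (damp ^+ l * bt k))).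
    by apply: ler_sum => l _; rewrite leNgt; apply/negP => hl; apply: no; exists l.
  rewrite -big_distrr /= -big_distrl /= mulrA ler_wpM2r ?(ltW bk)//.
  rewrite ler_wpM2l//; first by rewrite addr_ge0.
  by apply: sum_geo_le; rewrite (ltW t0).
rewrite integ_sum; last by move=> l; case: (hW l).
apply: ler_sum => l _; have [_ _ _ h] := hW l; apply: (le_trans h).
have bp := bsupp_piece (k + l).
have I0 : 0 <= integ (piece (k + l)) by apply: integ_ge0 => x; exact: piece_ge0.
have h2 : integ (fun x => piece (k + l) x ^+ 2) <= bt (k + l).+1 * integ (piece (k + l)).
  rewrite -integZ//; apply: integ_le => [||x]; [exact: bsupp_sqr|exact: bsuppZ|exact: piece_sqr_le].
have tl : 0 < damp ^+ l by rewrite exprn_gt0.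
have h3 : rho ^+ (M0 * l.+1) / (damp ^+ l * bt k) ^+ 2 * integ (fun x => piece (k + l) x ^+ 2) <=
    damp ^- (2 * l) / bt k * integ (piece (k + l)).
  apply: (le_trans (ler_wpM2l _ h2)).
    by rewrite divr_ge0 ?exprn_ge0 ?(ltW rho0) ?(ltW (tau0 l)).
  rewrite mulrA ler_wpM2r//.
  have r2 : rho ^+ (M0 * l.+1) <= 2 ^- l.+1.
    by rewrite exprM -exprVn; apply: lerXn2r; rewrite ?nnegrE ?invr_ge0 ?exprn_ge0 ?(ltW rho0).
  have -> : bt (k + l).+1 = 2 ^+ l.+1 * bt k by rewrite /bt -addnS exprD; ring.
  apply: (@le_trans _ _ (2 ^- l.+1 / (damp ^+ l * bt k) ^+ 2 * (2 ^+ l.+1 * bt k))).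
    by rewrite ler_wpM2r ?(mulr_ge0 _ (ltW bk)) ?exprn_ge0// ler_wpM2r// invr_ge0 sqr_ge0.
  rewrite le_eqVlt; apply/orP; left; apply/eqP; rewrite mulnC exprM.
  by field; rewrite !gt_eqF// exprn_gt0.
have h1 : (M0 * l.+1)%:R / (damp ^+ l * bt k) * integ (piece (k + l)) <=
    M0%:R * l.+1%:R * damp ^- (2 * l) / bt k * integ (piece (k + l)).
  rewrite ler_wpM2r// natrM invfM mulrA ler_wpM2r ?invr_ge0 ?(ltW bk)//.
  rewrite ler_wpM2l// mulnC exprM lef_pV2 ?posrE ?exprn_gt0//.
  by rewrite expr2 ler_piMl ?(ltW tl)// exprn_ile1 ?(ltW t0) ?(ltW t1).
have -> : C * (M0%:R + 1) * l.+1%:R / damp ^+ (2 * l) / bt k * integ (piece (k + l)) =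
  C * ((M0%:R + 1) * l.+1%:R / damp ^+ (2 * l) / bt k * integ (piece (k + l))) by ring.
rewrite ler_wpM2l//; apply: (le_trans (lerD h1 h3)).
rewrite [leRHS](_ : _ = M0%:R * l.+1%:R * damp ^- (2 * l) / bt k * integ (piece (k + l)) +
   l.+1%:R * (damp ^- (2 * l) / bt k * integ (piece (k + l)))); last by ring.
rewrite lerD2l ler_peMl ?ler1n//.
by rewrite mulr_ge0// divr_ge0 ?(ltW bk)// invr_ge0 exprn_ge0// ltW.
Qed.

(** On this slice f > 2^l bt k, so f^(p - 1) exceeds the same power of bt k by at least 2^(l (p -
    1)) = damp^(-4 l). *)
Lemma powR_piece (k l : nat) x :
  bt k `^ (p - 1) * piece (k + l) x <= damp ^+ (4 * l) * (slice (k + l) x * f x `^ p).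
Proof.
have p1 : 0 <= p - 1 by rewrite subr_ge0 ltW.
rewrite /piece /slice; case h : (inslice (k + l) x); last by rewrite !mul0r !mulr0.
have /andP[bf1 _] := h; rewrite !mul1r.
have fx : 0 < f x by rewrite (lt_trans (bt_gt0 (k + l))).
rewrite [f x `^ p]powR_subr1// mulrA ler_wpM2r// -damp4.
rewrite -powRM ?f0 ?invr_ge0//.
apply: ge0_ler_powR => //; rewrite ?nnegrE ?(ltW (bt_gt0 k)) ?mulr_ge0 ?invr_ge0//.
rewrite ler_pdivlMl ?exprn_gt0//; move: (ltW bf1); rewrite /bt exprD.
by apply: le_trans; rewrite le_eqVlt; apply/orP; left; apply/eqP; ring.
Qed.

Lemma bsupp_powR g r : 0 < r -> bsupp g -> (forall x, 0 <= g x) -> bsupp (fun x => g x `^ r).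
Proof.
move=> r0 bg g0; have [M M0 [rho' [gM gr]]] := bsupp_bound bg.
apply: (@bsupp_intro _ _ _ (M `^ r) rho').
- exact: (measurableT_comp (measurable_powR r) (bsupp_measurable bg)).
- move=> x; rewrite ger0_norm ?powR_ge0//; apply: ge0_ler_powR => //; rewrite ?nnegrE ?(ltW r0)//.
  by rewrite (le_trans (ler_norm _)).
- move=> x h; apply: gr; apply: contraNneq h => ->.
  by rewrite powR0// gt_eqF.
Qed.

(** The p-th power of the maximal function is summed over its dyadic heights wconst bt k. Heights
    below wconst b0 are left unresolved; on the bounded support they contribute the last term, which
    vanishes as b0 tends to 0. *)
Lemma strong_type_eps (M0 : nat) (rad : R) : (0 < M0)%N -> rho ^+ M0 <= 2^-1 ->
  (forall x, maxT f x != 0 -> `|x| <= rad) ->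
  integ (fun x => maxT f x `^ p) <=
  (2 * wconst) `^ p * (C * (M0%:R + 1)) * (1 - damp ^+ 2) ^- 2 * integ (fun x => f x `^ p) +
  (wconst * b0) `^ p * integ (\1_(norm_ball rad) : V -> R).
Proof.
move=> M00 rM0 hrad; have t0 := damp_gt0; have t1 := damp_lt1; have c0 := wconst_gt0.
have p0 : 0 < p by exact: lt_trans p_gt1.
have /choice[W hW] : forall k : nat, exists W : V -> R, [/\ bsupp W, forall x, 0 <= W x,
    forall x, wconst * bt k < maxT f x -> 1 <= W x &
    integ W <= \sum_(l < J) C * (M0%:R + 1) * l.+1%:R * damp ^- (2 * l) / bt k * integ (piece (k + l))].
  by move=> k; exact: slice_weak.
have bW k : bsupp (W k) by case: (hW k).
have W0 k x : 0 <= W k x by case: (hW k).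
have bS : bsupp (fun x => \sum_(k < J) (2 * wconst * bt k) `^ p * W k x).
  by apply: bsupp_sum => k; exact: bsuppZ.
have bI := bsuppZ ((wconst * b0) `^ p) (bsupp_norm_ball rad).
apply: (@le_trans _ _ (integ (fun x => \sum_(k < J) (2 * wconst * bt k) `^ p * W k x +
   (wconst * b0) `^ p * \1_(norm_ball rad) x))).
  apply: integ_le => [||x].
  - by apply: bsupp_powR => //; [exact: bsupp_maxT|move=> x; exact: maxT_ge0].
  - exact: bsuppD.
  have S0 : 0 <= \sum_(k < J) (2 * wconst * bt k) `^ p * W k x.
    by apply: sumr_ge0 => k _; rewrite mulr_ge0 ?powR_ge0.
  have i01 : 0 <= (\1_(norm_ball rad) x : R) by rewrite indicE.
  have [h0|h0] := eqVneq (maxT f x) 0.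
    by rewrite h0 powR0 ?gt_eqF// addr_ge0// mulr_ge0 ?powR_ge0.
  have [hc|hc] := leP (maxT f x) (wconst * b0).
    apply: ler_wpDl => //; rewrite indicE mem_set; last exact: hrad.
    rewrite mulr1; apply: ge0_ler_powR; rewrite ?nnegrE ?maxT_ge0 ?(ltW p0)//.
    by rewrite mulr_ge0 ?(ltW c0) ?(ltW b00).
  apply: ler_wpDr; first by rewrite mulr_ge0// powR_ge0.
  have ex : exists j, maxT f x <= wconst * bt j.
    exists J; apply/bigmax_leP; split => [|i _].
      by rewrite mulr_ge0 ?(ltW c0) ?(ltW (bt_gt0 J)).
    apply: (@le_trans _ _ (m * bt J)).
      by apply: T_ub => // y; rewrite f0 fJ.
    by rewrite ler_wpM2r ?(ltW (bt_gt0 J))// m_le_wconst.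
  case: (ex_minnP ex) => -[|j] hj jmin.
    by move: hc; rewrite ltNge; move: hj; rewrite /bt expr0 mulr1 => ->.
  have jJ : (j < J)%N.
    apply: jmin; apply/bigmax_leP; split => [|i _].
      by rewrite mulr_ge0 ?(ltW c0) ?(ltW (bt_gt0 J)).
    apply: (@le_trans _ _ (m * bt J)).
      by apply: T_ub => // y; rewrite f0 fJ.
    by rewrite ler_wpM2r ?(ltW (bt_gt0 J))// m_le_wconst.
  have cj : wconst * bt j < maxT f x by rewrite ltNge; apply/negP => /jmin; rewrite ltnn.
  rewrite (bigD1 (Ordinal jJ))//= -[leLHS]addr0 lerD//; last first.
    by apply: sumr_ge0 => k _; rewrite mulr_ge0 ?powR_ge0.
  have [_ _ hW1 _] := hW j; have W1 := hW1 x cj.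
  apply: (@le_trans _ _ ((2 * wconst * bt j) `^ p)); last by rewrite ler_peMr ?powR_ge0.
  apply: ge0_ler_powR; rewrite ?nnegrE ?maxT_ge0 ?(ltW p0)//.
    by rewrite mulr_ge0 ?(ltW (bt_gt0 j))// mulr_ge0// ltW.
  by apply: (le_trans hj); rewrite /bt exprS le_eqVlt; apply/orP; left; apply/eqP; ring.
rewrite integD// integZ; last exact: bsupp_norm_ball.
rewrite lerD2r integ_sum; last by move=> k; exact: bsuppZ.
have bp := bsupp_powR p0 bf f0.
have bsl j : bsupp (fun x => slice j x * f x `^ p).
  apply: (bsuppM (M := 1)) => //; first exact: measurable_slice.
  by move=> x; have /andP[s0 s1] := slice01 j x; rewrite ger0_norm.
pose I j := integ (fun x => slice j x * f x `^ p).
pose D := (2 * wconst) `^ p * (C * (M0%:R + 1)).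
have D0 : 0 <= D by rewrite mulr_ge0 ?powR_ge0// mulr_ge0// addr_ge0.
apply: (@le_trans _ _ (\sum_(k < J) \sum_(l < J) D * (l.+1%:R * (damp ^+ 2) ^+ l) * I (k + l)%N)).
  apply: ler_sum => k _; rewrite integZ//.
  have [_ _ _ hk] := hW k; have bk := bt_gt0 k.
  apply: (le_trans (ler_wpM2l (powR_ge0 _ _) hk)); rewrite big_distrr; apply: ler_sum => l _ /=.
  have hI : bt k `^ (p - 1) * integ (piece (k + l)) <= damp ^+ (4 * l) * I (k + l)%N.
    rewrite -!integZ//; [|exact: bsupp_piece..].
    apply: integ_le => [||x]; [apply: bsuppZ; exact: bsupp_piece|exact: bsuppZ|exact: powR_piece].
  rewrite powRM ?(ltW bk)//; last by rewrite mulr_ge0// ltW.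
  rewrite [bt k `^ p]powR_subr1//.
  have tl : damp ^- (2 * l) * damp ^+ (4 * l) = (damp ^+ 2) ^+ l.
    have e4 : (4 * l = 2 * l + 2 * l)%N by rewrite -mulnDl.
    by rewrite -exprM e4 exprD mulKf// expf_neq0// gt_eqF.
  have := ler_wpM2l _ hI => /(_ (D * l.+1%:R * damp ^- (2 * l))) H.
  apply: le_trans (le_trans (H _) _).
  - rewrite le_eqVlt; apply/orP; left; apply/eqP; rewrite /D; field; rewrite ?expf_neq0 ?gt_eqF ?andbT//.
  - by rewrite mulr_ge0 ?invr_ge0 ?exprn_ge0 ?(ltW t0)// mulr_ge0.
  - rewrite -tl le_eqVlt; apply/orP; left; apply/eqP; ring.
(* For fixed l the slices k + l are disjoint as k varies, so the sum over k is bounded by the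
   integral of f^p and only a series in l is left. *)
rewrite exchange_big /=.
apply: (@le_trans _ _ (\sum_(l < J) D * (l.+1%:R * (damp ^+ 2) ^+ l) * integ (fun x => f x `^ p))).
  apply: ler_sum => l _; rewrite -big_distrr /= ler_wpM2l//.
    by rewrite mulr_ge0// mulr_ge0// exprn_ge0// exprn_ge0// ltW.
  rewrite /I -(integ_sum _ _ (F := fun (k : 'I_J) x => slice (k + l) x * f x `^ p)); last by move=> k.
  apply: integ_le => [||x] //; first by apply: bsupp_sum => k.
  by rewrite -big_distrl /= ler_piMl ?powR_ge0// sum_slice_le1.
rewrite -big_distrl -big_distrr /= ler_wpM2r//; first by apply: integ_ge0 => x; exact: powR_ge0.
rewrite ler_wpM2l//; apply: sum_sgeo_le.
by rewrite exprn_ge0 ?(ltW t0)//= expr_lt1// ltW.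
Qed.

End Pieces.

Lemma strong_type (M0 : nat) f : (0 < M0)%N -> rho ^+ M0 <= 2^-1 ->
  bsupp f -> (forall x, 0 <= f x) ->
  integ (fun x => maxT f x `^ p) <=
  (2 * wconst) `^ p * (C * (M0%:R + 1)) * (1 - damp ^+ 2) ^- 2 * integ (fun x => f x `^ p).
Proof.
move=> M00 rM0 bf f0; have c0 := wconst_gt0; have p0 : 0 < p by exact: lt_trans p_gt1.
have [_ _ [rad [_ hrad]]] := bsupp_bound (bsupp_maxT bf).
have [M M1 [_ [fM _]]] := bsupp_bound bf.
apply/ler_addgt0Pr => e e0.
pose Vr := integ (\1_(norm_ball rad) : V -> R).
have V0 : 0 <= Vr by apply: integ_ge0 => x; rewrite indicE.
have Vp : 0 < Vr + 1 by rewrite ltr_wpDl.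
(* Chosen so that (wconst b0)^p Vr = e Vr / (Vr + 1), which is at most e. *)
pose b0 := (e / (Vr + 1)) `^ p^-1 / wconst.
have b00 : 0 < b0 by rewrite divr_gt0// powR_gt0// divr_gt0.
have [J hJ] : exists J : nat, M <= b0 * 2 ^+ J.
  have h0 : 0 <= 2^-1 :> R by rewrite invr_ge0.
  have h1 : 2^-1 < 1 :> R by rewrite invf_lt1// ltr1n.
  have h2 : 0 < b0 / (M + 1) by rewrite divr_gt0// ltr_wpDl.
  have [J hJ] := small_expr h0 h1 h2; exists J.
  move: hJ; rewrite ltr_pdivlMr ?ltr_wpDl// exprVn ltr_pdivrMl ?exprn_gt0// mulrC => hJ.
  by rewrite (le_trans _ (ltW hJ))// lerDl.
have fJ x : f x <= b0 * 2 ^+ J by rewrite (le_trans (ler_norm _))// (le_trans (fM x)).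
apply: (le_trans (strong_type_eps bf f0 b00 fJ M00 rM0 hrad)); rewrite lerD2l.
rewrite -/Vr (_ : wconst * b0 = (e / (Vr + 1)) `^ p^-1); last by rewrite /b0 mulrC divfK ?gt_eqF.
rewrite -powRrM mulVf ?gt_eqF// powRr1; last first.
  by rewrite divr_ge0 ?(ltW e0)// ltW.
by rewrite mulrAC ler_pdivrMr// ler_pM2l// lerDl.
Qed.

End Operators.
End StrongType.

(** * The unweighted maximal estimate *)

Section Unweighted.
Context {R : realType} {n : nat} (G : homogeneousGroup R n) (q : quasiNorm G).
Hypothesis qN : forall x, q (- x) = q x.
Notation V := 'rV[R]_n.
Notation lam := (@lebesgue R n).
Variables (mu : {finite_measure set V -> \bar R}) (b : R).
Hypothesis mub : mu (~` norm_ball b) = 0.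
Implicit Types (x y z : V) (f g v w : V -> R).

Section Instance.
Variables (ratio theta : R).
Hypotheses (ratio_big : 32 * ctri q ^+ 4 <= ratio) (theta_gt0 : 0 < theta).
Notation c := (cen q theta ratio).

Let mc (i : nat) := measurable_cen q theta ratio i.
Let cb i := cell_bounded qN ratio_big i theta_gt0.
Let v0 i := cell_vol_gt0 ratio_big i theta_gt0.
Let lb i := cellm_ge qN ratio_big i theta_gt0.

Lemma bsupp_kern (i : nat) x : bsupp (kern (c i) x).
Proof.
rewrite (_ : kern _ x = fun y => (cellm (c i) x)^-1 * \1_(cell (c i) x) y).
  by apply: bsuppZ; exact: (bsupp_cell (mc i) (cb i) x).
by apply/funext => y; rewrite /kern mulrC.
Qed.

Lemma Ex_invariant (i : nat) h x : (forall y z, c i y = c i z -> h y = h z) -> Ex (c i) h x = h x.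
Proof.
move=> hc; rewrite -[RHS]mulr1 -(integ_kern (mc i) (cb i) (v0 i) (lb i) x).
rewrite -(integZ _ (bsupp_kern i x)).
apply: eq_integ => y; have [->|k0] := eqVneq (kern (c i) x y) 0; first by rewrite mul0r mulr0.
by rewrite mulrC (hc x y (kern_neq0 k0)).
Qed.

(** Self-adjointness moves the average of level i onto the kernel of level j, which is constant on
    the finer cells and therefore unchanged. *)
Lemma Ex_tower (i j : nat) f x : (i <= j)%N -> bsupp f -> Ex (c j) (Ex (c i) f) x = Ex (c j) f x.
Proof.
move=> ij bf; have bk := bsupp_kern j x.
transitivity (integ (fun y => Ex (c i) (kern (c j) x) y * f y)).
  rewrite (E_adj qN ratio_big i theta_gt0 bk bf).
  by apply: eq_integ => y; rewrite mulrC.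
apply: eq_integ => y; rewrite Ex_invariant// => u w /(cen_nested ij) uw.
rewrite /kern !indicE; congr ((nat_of_bool _)%:R / _).
by apply/idP/idP => /set_mem h; apply/mem_set; rewrite /cell /= in h *; rewrite h.
Qed.

Lemma weak_type_levels (L M : nat) (Cd rho Dq tau : R) f :
  bsupp f -> (forall x, 0 <= f x) -> 0 < tau -> (0 < M)%N -> 0 < Dq ->
  (forall y r, `|y| <= b -> 0 < r -> ctri q * (q (dl G r y) + diam q * r) <= Dq * r) ->
  0 <= Cd -> 0 < rho < 1 ->
  (forall (i M : nat) v, bsupp v -> (forall x, Ex (c i) v x = 0) ->
    norm2 (Tr G mu (scale theta ratio (i + M)) v) ^+ 2 <= Cd * rho ^+ M * norm2 v ^+ 2) ->
  exists W : V -> R, [/\ bsupp W, forall x, 0 <= W x,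
    forall i x, (i <= L)%N -> (mass mu + 2) * tau < Tr G mu (scale theta ratio (i + M)) f x -> 1 <= W x &
    integ W <= (jac G (Dq / kap q) + mass mu) * M%:R / tau * integ f +
      Cd / (1 - Num.sqrt rho) ^+ 2 * rho ^+ M / tau ^+ 2 * integ (fun x => f x ^+ 2)].
Proof.
move=> bf f0 tau0 M0 Dq0 DqP Cd0 rho01 hd.
have nested (i j : nat) x y : (i <= j)%N -> c i x = c i y -> c j x = c j y.
  exact: cen_nested.
have bE (i : nat) g : bsupp g -> bsupp (Ex (c i) g) := @bsupp_E _ _ _ _ qN _ ratio_big theta i theta_gt0 g.
have E_cell (i : nat) g x y : c i x = c i y -> Ex (c i) g x = Ex (c i) g y := @eq_Ex _ _ (c i) g x y.
have adj (i : nat) g h (bg : bsupp g) (bh : bsupp h) := E_adj qN ratio_big i theta_gt0 bg bh.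
have E_B (i : nat) g h (bg : bsupp g) (bh : bsupp h) := E_B qN ratio_big i theta_gt0 bg bh.
have E_ge (i : nat) g x (g0 : forall y, 0 <= g y) := E_ge0 qN ratio_big i theta_gt0 x g0.
have c_ball (i : nat) x y : dist q (c i x) y <= kap q * scale theta ratio i -> c i y = c i x.
  by move=> h; exact: (cen_ball qN theta_gt0 ratio_big h).
have c_diam (i : nat) x y : c i x = c i y -> dist q x y <= diam q * scale theta ratio i.
  by move=> h; exact: (cell_diam qN ratio_big theta_gt0 h).
exact: (weak_type qN mub ratio_big theta_gt0 nested bE E_cell Ex_invariant Ex_tower adj
  E_B E_ge c_ball c_diam L bf f0 tau0 M0 Dq0 DqP Cd0 rho01 hd).
Qed.

End Instance.

(** The cells need a ratio of at least 32 ctri^4, while consecutive scales have ratio 2. With ratio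
    = 2^a the scales are split by i mod a into a sequences, each admissible, and the a estimates are
    added. *)
Lemma lacunary_unweighted (j : nat) (p : R) : regular q (word G mu j.*2) -> 1 < p ->
  exists2 C : R, 0 <= C & forall theta (L : nat) f, 0 < theta -> bsupp f -> (forall x, 0 <= f x) ->
  integ (fun x => maxT (fun i => Tr G mu (theta * 2 ^+ i)) L f x `^ p) <= C * integ (fun x => f x `^ p).
Proof.
move=> reg p1; have p0 : 0 < p by exact: lt_trans p1.
have c0 := ctri_gt0 q.
have [a [a0 ra]] : exists a : nat, (0 < a)%N /\ 32 * ctri q ^+ 4 <= 2 ^+ a.
  have h0 : 0 <= 2^-1 :> R by rewrite invr_ge0.
  have h1 : 2^-1 < 1 :> R by rewrite invf_lt1// ltr1n.
  have h2 : 0 < (32 * ctri q ^+ 4)^-1 by rewrite invr_gt0 mulr_gt0// exprn_gt0.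
  have [a ha] := small_expr h0 h1 h2; exists a.+1; split => //.
  move: ha; rewrite exprVn ltf_pV2 ?posrE ?mulr_gt0 ?exprn_gt0// => /ltW h.
  by apply: (le_trans h); rewrite ler_weXn2l// ler1n.
pose ratio : R := 2 ^+ a.
have [Cd [rho [Cd0 rho01 hd]]] := scaled_decay qN mub ra reg.
have [Qb Qb0 hQ] := qnorm_ub q b.
pose Dq := ctri q * (Qb + diam q).
have Dq0 : 0 < Dq by rewrite mulr_gt0// addr_gt0// diam_gt0.
have DqP y r : `|y| <= b -> 0 < r -> ctri q * (q (dl G r y) + diam q * r) <= Dq * r.
  move=> yb r0; rewrite qnorm_dl// /Dq -mulrA ler_pM2l// mulrDl lerD2r mulrC ler_pM2r//.
  exact: hQ.
pose C := jac G (Dq / kap q) + mass mu + Cd / (1 - Num.sqrt rho) ^+ 2.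
have d0 : 0 <= Cd / (1 - Num.sqrt rho) ^+ 2 by rewrite divr_ge0// sqr_ge0.
have j0 : 0 <= jac G (Dq / kap q) + mass mu by rewrite addr_ge0 ?jac_ge0// mass_ge0.
have C0 : 0 <= C by rewrite addr_ge0.
have /andP[rho0 rho1] := rho01.
have [M0 [M00 rM0]] := half_power rho01.
pose Cp := (2 * wconst (mass mu) p) `^ p * (C * (M0%:R + 1)) * (1 - damp p ^+ 2) ^- 2.
have Cp0 : 0 <= Cp.
  by rewrite mulr_ge0 ?invr_ge0 ?sqr_ge0// mulr_ge0 ?powR_ge0// mulr_ge0// addr_ge0.
have one_class theta (L : nat) f : 0 < theta -> bsupp f -> (forall x, 0 <= f x) ->
    integ (fun x => maxT (fun i => Tr G mu (scale theta ratio i)) L f x `^ p) <=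
    Cp * integ (fun x => f x `^ p).
  move=> th0 bf f0.
  apply: (strong_type (mass_ge0 mu) C0 rho01 p1) => //.
  - by move=> i g bg; exact: bsupp_Tr mub _ _ bg.
  - by move=> i g h bg bh; exact: (OpD G mu (adm_dl G b _) bg bh).
  - by move=> i g k bg; exact: (OpZ G mu k (adm_dl G b _) bg).
  - by move=> i g h x bg bh gh; exact: (Op_le G mu x (adm_dl G b _) bg bh gh).
  - move=> i g x k bg gk; apply: (le_trans (ler_norm _)); rewrite mulrC.
    apply: (Op_bound G mu x (adm_dl G b _) bg) => y.
    by have /andP[g0 gk1] := gk y; rewrite ger0_norm.
  move=> g tau M bg g0 tau0 MM0.
  have r0 : 0 < ratio by rewrite exprn_gt0.
  (* The weak-type bound is about the scales i + M. Starting the cells M levels lower turns these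
     into the scales i of the given sequence; the constants do not depend on the starting scale. *)
  have th'0 : 0 < theta * ratio ^- M by rewrite mulr_gt0// invr_gt0 exprn_gt0.
  have [W [bW W0 hW iW]] := weak_type_levels ra th'0 L bg g0 tau0 MM0 Dq0 DqP Cd0 rho01
    (fun i M' v => hd (theta * ratio ^- M) i M' v th'0).
  exists W; split => // [i x iL hx|].
    apply: (hW i x iL); rewrite (_ : scale _ _ _ = scale theta ratio i)//.
    by rewrite /scale exprD mulrACA [_ ^- M * _]mulrC -mulrA divff ?mulr1// expf_neq0// gt_eqF.
  apply: (le_trans iW); rewrite mulrDr.
  have I1 : 0 <= integ g by exact: integ_ge0.
  have I2 : 0 <= integ (fun x => g x ^+ 2) by apply: integ_ge0 => x; exact: sqr_ge0.
  apply: lerD.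
    rewrite [leRHS](_ : _ = C * M%:R / tau * integ g); last by ring.
    rewrite !ler_wpM2r ?invr_ge0 ?(ltW tau0)//; by rewrite /C lerDl.
  rewrite [leRHS](_ : _ = C * rho ^+ M / tau ^+ 2 * integ (fun x => g x ^+ 2)); last by ring.
  rewrite !ler_wpM2r ?invr_ge0 ?sqr_ge0 ?exprn_ge0 ?(ltW rho0)//; by rewrite /C lerDr.
exists (a%:R * Cp); first by rewrite mulr_ge0.
move=> theta L f th0 bf f0.
have thv (v : nat) : 0 < theta * 2 ^+ v by rewrite mulr_gt0// exprn_gt0.
pose m (v : nat) x := maxT (fun i => Tr G mu (scale (theta * 2 ^+ v) ratio i)) L f x.
have bT (s : nat -> R) (i : nat) g : bsupp g -> bsupp (Tr G mu (s i) g).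
  exact: bsupp_Tr mub _ _.
have bm (v : nat) : bsupp (fun x => m v x `^ p).
  by apply: bsupp_powR => //; [apply: bsupp_maxT => // i g; exact: bT|move=> x; exact: maxT_ge0].
apply: (@le_trans _ _ (integ (fun x => \sum_(v < a) m v x `^ p))).
  apply: integ_le => [||x].
  - by apply: bsupp_powR => //; [apply: bsupp_maxT => // i g; exact: (bT (fun i => theta * 2 ^+ i))|move=> x; exact: maxT_ge0].
  - by apply: bsupp_sum => v; exact: bm.
  set y := maxT _ _ _ _; have [y0|y0] := leP y 0.
    have -> : y = 0 by apply/eqP; rewrite eq_le y0 maxT_ge0.
    by rewrite powR0 ?gt_eqF// sumr_ge0// => v _; exact: powR_ge0.
  have [i iL hi] : exists2 i : nat, (i <= L)%N & y = Tr G mu (theta * 2 ^+ i) f x.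
    have [y00|] := maxT_cases (fun i => Tr G mu (theta * 2 ^+ i)) L f x; last by [].
    by move: y0; rewrite /y y00 ltxx.
  have va : (i %% a < a)%N by rewrite ltn_mod.
  have le1 (F : nat -> R) : (forall u, 0 <= F u) -> F (i %% a)%N <= \sum_(v < a) F v.
    by move=> F0; rewrite (bigD1 (Ordinal va))//= lerDl sumr_ge0.
  apply: le_trans (le1 (fun u => m u x `^ p) (fun=> powR_ge0 _ _)).
  apply: ge0_ler_powR; rewrite ?nnegrE ?maxT_ge0 ?(ltW p0) ?(ltW y0)//.
  rewrite hi (_ : theta * 2 ^+ i = scale (theta * 2 ^+ (i %% a)) ratio (i %/ a)).
    have iaL : (i %/ a <= L)%N by rewrite (leq_trans _ iL)// leq_div.
    exact: (maxT_ub (fun u => Tr G mu (scale (theta * 2 ^+ (i %% a)) ratio u)) f x iaL).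
  by rewrite /scale /ratio -exprM -mulrA -exprD mulnC addnC -divn_eq.
rewrite integ_sum//.
apply: (@le_trans _ _ (\sum_(v < a) Cp * integ (fun x => f x `^ p))).
  by apply: ler_sum => v _; exact: one_class.
by rewrite sumr_const card_ord -[leLHS]mulr_natl mulrA.
Qed.

End Unweighted.

(** As alpha < 0, the terms decay geometrically from the first scale that reaches t, and that first
    term is at most t^alpha. *)
Lemma sum_geo_tail (R : realType) (theta alpha t : R) (K : nat) : 0 < theta -> alpha < 0 -> 0 < t ->
  \sum_(i < K) (theta * 2 ^+ i) `^ alpha * (t <= theta * 2 ^+ i)%R%:R <= t `^ alpha / (1 - 2 `^ alpha).
Proof.
move=> th0 a0 t0.
have a1 : 0 < 2 `^ alpha :> R by rewrite powR_gt0.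
have a2 : 2 `^ alpha < 1 :> R.
  rewrite -[alpha]opprK powRN invf_lt1 ?powR_gt0// -[X in X < _](powR1l (- alpha)).
  by rewrite gt0_ltr_powR ?oppr_gt0// ?nnegrE// ltr1n.
have d0 : 0 < 1 - 2 `^ alpha :> R by rewrite subr_gt0.
elim: K theta th0 => [|K IH] theta th0; first by rewrite big_ord0 divr_ge0 ?powR_ge0// ltW.
rewrite big_ord_recl expr0 mulr1.
under eq_bigr do rewrite lift0 exprS mulrA.
have th2 : 0 < theta * 2 by rewrite mulr_gt0.
case: (leP t theta) => damp; last by rewrite mulr0 add0r; exact: IH.
rewrite mulr1 -subr_ge0.
have all1 (i : nat) : t <= theta * 2 * 2 ^+ i.
  by rewrite (le_trans damp)// -mulrA ler_peMr ?(ltW th0)// -exprS exprn_ege1// ler1n.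
have E : \sum_(i < K) (theta * 2 * 2 ^+ i) `^ alpha * (t <= theta * 2 * 2 ^+ i)%R%:R <=
    (theta * 2) `^ alpha / (1 - 2 `^ alpha).
  have -> : \sum_(i < K) (theta * 2 * 2 ^+ i) `^ alpha * (t <= theta * 2 * 2 ^+ i)%R%:R =
      (theta * 2) `^ alpha * \sum_(i < K) (2 `^ alpha) ^+ i.
    rewrite big_distrr; apply: eq_bigr => i _ /=; rewrite all1 mulr1.
    by rewrite powRM ?(ltW th2)// -[in LHS]powR_mulrn// -powRrM mulrC -powR_mulrn ?powR_ge0// -powRrM mulrC [alpha * _]mulrC.
  rewrite ler_wpM2l ?powR_ge0//; apply: sum_geo_le.
  by rewrite (ltW a1).
rewrite subr_ge0; apply: (@le_trans _ _ (theta `^ alpha / (1 - 2 `^ alpha))).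
  apply: (@le_trans _ _ (theta `^ alpha + (theta * 2) `^ alpha / (1 - 2 `^ alpha))).
    by rewrite lerD2l.
  rewrite powRM ?(ltW th0)// le_eqVlt; apply/orP; left; apply/eqP; field.
  by rewrite gt_eqF.
rewrite ler_pM2r ?invr_gt0//.
rewrite -[alpha]opprK (powRN theta) (powRN t) lef_pV2 ?posrE ?powR_gt0//.
apply: ge0_ler_powR => //; rewrite ?nnegrE ?(ltW t0) ?(ltW th0)//.
by rewrite oppr_ge0 ltW.
Qed.

(** * The weighted estimate for finitely many scales *)

Section Weighted.
Context {R : realType} {n : nat} (G : homogeneousGroup R n) (q : quasiNorm G).
Hypothesis qN : forall x, q (- x) = q x.
Notation V := 'rV[R]_n.
Notation lam := (@lebesgue R n).
Variables (mu : {finite_measure set V -> \bar R}) (a b : R).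
Hypotheses (a_gt0 : 0 < a) (mub : mu (~` norm_ball b) = 0)
  (mua : mu (~` [set y | a <= `|y| <= b]) = 0).
Implicit Types (x y z : V) (r : R) (f g v w : V -> R).

(** [mu] is carried by an annulus, so the two functions need to be compared only at the shifts that
    come from it. Its positive inner radius is what gives [T_far] a lower bound on the shifted
    point. *)
Lemma Tr_le_annulus r f g x : bsupp f -> bsupp g ->
  (forall y, a <= `|y| <= b -> f (gmul G x (- dl G r y)) <= g (gmul G x (- dl G r y))) ->
  Tr G mu r f x <= Tr G mu r g x.
Proof.
move=> bf bg fg; pose S : set V := [set y | a <= `|y| <= b].
have mS : measurable S.
  have -> : S = [set y : V | a <= `|y|] `&` norm_ball b.
    by apply/seteqP; split => [y /andP[]|y [h1 h2]] //; apply/andP.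
  apply: measurableI; last exact: measurable_norm_ball.
  apply: measurable_rV_closed.
  rewrite (_ : [set y : V | a <= `|y|] = (fun y : V => `|y|) @^-1` [set t | a <= t])//.
  by apply: closed_comp; [move=> y _; exact: norm_continuous|exact: closed_ge].
have as_ := adm_dl G b r.
have E h : bsupp h -> Tr G mu r h x = (\int[mu]_y (h (gmul G x (- dl G r y)) * \1_S y))%R.
  move=> bh; rewrite /Tr /Op /Rintegral; congr fine.
  have mh := measurable_gmul_comp G x as_ bh.
  apply: ae_eq_integral => //.
  - exact/measurable_EFinP.
  - by apply/measurable_EFinP; apply: measurable_funM => //; exact: measurable_indic.
  exists (~` S); split => //; first exact: measurableC.
  by move=> y /= hy Sy; apply: hy => _; congr EFin; rewrite indicE mem_set// mulr1.
have I h : bsupp h -> mu.-integrable setT (EFin \o (fun y => h (gmul G x (- dl G r y)) * \1_S y)).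
  move=> bh; have [M M0 [rho [hM _]]] := bsupp_bound bh.
  apply: (@bounded_integrable _ _ _ mu _ M).
    by apply: measurable_funM; [exact: (measurable_gmul_comp G x as_ bh)|exact: measurable_indic].
  by move=> y; rewrite normrM -[leRHS]mulr1 ler_pM// indicE; case: (_ \in _); rewrite ?normr1 ?normr0.
rewrite !E//; apply: le_Rintegral => //; [exact: I|exact: I|].
move=> y _; rewrite indicE; case: (boolP (y \in S)) => [/set_mem Sy|_]; last by rewrite !mulr0.
by rewrite !mulr1; exact: fg.
Qed.

Variables (alpha p : R).
Hypotheses (alpha_lt0 : alpha < 0) (p_gt1 : 1 < p).

Definition wgt x : R := q x `^ alpha.

Lemma wgt_ge0 x : 0 <= wgt x. Proof. exact: powR_ge0. Qed.

(** By convention a negative power of 0 is 0 and not infinity. The identity is therefore an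
    exceptional point in pointwise comparisons with the weight and is discarded as a null set. *)
Lemma wgt0 : wgt 0 = 0.
Proof. by rewrite /wgt qnorm0 powR0// lt_eqF. Qed.

Lemma measurable_wgt : measurable_fun setT wgt.
Proof. exact: (measurableT_comp (measurable_powR alpha) (measurable_qnorm q)). Qed.

Lemma powR_anti s t : 0 < s -> s <= t -> t `^ alpha <= s `^ alpha.
Proof.
move=> s0 st; have t0 : 0 < t by exact: lt_le_trans st.
rewrite -[alpha]opprK (powRN s) (powRN t) lef_pV2 ?posrE ?powR_gt0//.
apply: ge0_ler_powR => //; rewrite ?nnegrE ?(ltW s0) ?(ltW t0)//.
by rewrite oppr_ge0 ltW.
Qed.

Section Cutoff.
Variables (t1 t2 : R).
Hypotheses (t1_gt0 : 0 < t1).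

(* Continuous, because the single-scale hypothesis is about [C_c] only. *)
Definition cutoff s : R := Num.min 1 (Num.max 0 (Num.min (s / t1 - 1) (2 - s / t2))).

Lemma cutoff01 s : 0 <= cutoff s <= 1.
Proof. by rewrite /cutoff le_min ler01 le_max lexx /= ge_min lexx. Qed.

Lemma cutoff_eq1 s : 0 < t2 -> 2 * t1 <= s <= t2 -> cutoff s = 1.
Proof.
move=> t20 /andP[h1 h2]; rewrite /cutoff; apply/min_idPl; rewrite le_max; apply/orP; right.
rewrite le_min; apply/andP; split.
  by rewrite lerBrDr ler_pdivlMr// (le_trans _ h1)// le_eqVlt; apply/orP; left; apply/eqP; ring.
by rewrite lerBrDr -lerBrDl (le_trans (_ : _ <= 1))// ?ler_pdivrMr ?mul1r//; lra.
Qed.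

Lemma cutoff_neq0 s : 0 < t2 -> cutoff s != 0 -> t1 < s < 2 * t2.
Proof.
move=> t20; apply: contraR => h; rewrite /cutoff.
have : Num.min (s / t1 - 1) (2 - s / t2) <= 0.
  move: h; rewrite negb_and -!leNgt ge_min => /orP[h|h]; apply/orP; [left|right].
    by rewrite subr_le0 ler_pdivrMr// mul1r.
  by rewrite subr_le0 ler_pdivlMr.
by move=> h0; apply/eqP; rewrite (max_idPl h0) minEle ler10.
Qed.

Lemma cutoff_continuous : continuous cutoff.
Proof.
have cid c : continuous (fun s : R^o => s / c : R^o).
  by move=> s; apply: cvgM; [exact: cvg_id|exact: cvg_cst].
have c1 : continuous (fun s : R^o => s / t1 - 1 : R^o).
  by move=> s; apply: cvgB; [exact: cid|exact: cvg_cst].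
have c2 : continuous (fun s : R^o => 2 - s / t2 : R^o).
  by move=> s; apply: cvgB; [exact: cvg_cst|exact: cid].
have wconst c : continuous (fun _ : R^o => c : R^o) by move=> ?; exact: cvg_cst.
move=> s; apply: (continuous_min (wconst 1 s)).
apply: (continuous_max (wconst 0 s)).
exact: (continuous_min (c1 s) (c2 s)).
Qed.

End Cutoff.
Section Estimate.
Variables (theta : R) (K L : nat) (A B Cu C1 : R) (f : V -> R).
Hypotheses (theta_gt0 : 0 < theta) (A_gt0 : 0 < A) (B_gt0 : 0 < B) (Cu_ge0 : 0 <= Cu) (C1_ge0 : 0 <= C1)
  (AB : forall y, a <= `|y| <= b -> A <= q y <= B)
  (L_big : 4 * ctri q / A + 2 <= 2 ^+ L)
  (unweighted : forall theta (L : nat) g, 0 < theta -> bsupp g -> (forall x, 0 <= g x) ->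
    integ (fun x => maxT (fun i => Tr G mu (theta * 2 ^+ i)) L g x `^ p) <= Cu * integ (fun x => g x `^ p))
  (bf : bsupp f) (f0 : forall x, 0 <= f x).

Definition sl (i : nat) : R := theta * 2 ^+ i.
Notation T := (fun i : nat => Tr G mu (sl i)).

(** For x small against the scale sl i, every point entering the average at x has quasi-norm between
    2 inner sl(i) and outer sl(i). The cutoff equals 1 there and is supported between inner sl(i)
    and 2 outer sl(i). *)
Definition inner : R := A / (4 * ctri q).
Definition outer : R := ctri q * (1 + B).
Definition far (i : nat) x : R := f x * cutoff inner outer (q x / sl i).
Definition near_const : R := ctri q * (2 + 2 ^+ L * B).
Definition near (l : nat) x : R := \1_(qball q (near_const * sl l)) x * f x.
(** The truncation keeps the weight bounded, so that products with it stay integrable, and it places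
    every relevant x in a shell sl l <= q x < sl (l + 1) with l < K. *)
Definition wD x : R := wgt x * ((theta <= q x) && (q x < sl K))%:R.

Hypothesis single : forall i : nat, (i <= K)%N ->
  integ (fun x => T i (far i) x `^ p * wD x) <= C1 * integ (fun x => far i x `^ p * wgt x).

Let c0 := ctri_gt0 q.
Let p0 : 0 < p. Proof. exact: lt_trans p_gt1. Qed.

Lemma sl_gt0 i : 0 < sl i.
Proof. by rewrite mulr_gt0// exprn_gt0. Qed.

Lemma inner_gt0 : 0 < inner.
Proof. by rewrite divr_gt0// mulr_gt0. Qed.

Lemma outer_gt0 : 0 < outer.
Proof. by rewrite mulr_gt0// addr_gt0. Qed.

Lemma near_const_gt0 : 0 < near_const.
Proof. by rewrite mulr_gt0// addr_gt0// mulr_gt0// exprn_gt0. Qed.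

Lemma far_ge0 i x : 0 <= far i x.
Proof. by rewrite mulr_ge0//; case/andP: (cutoff01 inner outer (q x / sl i)). Qed.

Lemma near_ge0 l x : 0 <= near l x.
Proof. by rewrite mulr_ge0// indicE. Qed.

Lemma bsupp_far i : bsupp (far i).
Proof.
have mq := measurable_qnorm q.
rewrite (_ : far i = fun x => cutoff inner outer (q x / sl i) * f x); last first.
  by apply/funext => x; rewrite /far mulrC.
apply: (bsuppM (M := 1)) => //.
  have mc : measurable_fun setT (cutoff inner outer).
    by apply: continuous_measurable_fun; exact: cutoff_continuous.
  by apply: (measurableT_comp mc); exact: measurable_funM.
by move=> x; have /andP[h0 h1] := cutoff01 inner outer (q x / sl i); rewrite ger0_norm.
Qed.

Lemma bsupp_near l : bsupp (near l).
Proof. by apply: bsupp_mul => //; exact: bsupp_qball. Qed.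

Lemma wD_ge0 x : 0 <= wD x.
Proof. by rewrite mulr_ge0 ?wgt_ge0. Qed.

Lemma measurable_wD : measurable_fun setT wD.
Proof.
have mq := measurable_qnorm q.
apply: measurable_funM; first exact: measurable_wgt.
have mb : measurable_fun setT (fun x => (theta <= q x) && (q x < sl K)).
  by apply: measurable_and; [exact: measurable_fun_ler|exact: measurable_fun_ltr].
rewrite (_ : (fun x => _) = \1_((fun x => (theta <= q x) && (q x < sl K)) @^-1` [set true])).
  by apply: measurable_indic; exact: measurable_preimage.
apply/funext => x; rewrite indicE.
by case h : (_ && _); [rewrite mem_set|rewrite memNset//= h].
Qed.

Lemma wD_le x : `|wD x| <= theta `^ alpha.
Proof.
rewrite ger0_norm ?wD_ge0// /wD; case: (leP theta (q x)) => h; last by rewrite mulr0 powR_ge0.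
apply: (@le_trans _ _ (wgt x)); last exact: powR_anti.
by rewrite ler_piMr ?wgt_ge0//; case: (_ && _).
Qed.

Lemma bsupp_wD g : bsupp g -> bsupp (fun x => g x * wD x).
Proof.
move=> bg; rewrite (_ : (fun x => _) = fun x => wD x * g x); last by apply/funext => x; rewrite mulrC.
exact: (bsuppM measurable_wD wD_le bg).
Qed.

(** Here q x < 2 sl(l), and the shift has quasi-norm at most B sl(i) <= 2^L B sl(l); [near_const] is
    ctri times the sum of the two bounds. *)
Lemma T_near i l x : (i < l + L)%N -> q x < sl l.+1 -> Tr G mu (sl i) f x <= Tr G mu (sl i) (near l) x.
Proof.
move=> il qx; apply: Tr_le_annulus => //; first exact: bsupp_near.
move=> y /AB/andP[_ yB]; set u := gmul G x _.
rewrite /near indicE mem_set ?mul1r// /qball /=.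
have si := sl_gt0 i; have sll := sl_gt0 l.
have h : q u <= ctri q * (q x + q (dl G (sl i) y)).
  have := dist_triangle q 0 x u.
  by rewrite /u dist_gmul qN /dist oppr0 !gmul0x.
apply: (le_trans h); rewrite /near_const -mulrA ler_pM2l// mulrDl qnorm_dl// lerD//.
  by rewrite (le_trans (ltW qx))// /sl exprS le_eqVlt; apply/orP; left; apply/eqP; ring.
apply: (@le_trans _ _ (sl i * B)); first by rewrite ler_pM2l.
rewrite [leRHS]mulrAC ler_pM2r// /sl [leRHS]mulrCA ler_pM2l// -exprD ler_weXn2l ?ler1n//.
by rewrite addnC ltnW.
Qed.

(** [L_big] makes q x at most sl(i) and at most sl(i) A / (2 ctri). The triangle inequality then
    puts q u below outer sl(i); applied to the shift itself, of quasi-norm at least A sl(i), it puts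
    q u above 2 inner sl(i). *)
Lemma T_far i l x : (l + L <= i)%N -> q x < sl l.+1 -> Tr G mu (sl i) f x <= Tr G mu (sl i) (far i) x.
Proof.
move=> li qx; apply: Tr_le_annulus => //; first exact: bsupp_far.
move=> y yab; have /andP[yA yB] := AB yab; set u := gmul G x _.
have si := sl_gt0 i; have sll := sl_gt0 l.
have qd := qnorm_dl q y si.
rewrite /far cutoff_eq1 ?mulr1// ?inner_gt0 ?outer_gt0//.
have c1 := ctri_ge1 q.
have qxi : q x * (4 * ctri q / A + 2) <= 2 * sl i.
  apply: (@le_trans _ _ (q x * 2 ^+ L)); first by rewrite ler_wpM2l// qnorm_ge0.
  apply: (@le_trans _ _ (sl l.+1 * 2 ^+ L)); first by rewrite ler_wpM2r ?exprn_ge0// ltW.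
  rewrite /sl exprS -!mulrA [leRHS]mulrCA ler_pM2l//.
  by rewrite ler_pM2l// -exprD ler_weXn2l// ler1n.
have qx0 := qnorm_ge0 q x.
have h1 : q x <= sl i.
  have e0 : 0 <= 4 * ctri q / A by rewrite divr_ge0 ?(ltW A_gt0)// mulr_ge0// ltW.
  by move: (4 * ctri q / A) (sl i) (q x) e0 qxi qx0 => e t u0 ? ? ?; nra.
have h2 : q x <= sl i * A / (2 * ctri q).
  rewrite ler_pdivlMr ?mulr_gt0//.
  have h : q x * (4 * ctri q / A) <= 2 * sl i.
    by apply: le_trans qxi; rewrite ler_wpM2l// lerDl.
  move: h; rewrite mulrA ler_pdivrMr// => h.
  by move: (ctri q) (sl i) (q x) (A) h => C t u0 A'; lra.
have hu1 : q u <= ctri q * (q x + q (dl G (sl i) y)).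
  have := dist_triangle q 0 x u.
  by rewrite /u dist_gmul qN /dist oppr0 !gmul0x.
have hu2 : q (dl G (sl i) y) <= ctri q * (q x + q u).
  have := dist_triangle q x 0 u; rewrite {1}/u dist_gmul qN.
  by rewrite [dist q x 0]/dist gmulx0 qN [dist q 0 u]/dist oppr0 gmul0x.
rewrite qd in hu1 hu2.
rewrite /inner /outer; apply/andP; split.
  rewrite ler_pdivlMr//.
  have -> : 2 * (A / (4 * ctri q)) * sl i = sl i * A / (2 * ctri q).
    by field; rewrite gt_eqF.
  have hA : sl i * A <= ctri q * (q x + q u) by rewrite (le_trans _ hu2)// ler_pM2l.
  have : sl i * A / ctri q <= q x + q u by rewrite ler_pdivrMr// [leRHS]mulrC.
  have -> : sl i * A / ctri q = sl i * A / (2 * ctri q) + sl i * A / (2 * ctri q).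
    by field; rewrite gt_eqF.
  by move: h2; move: (_ / _) (q x) (q u) => e u0 u1; lra.
rewrite ler_pdivrMr// (le_trans hu1)// -[leRHS]mulrA ler_pM2l// mulrDl mul1r lerD//.
by rewrite mulrC ler_pM2r.
Qed.

(** The maximum at x is attained at a single scale i, and x lies in a single shell l, so one term of
    one of the two sums already dominates. *)
Lemma pointwise_bound x : maxT T K f x `^ p * wD x <=
  \sum_(l < K) sl l `^ alpha * maxT T K (near l) x `^ p +
  \sum_(i < K.+1) Tr G mu (sl i) (far i) x `^ p * wD x.
Proof.
have S1 : 0 <= \sum_(l < K) sl l `^ alpha * maxT T K (near l) x `^ p.
  by apply: sumr_ge0 => l _; rewrite mulr_ge0 ?powR_ge0.
have S2 : 0 <= \sum_(i < K.+1) Tr G mu (sl i) (far i) x `^ p * wD x.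
  by apply: sumr_ge0 => i _; rewrite mulr_ge0 ?powR_ge0 ?wD_ge0.
case D : ((theta <= q x) && (q x < sl K)); last first.
  by rewrite [X in _ * X <= _]/wD D !mulr0 addr_ge0.
have [->|[i iK ->]] := maxT_cases T K f x.
  by rewrite powR0 ?gt_eqF// mul0r addr_ge0.
have Tf0 (j : nat) g : (forall y, 0 <= g y) -> 0 <= Tr G mu (sl j) g x by move=> g0; exact: Op_ge0.
have [l lK qxl] : exists2 l : nat, (l < K)%N & sl l <= q x < sl l.+1.
  have /andP[hD1 hD2] := D.
  have ex : exists l : nat, q x < sl l by exists K.
  case: (ex_minnP ex) => -[|l] hl lmin.
    by move: hl; rewrite /sl expr0 mulr1 ltNge hD1.
  exists l; first exact: lmin.
  by rewrite hl andbT leNgt; apply/negP => /lmin; rewrite ltnn.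
have /andP[qx1 qx2] := qxl.
have [il|il] := ltnP i (l + L).
  apply: ler_wpDr => //.
  have le1 (F : nat -> R) : (forall u, 0 <= F u) -> F l <= \sum_(u < K) F u.
    by move=> F0; rewrite (bigD1 (Ordinal lK))//= lerDl sumr_ge0.
  apply: le_trans (le1 (fun l => sl l `^ alpha * maxT T K (near l) x `^ p) _); last first.
    by move=> u; rewrite mulr_ge0 ?powR_ge0.
  rewrite mulrC; apply: ler_pM; rewrite ?powR_ge0 ?wD_ge0//.
    by rewrite /wD D mulr1; apply: powR_anti => //; exact: sl_gt0.
  apply: ge0_ler_powR; rewrite ?nnegrE ?maxT_ge0 ?(ltW p0) ?Tf0//.
  apply: (le_trans (T_near il qx2)).
  exact: (maxT_ub T (near l) x iK).
apply: ler_wpDl => //.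
have le1 (F : nat -> R) : (forall u, 0 <= F u) -> F i <= \sum_(u < K.+1) F u.
  have iK1 : (i < K.+1)%N by [].
  by move=> F0; rewrite (bigD1 (Ordinal iK1))//= lerDl sumr_ge0.
apply: le_trans (le1 (fun i => Tr G mu (sl i) (far i) x `^ p * wD x) _); last first.
  by move=> u; rewrite mulr_ge0 ?powR_ge0 ?wD_ge0.
rewrite ler_wpM2r ?wD_ge0//.
apply: ge0_ler_powR; rewrite ?nnegrE ?(ltW p0) ?Tf0//; last exact: T_far il qx2.
by move=> y; exact: far_ge0.
Qed.

(** In the far sum, the lower bound inner sl(i) on q u has been spent to replace the weight by
    (inner sl(i))^alpha. Only the ball q u <= 2 outer sl(i) is kept, so both sums are geometric
    series of the kind bounded in [sum_geo_tail]. *)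
Definition maj u : R := Cu * (\sum_(l < K) sl l `^ alpha * \1_(qball q (near_const * sl l)) u) +
  C1 * inner `^ alpha * (\sum_(i < K.+1) sl i `^ alpha * \1_(qball q (2 * outer * sl i)) u).

Lemma far_powR_le i u : far i u `^ p * wgt u <=
  inner `^ alpha * sl i `^ alpha * \1_(qball q (2 * outer * sl i)) u * f u `^ p.
Proof.
have si := sl_gt0 i.
have R0 : 0 <= inner `^ alpha * sl i `^ alpha * \1_(qball q (2 * outer * sl i)) u * f u `^ p.
  by rewrite !mulr_ge0 ?powR_ge0.
have [h|h] := eqVneq (cutoff inner outer (q u / sl i)) 0.
  by rewrite /far h mulr0 powR0 ?gt_eqF// mul0r.
have /andP[h1 h2] := cutoff_neq0 inner_gt0 outer_gt0 h.
rewrite ltr_pdivlMr// in h1; rewrite ltr_pdivrMr// in h2.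
rewrite indicE mem_set ?mulr1; last exact: ltW.
rewrite -powRM ?(ltW inner_gt0) ?(ltW si)// mulrC.
apply: ler_pM; rewrite ?powR_ge0 ?wgt_ge0//.
  by apply: powR_anti; [rewrite mulr_gt0// inner_gt0|exact: ltW].
apply: ge0_ler_powR; rewrite ?nnegrE ?far_ge0 ?(ltW p0)//.
by rewrite /far ler_piMr//; case/andP: (cutoff01 inner outer (q u / sl i)).
Qed.

Lemma bsupp_powR_f : bsupp (fun x => f x `^ p).
Proof. exact: bsupp_powR. Qed.

Lemma bsupp_T i g : bsupp g -> bsupp (Tr G mu (sl i) g).
Proof. exact: (bsupp_Tr G mub (sl i)). Qed.

Lemma bsupp_maxT_powR g : bsupp g -> bsupp (fun x => maxT T K g x `^ p).
Proof.
move=> bg; apply: bsupp_powR => //; last by move=> x; exact: maxT_ge0.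
by apply: bsupp_maxT => // i h; exact: bsupp_T.
Qed.

Lemma bsupp_ball_mul (k r : R) g : bsupp g -> bsupp (fun u => k * \1_(qball q r) u * g u).
Proof.
move=> bg; have := bsuppZ k (bsupp_mul (bsupp_qball q r) bg).
by rewrite (_ : (fun x => _) = fun u => k * \1_(qball q r) u * g u)//; apply/funext => u; rewrite mulrA.
Qed.

Lemma bsupp_far_wgt i : bsupp (fun x => far i x `^ p * wgt x).
Proof.
apply: (bsupp_le (g := fun u => inner `^ alpha * sl i `^ alpha * \1_(qball q (2 * outer * sl i)) u * f u `^ p)).
- apply: measurable_funM; last exact: measurable_wgt.
  exact: (measurableT_comp (measurable_powR p) (bsupp_measurable (bsupp_far i))).
- move=> u; rewrite ger0_norm ?mulr_ge0 ?powR_ge0 ?wgt_ge0//.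
  by rewrite (le_trans (far_powR_le i u))// ler_norm.
- by apply: bsupp_ball_mul; exact: bsupp_powR_f.
Qed.

Lemma integ_estimate : integ (fun x => maxT T K f x `^ p * wD x) <= integ (fun u => maj u * f u `^ p).
Proof.
have bp := bsupp_powR_f.
have Tf0 (j : nat) g x : (forall y, 0 <= g y) -> 0 <= Tr G mu (sl j) g x by move=> g0; exact: Op_ge0.
have b1 l : bsupp (fun x => sl l `^ alpha * maxT T K (near l) x `^ p).
  by apply: bsuppZ; apply: bsupp_maxT_powR; exact: bsupp_near.
have b2 i : bsupp (fun x => Tr G mu (sl i) (far i) x `^ p * wD x).
  apply: bsupp_wD; apply: bsupp_powR => //.
    by apply: bsupp_T; exact: bsupp_far.
  by move=> x; apply: Tf0 => y; exact: far_ge0.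
pose g1 l u := Cu * sl l `^ alpha * \1_(qball q (near_const * sl l)) u * f u `^ p.
pose g2 i u := C1 * inner `^ alpha * sl i `^ alpha * \1_(qball q (2 * outer * sl i)) u * f u `^ p.
have bg1 l : bsupp (g1 l) by exact: bsupp_ball_mul.
have bg2 i : bsupp (g2 i) by exact: bsupp_ball_mul.
apply: (@le_trans _ _ (integ (fun x => \sum_(l < K) sl l `^ alpha * maxT T K (near l) x `^ p +
  \sum_(i < K.+1) Tr G mu (sl i) (far i) x `^ p * wD x))).
  apply: integ_le => [||x]; last exact: pointwise_bound.
  - by apply: bsupp_wD; exact: bsupp_maxT_powR.
  - by apply: bsuppD; apply: bsupp_sum => i; [exact: b1|exact: b2].
rewrite integD; [|by apply: bsupp_sum => i; exact: b1|by apply: bsupp_sum => i; exact: b2].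
have -> : integ (fun u => maj u * f u `^ p) =
    integ (fun u => \sum_(l < K) g1 l u) + integ (fun u => \sum_(i < K.+1) g2 i u).
  rewrite -integD; [|by apply: bsupp_sum => i; exact: bg1|by apply: bsupp_sum => i; exact: bg2].
  apply: eq_integ => u; rewrite /maj mulrDl !big_distrr !big_distrl /=.
  by congr (_ + _); apply: eq_bigr => l _; rewrite /g1 /g2; ring.
rewrite (integ_sum _ _ (F := fun l : 'I_K => _))//.
rewrite (integ_sum _ _ (F := fun i : 'I_K.+1 => _))//.
rewrite (integ_sum _ _ (F := fun l : 'I_K => g1 l))// (integ_sum _ _ (F := fun i : 'I_K.+1 => g2 i))//.
apply: lerD; apply: ler_sum => i _.
  rewrite integZ; last by apply: bsupp_maxT_powR; exact: bsupp_near.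
  have bn : bsupp (fun x => near i x `^ p).
    by apply: bsupp_powR => //; [exact: bsupp_near|move=> x; exact: near_ge0].
  apply: (@le_trans _ _ (sl i `^ alpha * (Cu * integ (fun x => near i x `^ p)))).
    rewrite ler_wpM2l ?powR_ge0//; apply: unweighted => //; first exact: bsupp_near.
    by move=> x; exact: near_ge0.
  rewrite mulrA -integZ// le_eqVlt; apply/orP; left; apply/eqP.
  apply: eq_integ => u; rewrite /g1 /near indicE; case: (_ \in _).
    by rewrite mul1r mulr1 [Cu * _]mulrC.
  by rewrite mul0r mulr0 powR0 ?gt_eqF// mulr0 mul0r.
have iK : (i <= K)%N by rewrite -ltnS.
apply: (le_trans (single iK)).
have bfw := bsupp_far_wgt i.
rewrite -integZ//; apply: integ_le => [||u]; [exact: bsuppZ|exact: bg2|].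
rewrite (_ : g2 i u = C1 * (inner `^ alpha * sl i `^ alpha *
  \1_(qball q (2 * outer * sl i)) u * f u `^ p)); last by rewrite /g2; ring.
by rewrite ler_wpM2l//; exact: far_powR_le.
Qed.

Lemma maj_le u : u != 0 -> maj u <=
  (Cu * near_const^-1 `^ alpha + C1 * inner `^ alpha * (2 * outer)^-1 `^ alpha) / (1 - 2 `^ alpha) * wgt u.
Proof.
move=> u0; have qu : 0 < q u by exact: qnorm_gt0.
have geo (k : R) (m : nat) : 0 < k -> \sum_(l < m) sl l `^ alpha * \1_(qball q (k * sl l)) u <=
    k^-1 `^ alpha * wgt u / (1 - 2 `^ alpha).
  move=> k0; have t0 : 0 < k^-1 * q u by rewrite mulr_gt0// invr_gt0.
  rewrite /wgt -powRM ?invr_ge0 ?(ltW k0) ?(ltW qu)//.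
  apply: le_trans (sum_geo_tail m theta_gt0 alpha_lt0 t0); rewrite le_eqVlt; apply/orP; left; apply/eqP.
  apply: eq_bigr => l _; congr (_ * _); rewrite indicE; congr (nat_of_bool _)%:R.
  rewrite ler_pdivrMl//; apply/idP/idP; last by move=> h; apply/mem_set.
  by move/set_mem.
have h1 := geo _ K near_const_gt0.
have o2 : 0 < 2 * outer by rewrite mulr_gt0// outer_gt0.
have h2 := geo _ K.+1 o2.
rewrite /maj; apply: (le_trans (lerD (ler_wpM2l Cu_ge0 h1) (ler_wpM2l _ h2))).
  by rewrite mulr_ge0// powR_ge0.
rewrite le_eqVlt; apply/orP; left; apply/eqP; ring.
Qed.

Lemma weighted_estimate : lam [set 0] = 0 ->
  ((integ (fun x => maxT T K f x `^ p * wD x))%:E <=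
  ((Cu * near_const^-1 `^ alpha + C1 * inner `^ alpha * (2 * outer)^-1 `^ alpha) / (1 - 2 `^ alpha))%:E *
  \int[lam]_x (f x `^ p * wgt x)%:E)%E.
Proof.
move=> lam0; set C4 := _ / _.
have bm : bsupp (fun u => maj u * f u `^ p).
  have e : (fun u => maj u * f u `^ p) = fun u =>
     \sum_(l < K) (Cu * sl l `^ alpha * \1_(qball q (near_const * sl l)) u * f u `^ p) +
     \sum_(i < K.+1) (C1 * inner `^ alpha * sl i `^ alpha * \1_(qball q (2 * outer * sl i)) u * f u `^ p).
    apply/funext => u; rewrite /maj mulrDl !big_distrr !big_distrl /=.
    by congr (_ + _); apply: eq_bigr => l _; ring.
  rewrite e; apply: bsuppD; apply: bsupp_sum => i; apply: bsupp_ball_mul; exact: bsupp_powR_f.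
have maj0 u : 0 <= maj u.
  by apply: addr_ge0; rewrite !mulr_ge0 ?powR_ge0// sumr_ge0// => i _; rewrite mulr_ge0 ?powR_ge0.
have mf : measurable_fun setT (fun x => f x `^ p) := bsupp_measurable bsupp_powR_f.
have mfw : measurable_fun setT (fun x => f x `^ p * wgt x).
  by apply: measurable_funM => //; exact: measurable_wgt.
have C40 : 0 <= C4.
  rewrite divr_ge0//; first by rewrite addr_ge0// !mulr_ge0 ?powR_ge0.
  rewrite subr_ge0 -[alpha]opprK powRN invf_le1 ?powR_gt0//.
  by apply: powR_ge1; [rewrite ler1n|rewrite oppr_ge0 ltW].
apply: (@le_trans _ _ (integ (fun u => maj u * f u `^ p))%:E).
  by rewrite lee_fin; exact: integ_estimate.
rewrite /integ /Rintegral fineK; last first.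
  by apply: integrable_fin_num => //; exact: bsupp_integrable.
rewrite -ge0_integralZl//; last 2 first.
- exact/measurable_EFinP.
- by move=> x _; rewrite lee_fin mulr_ge0 ?powR_ge0 ?wgt_ge0.
apply: ae_ge0_le_integral => //.
- by move=> x _; rewrite lee_fin mulr_ge0 ?powR_ge0.
- by apply/measurable_EFinP; exact: bsupp_measurable bm.
- by move=> x _; rewrite mule_ge0 ?lee_fin// mulr_ge0 ?powR_ge0 ?wgt_ge0.
- by apply/measurable_EFinP; exact: measurable_funM.
(* At u = 0 the weight is 0 by convention while [maj] need not vanish, so the comparison holds only
   almost everywhere. *)
exists [set 0]; split => //.
  rewrite (_ : [set 0] = norm_ball 0); first exact: measurable_norm_ball.
  by apply/seteqP; split => x /=; rewrite /norm_ball /= normr_le0 => /eqP.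
move=> u /= h; apply: contrapT => u0; apply: h => _.
have {}u0 : u != 0 by apply/eqP.
rewrite -EFinM lee_fin mulrCA mulrC ler_wpM2l ?powR_ge0//.
exact: maj_le.
Qed.

End Estimate.
End Weighted.

(** * A symmetric quasi-norm equivalent to the given one *)

Section Symmetrization.
Context {R : realType} {n : nat} (G : homogeneousGroup R n) (qn : quasiNorm G).
Notation V := 'rV[R]_n.
Implicit Types (x y : V).

Let sq x := Num.max (qn x) (qn (- x)).

Let sq_ge0 x : 0 <= sq x.
Proof. by rewrite le_max qnorm_ge0. Qed.

Let sq_continuous : continuous sq.
Proof.
move=> x; apply: (@continuous_max R V (qn : V -> R^o) (fun y => qn (- y) : R^o) x).
  exact: qnorm_continuous.
by apply: continuous_comp; [exact: oppr_continuous|exact: qnorm_continuous].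
Qed.

Let sq_eq0 x : sq x = 0 <-> x = 0.
Proof.
split=> [h|->]; last by rewrite /sq oppr0 maxxx; exact: qnorm0.
apply/(qnorm_eq0 qn)/eqP; rewrite eq_le qnorm_ge0 andbT.
by rewrite -h le_max lexx.
Qed.

Let sq_dilation r x : 0 < r -> sq (dilation G r x) = r * sq x.
Proof.
move=> r0; rewrite /sq -dilationN !(qnorm_dilation qn)//.
by rewrite maxr_pMr// ltW.
Qed.

Let sq_triangle : exists2 c : R, 1 <= c & forall x y, sq (gmul G x y) <= c * (sq x + sq y).
Proof.
have [c c1 hc] := qnorm_triangle qn; exists c => // x y.
have c0 : 0 < c by exact: lt_le_trans c1.
rewrite ge_max; apply/andP; split; [apply: (le_trans (hc x y))|].
  by rewrite ler_pM2l// lerD// le_max lexx.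
rewrite gmulN; apply: (le_trans (hc _ _)).
by rewrite ler_pM2l// addrC lerD// le_max lexx orbT.
Qed.

Definition symq : quasiNorm G := QuasiNorm sq_ge0 sq_continuous sq_eq0 sq_dilation sq_triangle.

Lemma symqN x : symq (- x) = symq x.
Proof. by rewrite /= /sq opprK maxC. Qed.

Lemma le_symq x : qn x <= symq x.
Proof. by rewrite /= /sq le_max lexx. Qed.

(** Both sides are homogeneous, so it suffices to bound [symq] where [qn] is at most 1, a set that
    is bounded by [qnorm_proper]. *)
Lemma symq_le : exists2 C : R, 0 < C & forall x, symq x <= C * qn x.
Proof.
have [M M0 hM] := qnorm_proper qn 1.
have [C C0 hC] := qnorm_ub symq M.
exists C => // x; have [->|x0] := eqVneq x 0; first by rewrite !qnorm0 mulr0.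
have qx := qnorm_gt0 qn x0.
rewrite -{1}(dlVK G qx x) qnorm_dl// mulrC ler_pM2r//.
by apply/hC/hM; rewrite qnorm_dl ?invr_gt0// mulVf// gt_eqF.
Qed.

End Symmetrization.

(** * The measure is carried by an annulus *)

Section Support.
Context {R : realType} {n : nat}.
Notation V := 'rV[R]_n.
Variable mu : {finite_measure set V -> \bar R}.

(** Each point off the support lies in a null ball with rational centre and radius 1/(k+1), and
    there are countably many such balls. *)
Lemma mu_msupportC : exists2 N : set V, measurable N /\ mu N = 0%E & ~` msupport mu `<=` N.
Proof.
pose W (i : 'rV[rat]_n * nat) := map_mx ratr i.1 : V.
pose D (i : 'rV[rat]_n * nat) : set V := [set x | `|x - W i| < i.2.+1%:R^-1].
have oD i : open (D i).
  rewrite (_ : D i = ball (W i) (i.2.+1%:R^-1)); first exact: ball_open.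
  by apply/seteqP; split => x; rewrite /D mx_norm_ball /ball_ /= distrC.
have mD i : measurable (D i) by exact: measurable_rV_open.
pose F (k : nat) : set V :=
  if unpickle k is Some i then if mu (D i) == 0%E then D i else set0 else set0.
have mF k : measurable (F k) by rewrite /F; case: unpickle => // i; case: ifP.
have F0 k : mu (F k) = 0%E by rewrite /F; case: unpickle => // i; case: ifP => // /eqP.
exists (\bigcup_k F k).
  split; first exact: bigcup_measurable.
  apply/eqP; rewrite eq_le measure_ge0 andbT.
  apply: (le_trans (@measure_sigma_subadditive _ _ _ mu (\bigcup_k F k) F mF _ _)) => //.
    exact: bigcup_measurable.
  by rewrite eseries0// => i _ _; exact: F0.
move=> x /existsNP[U /not_implyP[oU /not_implyP[Ux /negP]]]; rewrite -leNgt => U0.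
have /nbhs_ballP [e /= e0 eU] := open_nbhs_nbhs (conj oU Ux).
have [k ke] : exists k : nat, k.+1%:R^-1 < e / 2.
  have [|k hk] := @ltr_add_invr R 0 (e / 2); first by rewrite divr_gt0.
  by exists k; move: hk; rewrite add0r.
have k0 : (0 : R) < k.+1%:R^-1 by rewrite invr_gt0.
have [r hr] := rat_ball_rV x k0.
exists (pickle (r, k)) => //; rewrite /F pickleK ifT//.
rewrite eq_le measure_ge0 andbT; apply: le_trans U0; apply: le_measure; rewrite ?inE//.
  exact: measurable_rV_open.
move=> y; rewrite /D /W /= => hy; apply: eU.
rewrite mx_norm_ball /ball_ /=.
rewrite (le_lt_trans (ler_distD (map_mx ratr r) _ _))// (splitr e).
by rewrite ltrD// ?(lt_trans hr)// distrC (lt_trans hy).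
Qed.

Lemma measurable_annulus (a b : R) : measurable [set y : V | a <= `|y| <= b].
Proof.
have -> : [set y : V | a <= `|y| <= b] = [set y : V | a <= `|y|] `&` norm_ball b.
  by apply/seteqP; split => [y /andP[]|y [h1 h2]] //; apply/andP.
apply: measurableI; last exact: measurable_norm_ball.
apply: measurable_rV_closed.
rewrite (_ : [set y : V | a <= `|y|] = (fun y : V => `|y|) @^-1` [set t | a <= t])//.
by apply: closed_comp; [move=> y _; exact: norm_continuous|exact: closed_ge].
Qed.

Lemma mu_annulus : compact (msupport mu) -> ~ msupport mu 0 ->
  exists a b : R, 0 < a /\ mu (~` [set y | a <= `|y| <= b]) = 0%E.
Proof.
move=> cK K0; have [N [mN N0] KN] := mu_msupportC.
have [b0 [_ hb]] := compact_bounded cK.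
have Kb x : msupport mu x -> `|x| <= b0 + 1 by apply: hb; rewrite ltrDl.
have /existsNP[U /not_implyP[oU /not_implyP[U0 /negP]]] := K0; rewrite -leNgt => muU.
have /nbhs_ballP [a /= a0 aU] := open_nbhs_nbhs (conj oU U0).
exists a, (b0 + 1); split => //; apply/eqP; rewrite eq_le measure_ge0 andbT.
have mU : measurable U by exact: measurable_rV_open.
apply: (@le_trans _ _ (mu (U `|` N))).
  apply: le_measure; rewrite ?inE; [by apply: measurableC; exact: measurable_annulus|exact: measurableU|].
  move=> y /= hy; have [ya|ya] := ltP `|y| a.
    by left; apply: aU; rewrite mx_norm_ball /ball_ /= sub0r normrN.
  right; apply: KN => Ky; apply: hy; rewrite ya /=; exact: Kb.
apply: (le_trans (measureU2 mu mU mN)).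
by rewrite [X in (_ + X)%E]N0 adde0.
Qed.

End Support.

Lemma lebesgue_set1 (R : realType) (m : nat) : @lebesgue R m.+1 [set 0] = 0%E.
Proof.
have -> : @lebesgue R m.+1 [set 0] =
    (@lebesgue_measure R \x @lebesgue R m)%E ([set 0] `*` [set 0]).
  rewrite /= /pushforward; congr ((_ \x _)%E _); apply/seteqP; split => -[r v] /=.
    move=> h; have : `|row_cons (r, v)| <= 0 by rewrite /row_cons h normr0.
    by move=> /norm_row_cons[/=]; rewrite !normr_le0 => /eqP -> /eqP ->.
  by move=> [-> ->]; rewrite raddf0 row_mx0.
rewrite product_measure1E//; last first.
  rewrite (_ : [set 0] = norm_ball 0); first exact: measurable_norm_ball.
  by apply/seteqP; split => x /=; rewrite /norm_ball /= normr_le0 => /eqP.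
have e : @lebesgue_measure R [set 0] = 0%E by exact: lebesgue_measure_set1.
by rewrite [X in (X * _)%E](_ : _ = 0%E) ?mul0e.
Qed.

Section CompactSupport.
Context {R : realType} {n : nat}.
Notation V := 'rV[R]_n.

Lemma bsupp_Cc (f : V -> R) : Cc f -> bsupp f.
Proof.
move=> [cf cs]; have [b0 [_ hb]] := compact_bounded cs.
have fb x : f x != 0 -> `|x| <= b0 + 1.
  by move=> fx; apply: (hb (b0 + 1)); [rewrite ltrDl|exact: subset_closure].
have [M hM] : exists M : R, forall x, `|x| <= b0 + 1 -> `|f x| <= M.
  case: (ltP (b0 + 1) 0) => b1.
    by exists 0 => x xb; have := le_lt_trans xb b1; rewrite ltNge normr_ge0.
  have [|||c _ hc] := @EVT_max_rV R n (fun x => `|f x|) [set x | 0 <= `|x| <= b0 + 1].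
  - by exists 0 => /=; rewrite normr0 lexx.
  - exact: compact_norm_annulus.
  - apply: continuous_subspaceT => x.
    by apply: continuous_comp; [exact: cf|exact: norm_continuous].
  by exists `|f c| => x xb; apply: hc; rewrite inE /= normr_ge0.
apply: (@bsupp_intro _ _ _ `|M| (b0 + 1)) => //.
  exact: measurable_fun_continuous.
move=> x; have [->|fx] := eqVneq (f x) 0; first by rewrite normr0.
by rewrite (le_trans (hM x (fb x fx)))// ler_norm.
Qed.

Lemma Cc_mul (f g : V -> R) : Cc f -> continuous g -> Cc (fun x => f x * g x).
Proof.
move=> [cf cs] cg; split; first by move=> x; exact: (continuousM (cf x) (cg x)).
apply: (subclosed_compact _ cs); first exact: closed_closure.
apply: closure_subset => x /=; apply: contraNneq => ->; by rewrite mul0r.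
Qed.

Lemma Cc_abs (f : V -> R) : Cc f -> Cc (fun x => `|f x|).
Proof.
move=> [cf cs]; split.
  by move=> x; apply: continuous_comp; [exact: cf|exact: norm_continuous].
by rewrite (_ : [set x | `|f x| != 0] = [set x | f x != 0])//; apply/funext => x; rewrite /= normr_eq0.
Qed.

End CompactSupport.

(** * Regularity of an even word from the curvature assumption *)

Section Curvature.
Context {R : realType} {n : nat} (G : homogeneousGroup R n) (qn q : quasiNorm G).
Hypotheses (qN : forall x, q (- x) = q x) (qnq : forall x, qn x <= q x).
Notation V := 'rV[R]_n.
Notation lam := (@lebesgue R n).
Variables (mu : {finite_measure set V -> \bar R}) (b : R).
Hypothesis mub : mu (~` norm_ball b) = 0.

(* The density is nonnegative almost everywhere, so [h] may be replaced by its
   positive part. *)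
Lemma density_max0 (m : {finite_measure set V -> \bar R}) (h : V -> R) :
  measurable_fun setT h ->
  (forall A, measurable A -> m A = \int[lam]_(x in A) (h x)%:E)%E ->
  (forall A, measurable A -> m A = \int[lam]_(x in A) (Num.max (h x) 0)%:E)%E.
Proof.
move=> mh mE A mA.
pose N : set V := [set x | h x < 0].
have mN : measurable N.
  rewrite (_ : N = (fun x => h x < 0) @^-1` [set true]); last by apply/seteqP; split => x.
  by apply: measurable_preimage => //; exact: measurable_fun_ltr.
have mN0 : m N = 0%E.
  apply/eqP; rewrite eq_le measure_ge0 andbT mE// integralE.
  rewrite [X in (X - _)%E](_ : _ = 0%E).
    by rewrite sub0e oppe_le0 integral_ge0// => x _; exact: funeneg_ge0.
  apply: integral0_eq => x Nx; rewrite funeposE; apply/max_idPr.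
  by rewrite lee_fin ltW.
have AE : m A = m (A `\` N).
  rewrite (measureD mA mN) ?ltey_eq ?fin_num_measure//.
  rewrite [X in (_ - X)%E](_ : _ = 0%E) ?sube0//.
  apply/eqP; rewrite eq_le measure_ge0 andbT -mN0.
  by apply: le_measure; rewrite ?inE//; exact: measurableI.
rewrite AE mE; last exact: measurableD.
rewrite [LHS]integral_mkcond [RHS]integral_mkcond; apply: eq_integral => x _.
rewrite !patchE; have [hx|hx] := ltP (h x) 0.
  rewrite ifF; first by case: ifP.
  by apply/negbTE/negP => /set_mem[_]; exact.
case: ifPn => [/set_mem[Ax _]|h1]; first by rewrite mem_set.
rewrite ifF//; apply/negbTE; apply: contra h1 => /set_mem Ax.
by apply/mem_set; split => //; apply/negP; rewrite -leNgt.
Qed.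

(** Only the even words have the form (T1 T0)^i T1 that [T0_decay] needs. If the assumption concerns
    an odd word, one more average [T1] makes it even and keeps it regular by [regular_T1]. *)
Lemma curvature_regular : curvature_assumption qn mu -> exists i, regular q (word G mu i.*2).
Proof.
move=> [j [_ [h [mh mE] [gam [Cmu [gam0 Cmu0 hC]]]]]].
have [m mj mI] := iter_mconv_word G mub j.
have mE' A : measurable A -> m A = (\int[lam]_(x in A) (h x)%:E)%E.
  by rewrite mj; exact: mE.
have mh0 : measurable_fun setT (fun x => Num.max (h x) 0) by exact: measurable_maxr.
have reg : regular q (word G mu j).
  apply: (@density_regular _ _ _ _ qN (word G mu j) m (fun x => Num.max (h x) 0) Cmu gam mI) => //.
  - by move=> f; exact: (bsupp_word _ mub).
  - by move=> x; rewrite le_max lexx orbT.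
  - exact: density_max0.
  - exact: ltW.
  move=> y; apply: (@le_trans _ _ (Cmu * qn y `^ gam)%:E); last first.
    rewrite lee_fin ler_pM2l//; apply: ge0_ler_powR; rewrite ?nnegrE ?qnorm_ge0//.
    exact: ltW.
  apply: le_trans (hC y).
  have mg z : measurable_fun setT (fun x => h (gmul G x z)).
    by apply: (measurableT_comp mh); exact: measurable_gmulr.
  have mg' z : measurable_fun setT (fun x => h (gmul G z x)).
    by apply: (measurableT_comp mh); exact: measurable_gmull.
  apply: ge0_le_integral => //.
  - apply/measurable_EFinP; apply: measurableT_comp => //; apply: measurable_funB => //.
    by apply: measurable_maxr => //; exact: mg.
  - apply/measurable_EFinP; apply: measurable_funD.
      by apply: measurableT_comp => //; apply: measurable_funB => //; exact: mg.
    by apply: measurableT_comp => //; apply: measurable_funB => //; exact: mg'.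
  move=> x _; rewrite lee_fin (le_trans _ (_ : `|h (gmul G x (ginv G y)) - h x| <= _))//; last first.
    by rewrite lerDl.
  (* Taking positive parts is 1-Lipschitz, so the modulus of continuity of the density does not
     increase. *)
  rewrite /ginv; move: (h (gmul G x (- y))) (h x) => s t.
  have h1 := ler_norm (s - t); have h2 := ler_norm (t - s); rewrite distrC in h2.
  by case: (leP s 0) => s0; case: (leP t 0) => t0; rewrite ler_norml; apply/andP; split; lra.
have [od|ev] := boolP (odd j).
  exists j.+1./2; have -> : (j.+1./2.*2 = j.+1)%N by rewrite -[RHS]odd_double_half /= od.
  rewrite (_ : word G mu j.+1 = fun f => T1 G mu (word G mu j f)).
    by apply: (regular_T1 mub) => // f; exact: (bsupp_word _ mub).
  by apply/funext => f /=; rewrite od.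
exists j./2; have -> // : (j./2.*2 = j)%N.
by rewrite -[RHS]odd_double_half (negbTE ev).
Qed.

End Curvature.

(** The integral of a nonnegative function is a supremum over the simple functions below it, hence
    monotone without any measurability. This lets the lacunary maximal function be compared directly
    with its windows. *)
Lemma ge0_le_integral_sup d (T : measurableType d) (R : realType)
    (m : {measure set T -> \bar R}) (f g : T -> \bar R) :
  (forall x, 0 <= f x)%E -> (forall x, f x <= g x)%E ->
  (\int[m]_x f x <= \int[m]_x g x)%E.
Proof.
move=> f0 fg; have g0 x : (0 <= g x)%E := le_trans (f0 x) (fg x).
rewrite !ge0_integralE// !patch_setT; apply: le_ereal_sup => _ [h hf <-].
by exists h => // x; exact: le_trans (hf x) (fg x).
Qed.

Lemma integ_EFin (R : realType) (n : nat) (f : 'rV[R]_n -> R) : bsupp f ->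
  ((integ f)%:E = \int[@lebesgue R n]_x (f x)%:E)%E.
Proof.
move=> bf; rewrite /integ /Rintegral fineK//.
by apply: integrable_fin_num => //; exact: bsupp_integrable.
Qed.

Lemma int_shift (k : int) (N0 : nat) :
  exists2 i : nat, (i <= (N0 + `|k|).*2)%N & k = i%:Z - (N0 + `|k|)%N%:Z.
Proof.
exists (absz (k + (N0 + `|k|)%N%:Z)%R); last lia.
by rewrite -muln2; lia.
Qed.

(** * From finite windows of scales to the lacunary maximal function *)

Section Lacunary.
Context {R : realType} {n : nat} (G : homogeneousGroup R n) (qn : quasiNorm G).
Notation V := 'rV[R]_n.
Notation lam := (@lebesgue R n).
Variables (mu : {finite_measure set V -> \bar R}) (a b alpha p : R).
Hypotheses (a_gt0 : 0 < a) (mub : mu (~` norm_ball b) = 0%E)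
  (mua : mu (~` [set y | a <= `|y| <= b]) = 0%E) (alpha_lt0 : alpha < 0) (p_gt1 : 1 < p)
  (mu_CA : curvature_assumption qn mu).
Implicit Types (x y z : V) (f g : V -> R).

Notation q := (symq qn).
Notation wt := (wgt q alpha).

Let p0 : 0 < p. Proof. exact: lt_trans p_gt1. Qed.

Lemma average_dilate (r : R) f x : bsupp f -> average G (dilate G mu r) f x = Tr G mu r f x.
Proof.
move=> bf; rewrite /average /dilate /Tr /Op -dlE.
have mf : measurable_fun setT (fun y => f (gmul G x (- y))).
  apply: (measurableT_comp (bsupp_measurable bf)).
  by apply: measurable_fun_gmul => //; exact: measurable_oppV.
rewrite (@Rintegral_pushforward _ _ _ _ _ mu (dl G r) (fun y => f (gmul G x (- y))))//.
  exact: measurable_dl.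
exact: (Op_integrable G mu x (adm_dl G b r) bf).
Qed.

Lemma wgt_le x : wt x <= qn x `^ alpha.
Proof.
rewrite /wgt; have [->|x0] := eqVneq x 0; first by rewrite !qnorm0.
apply: (powR_anti alpha_lt0); last exact: le_symq.
exact: qnorm_gt0.
Qed.

Lemma le_wgt : exists2 C : R, 0 < C & forall x, qn x `^ alpha <= C * wt x.
Proof.
have [C C0 hC] := symq_le qn; exists (C^-1 `^ alpha); first by rewrite powR_gt0// invr_gt0.
move=> x; have [->|x0] := eqVneq x 0.
  by rewrite wgt0// qnorm0 powR0 ?lt_eqF// mulr0.
have qx := qnorm_gt0 q x0.
rewrite /wgt -powRM ?invr_ge0 ?(ltW C0) ?(ltW qx)//.
apply: (powR_anti alpha_lt0); first by rewrite mulr_gt0// invr_gt0.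
by rewrite ler_pdivrMl.
Qed.

Section Windows.
Variable f : V -> R.
Hypotheses (ccf : Cc f).
Let g x := `|f x|.
Let bg : bsupp g := bsupp_Cc (Cc_abs ccf).
Let g0 x : 0 <= g x. Proof. exact: normr_ge0. Qed.

Definition th (N : nat) : R := 2 ^- N.

Lemma th_gt0 N : 0 < th N.
Proof. by rewrite invr_gt0 exprn_gt0. Qed.

(* [2^k] with [-N <= k <= N] is [sl (th N) i] with [i <= 2 N]. *)
Definition window (N : nat) x : R :=
  maxT (fun i : nat => Tr G mu (sl (th N) i)) N.*2 g x `^ p * wD q alpha (th N) N.*2 x.

Lemma window_ge0 N x : 0 <= window N x.
Proof. by rewrite mulr_ge0 ?powR_ge0 ?wD_ge0. Qed.

Lemma bsupp_window N : bsupp (window N).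
Proof.
apply: (bsupp_wD q alpha_lt0 _ (th_gt0 N)).
exact: (bsupp_maxT_powR G mub p_gt1 (th N) N.*2 bg).
Qed.

Lemma slS N i : sl (th N) i = sl (th N.+1) i.+1.
Proof. by rewrite /sl /th !exprS invfM; field; rewrite expf_neq0. Qed.

Lemma slE N i : sl (th N) i = 2 ^ (i%:Z - N%:Z).
Proof. by rewrite /sl /th expfzDr ?pnatr_eq0// mulrC -exprnN. Qed.

Lemma sl_top N : sl (th N) N.*2 = 2 ^+ N.
Proof. by rewrite /sl /th -addnn exprD mulKf// expf_neq0. Qed.

(** Enlarging N by one shifts the index of every scale by one, adds a scale at each end, and widens
    the range of x. *)
Lemma window_nd x : {homo window^~ x : M N / (M <= N)%N >-> M <= N}.
Proof.
apply/nondecreasing_seqP => N; rewrite /window.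
have h1 : maxT (fun i : nat => Tr G mu (sl (th N) i)) N.*2 g x <=
    maxT (fun i : nat => Tr G mu (sl (th N.+1) i)) N.+1.*2 g x.
  have [->|[i iN ->]] := maxT_cases (fun i : nat => Tr G mu (sl (th N) i)) N.*2 g x.
    exact: maxT_ge0.
  rewrite slS; apply: (maxT_ub (fun i : nat => Tr G mu (sl (th N.+1) i))).
  by rewrite doubleS ltnS (leq_trans iN).
apply: ler_pM; rewrite ?powR_ge0 ?wD_ge0//.
  by apply: ge0_ler_powR; rewrite ?nnegrE ?maxT_ge0 ?(ltW p0).
rewrite /wD ler_wpM2l ?wgt_ge0// ler_nat.
have e1 : th N.+1 <= th N.
  by rewrite /th lef_pV2 ?posrE ?exprn_gt0// ler_weXn2l// ler1n.
have e2 : sl (th N) N.*2 <= sl (th N.+1) N.+1.*2.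
  rewrite slS doubleS /sl ler_pM2l ?th_gt0// ler_weXn2l ?ler1n//.
case: (leP (th N) (q x)) => // h3; rewrite (le_trans e1 h3) /=.
by case: (ltP (q x) (sl (th N) N.*2)) => // h4; rewrite (lt_le_trans h4 e2).
Qed.

(** For each k some window contains both the scale 2^k and the shell of x. If the supremum of the
    windows at x is a finite s, every average at x is therefore at most [B] = (s / wt x)^(1/p). *)
Lemma lacunary_le (C : R) x : (forall x, qn x `^ alpha <= C * wt x) -> 0 < C ->
  (lacunary_maximal G mu f x `^ p * (qn x `^ alpha)%:E <=
   C%:E * ereal_sup (range (fun N => (window N x)%:E)))%E.
Proof.
move=> hC C0; set S := ereal_sup _.
have ubS N : ((window N x)%:E <= S)%E by apply: ereal_sup_ubound; exists N.
have S0 : (0 <= S)%E by apply: le_trans (ubS 0%N); rewrite lee_fin window_ge0.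
have [->|x0] := eqVneq x 0.
  by rewrite qnorm0 powR0 ?lt_eqF// mule0 mule_ge0// lee_fin ltW.
have qx := qnorm_gt0 q x0.
have wx : 0 < wt x by rewrite powR_gt0.
have [Sy|Sy] := eqVneq S +oo%E.
  by rewrite Sy gt0_muley ?lte_fin// leey.
have Sf : S \is a fin_num by rewrite ge0_fin_numE// ltey.
pose s := fine S; have SE : S = s%:E by rewrite fineK.
have s0 : 0 <= s by rewrite -lee_fin -SE.
rewrite SE; pose B := (s / wt x) `^ p^-1.
have lacB : (lacunary_maximal G mu f x <= B%:E)%E.
  apply: ge_ereal_sup => _ [k _ <-]; rewrite lee_fin.
  have [N0 hN0] : exists N0 : nat, th N0 <= q x < sl (th N0) N0.*2.
    have h0 : 0 <= 2^-1 :> R by rewrite invr_ge0.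
    have h1 : 2^-1 < 1 :> R by rewrite invf_lt1// ltr1n.
    have [N1 hN1] := small_expr h0 h1 qx.
    have qxi : 0 < (q x)^-1 by rewrite invr_gt0.
    have [N2 hN2] := small_expr h0 h1 qxi.
    exists (N1 + N2)%N; apply/andP; split.
      rewrite (le_trans _ (ltW hN1))// /th -exprVn exprD ler_piMr ?exprn_ge0//.
      by rewrite exprn_ile1// ltW.
    rewrite sl_top.
    move: hN2; rewrite exprVn ltf_pV2 ?posrE ?exprn_gt0// => hN2.
    by rewrite (lt_le_trans hN2)// ler_weXn2l ?ler1n// leq_addl.
  pose N := (N0 + `|k|)%N.
  have hN : th N <= q x < sl (th N) N.*2.
    have /andP[h1 h2] := hN0; apply/andP; split.
      by rewrite (le_trans _ h1)// /th lef_pV2 ?posrE ?exprn_gt0// ler_weXn2l ?ler1n// leq_addr.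
    by rewrite (lt_le_trans h2)// !sl_top ler_weXn2l ?ler1n// leq_addr.
  have [i iN ik] : exists2 i : nat, (i <= N.*2)%N & k = i%:Z - N%:Z.
    exact: int_shift.
  rewrite average_dilate; last exact: bsupp_Cc.
  apply: (@le_trans _ _ (Tr G mu (2 ^ k) g x)).
    exact: (Op_abs G mu x (adm_dl G b (2 ^ k)) (bsupp_Cc ccf)).
  rewrite ik -slE.
  apply: (le_trans (maxT_ub (fun i : nat => Tr G mu (sl (th N) i)) g x iN)).
  rewrite /B -[leLHS]powRr1 ?maxT_ge0// -(mulfV (x := p)) ?gt_eqF// powRrM.
  apply: ge0_ler_powR; rewrite ?nnegrE ?invr_ge0 ?(ltW p0) ?powR_ge0 ?divr_ge0 ?(ltW wx)//.
  rewrite ler_pdivlMr//.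
  have := ubS N; rewrite SE lee_fin /window /wD hN mulr1; exact.
have lac0 : (0 <= lacunary_maximal G mu f x)%E.
  apply: le_trans (_ : (`|average G (dilate G mu (2 ^ (0 : int))) f x|%:E <= _)%E); first by rewrite lee_fin.
  by apply: ereal_sup_ubound; exists 0.
apply: (@le_trans _ _ (B%:E `^ p * (qn x `^ alpha)%:E)%E).
  apply: lee_wpmul2r; first by rewrite lee_fin powR_ge0.
  apply: gt0_ler_poweR; rewrite ?(ltW p0)// in_itv/= ?leey ?andbT//.
  by rewrite lee_fin powR_ge0.
rewrite poweR_EFin -EFinM -EFinM lee_fin /B -powRrM mulVf ?gt_eqF// powRr1 ?divr_ge0 ?(ltW wx)//.
by rewrite mulrAC ler_pdivrMr// mulrC mulrAC ler_wpM2r.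
Qed.

End Windows.

Hypothesis lam0 : lam [set 0] = 0%E.

Lemma weighted_lacunary (C : R) :
  (forall (k : int) f, Cc f ->
      (\int[lam]_x (`|average G (dilate G mu (2 ^ k)) f x| `^ p * qn x `^ alpha)%:E
       <= C%:E * \int[lam]_x (`|f x| `^ p * qn x `^ alpha)%:E)%E) ->
  exists C' : R, forall f, Cc f ->
    (\int[lam]_x (lacunary_maximal G mu f x `^ p * (qn x `^ alpha)%:E)
     <= C'%:E * \int[lam]_x (`|f x| `^ p * qn x `^ alpha)%:E)%E.
Proof.
move=> single.
have qN := symqN qn; have [Cw Cw0 hCw] := le_wgt.
have [j reg] := curvature_regular qN (le_symq qn) mub mu_CA.
have [Cu Cu0 hCu] := lacunary_unweighted qN mub reg p_gt1.
have [A A0 hA] := qnorm_lb q b a_gt0.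
have [B B0 hB] := qnorm_ub q b.
have AB y : a <= `|y| <= b -> A <= q y <= B.
  by move=> yab; rewrite hA// hB//; case/andP: yab.
have [L hL] : exists L : nat, 4 * ctri q / A + 2 <= 2 ^+ L.
  have h0 : 0 <= 2^-1 :> R by rewrite invr_ge0.
  have h1 : 2^-1 < 1 :> R by rewrite invf_lt1// ltr1n.
  have h2 : 0 < 4 * ctri q / A + 2 by rewrite addr_gt0// divr_gt0// mulr_gt0// ctri_gt0.
  have h3 : 0 < (4 * ctri q / A + 2)^-1 by rewrite invr_gt0.
  have [L hL] := small_expr h0 h1 h3; exists L.
  by move: hL; rewrite exprVn ltf_pV2 ?posrE ?exprn_gt0// => /ltW.
(* The given constant carries no sign, hence the absolute value; [Cw] converts the original weight
   into that of the symmetric quasi-norm. The opposite conversion is free by [wgt_le]. *)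
pose C1 := `|C| * Cw.
have C10 : 0 <= C1 by rewrite mulr_ge0// ltW.
pose C4 := (Cu * (near_const q L B)^-1 `^ alpha +
  C1 * inner q A `^ alpha * (2 * outer q B)^-1 `^ alpha) / (1 - 2 `^ alpha).
exists (Cw * C4) => f ccf; pose g x := `|f x|.
have bg : bsupp g := bsupp_Cc (Cc_abs ccf).
have g0 x : 0 <= g x by exact: normr_ge0.
have est N : ((integ (window f N))%:E <= C4%:E * \int[lam]_x (`|f x| `^ p * wt x)%:E)%E.
  have t0 := th_gt0 N.
  apply: (weighted_estimate qN mub mua alpha_lt0 p_gt1 t0 A0 B0 Cu0 C10 AB hL hCu bg g0) => // i iN.
  have bfar := bsupp_far q (th N) A B bg i.
  have bT := bsupp_Tr G mub (sl (th N) i) bfar.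
  have far0 x : 0 <= far q (th N) A B g i x by exact: far_ge0.
  have T0 x : 0 <= Tr G mu (sl (th N) i) (far q (th N) A B g i) x by exact: Op_ge0.
  have ccfar : Cc (far q (th N) A B g i).
    apply: Cc_mul; first exact: Cc_abs.
    have cs : continuous (fun t : R^o => t / sl (th N) i : R^o).
      by move=> t; apply: cvgM; [exact: cvg_id|exact: cvg_cst].
    move=> x; apply: (@continuous_comp _ _ _ (q : V -> R^o) (fun t : R^o => cutoff (inner q A) (outer q B) (t / sl (th N) i) : R^o)).
      exact: qnorm_continuous.
    apply: (@continuous_comp _ _ _ (fun t : R^o => t / sl (th N) i : R^o) (cutoff (inner q A) (outer q B) : R^o -> R^o)); first exact: cs.
    exact: cutoff_continuous.
  have bw := bsupp_far_wgt q alpha_lt0 p_gt1 t0 A0 B0 bg g0 i.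
  have bTw := bsupp_wD q alpha_lt0 N.*2 t0 (bsupp_powR p0 bT T0).
  rewrite -lee_fin EFinM (integ_EFin bTw) (integ_EFin bw).
  (* The single-scale hypothesis is about to be used with k = i - N on the far part of |f|, which
     lies in C_c because the cutoff is continuous. *)
  apply: (@le_trans _ _ (\int[lam]_x (`|average G (dilate G mu (2 ^ (i%:Z - N%:Z)))
      (far q (th N) A B g i) x| `^ p * qn x `^ alpha)%:E)%E).
    apply: ge0_le_integral_sup => x; rewrite lee_fin.
      by rewrite mulr_ge0 ?powR_ge0 ?wD_ge0.
    rewrite average_dilate// -slE ger0_norm// ler_wpM2l ?powR_ge0//.
    apply: le_trans (wgt_le x); rewrite /wD ler_piMr ?wgt_ge0//.
    by case: (_ && _).
  apply: (le_trans (single _ _ ccfar)).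
  apply: (@le_trans _ _ (`|C|%:E * \int[lam]_x (Cw%:E * (far q (th N) A B g i x `^ p * wt x)%:E))%E).
    apply: (@le_trans _ _ (`|C|%:E * \int[lam]_x (`|far q (th N) A B g i x| `^ p * qn x `^ alpha)%:E)%E).
      apply: lee_wpmul2r; last by rewrite lee_fin ler_norm.
      by apply: integral_ge0 => x _; rewrite lee_fin mulr_ge0 ?powR_ge0.
    apply: lee_wpmul2l; first by rewrite lee_fin.
    apply: ge0_le_integral_sup => x; first by rewrite lee_fin mulr_ge0 ?powR_ge0.
    rewrite -EFinM lee_fin ger0_norm//.
    apply: le_trans (ler_wpM2l (powR_ge0 _ _) (hCw x)) _.
    by rewrite mulrCA.
  rewrite ge0_integralZl//; last 3 first.
  - by apply/measurable_EFinP; exact: bsupp_measurable bw.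
  - by move=> x _; rewrite lee_fin mulr_ge0 ?powR_ge0.
  - by rewrite lee_fin ltW.
  by rewrite muleA -EFinM.
have C40 : 0 <= C4.
  apply: divr_ge0.
    apply: addr_ge0; first by apply: mulr_ge0; [exact: Cu0|exact: powR_ge0].
    by apply: mulr_ge0; [apply: mulr_ge0; [exact: C10|exact: powR_ge0]|exact: powR_ge0].
  rewrite subr_ge0 -[alpha]opprK powRN invf_le1 ?powR_gt0//.
  by apply: powR_ge1; [rewrite ler1n|rewrite oppr_ge0 ltW].
apply: (@le_trans _ _ (\int[lam]_x (Cw%:E * limn (fun N => (window f N x)%:E)))%E).
  apply: ge0_le_integral_sup => x.
    by rewrite mule_ge0 ?poweR_ge0// lee_fin powR_ge0.
  have nd : nondecreasing_seq (fun N => (window f N x)%:E).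
    by move=> M N MN; rewrite lee_fin; exact: window_nd.
  rewrite (cvg_lim _ (ereal_nondecreasing_cvgn nd))//.
  exact: lacunary_le.
have mwin N : measurable_fun setT (fun x => (window f N x)%:E).
  by apply/measurable_EFinP; exact: bsupp_measurable (bsupp_window _ _).
have lim0 x : (0 <= limn (fun N => (window f N x)%:E))%E.
  apply: lime_ge; last by near=> N; rewrite lee_fin window_ge0.
  apply: ereal_nondecreasing_is_cvgn => M N MN; rewrite lee_fin; exact: window_nd.
rewrite ge0_integralZl//; last 2 first.
- apply: (emeasurable_fun_cvg (fun N x => (window f N x)%:E)) => // x _.
  by apply: ereal_nondecreasing_is_cvgn => M N MN; rewrite lee_fin; exact: window_nd.
- by rewrite lee_fin ltW.
rewrite EFinM -muleA lee_pmul2l ?lte_fin//.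
rewrite monotone_convergence//; last 2 first.
- by move=> N x _; rewrite lee_fin window_ge0.
- by move=> x _ M N MN; rewrite lee_fin; exact: window_nd.
apply: (@le_trans _ _ (C4%:E * \int[lam]_x (`|f x| `^ p * wt x)%:E)%E).
  apply: lime_le.
    apply: ereal_nondecreasing_is_cvgn => M N MN; apply: ge0_le_integral_sup => x.
      by rewrite lee_fin window_ge0.
    by rewrite lee_fin; exact: window_nd.
  by near=> N; rewrite -integ_EFin; [exact: est|exact: bsupp_window].
apply: lee_wpmul2l; first by rewrite lee_fin.
apply: ge0_le_integral_sup => x; rewrite lee_fin.
  by rewrite mulr_ge0 ?powR_ge0.
by rewrite ler_wpM2l ?powR_ge0// wgt_le.
Unshelve. all: by end_near. Qed.

End Lacunary.

Unset Implicit Arguments.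
Set Strict Implicit.

Theorem theorem1p3 (R : realType) (n : nat) (G : homogeneousGroup R n)
    (qn : quasiNorm G) (mu : {finite_measure set 'rV[R]_n -> \bar R})
    (mu_compact : compact (msupport mu))
    (mu_away0 : ~ msupport mu 0)
    (mu_CA : curvature_assumption qn mu)
    (alpha p : R) (alpha_lt0 : alpha < 0) (p_gt1 : 1 < p)
    (single_scale : exists C : R, forall (k : int) (f : 'rV[R]_n -> R), Cc f ->
      (\int[@lebesgue R n]_x
          (`|average G (dilate G mu (2 ^ k)) f x| `^ p * qn x `^ alpha)%:E
       <= C%:E * \int[@lebesgue R n]_x (`|f x| `^ p * qn x `^ alpha)%:E)%E) :
  exists C' : R, forall f : 'rV[R]_n -> R, Cc f ->
    (\int[@lebesgue R n]_x
        (lacunary_maximal G mu f x `^ p * (qn x `^ alpha)%:E)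
     <= C'%:E * \int[@lebesgue R n]_x (`|f x| `^ p * qn x `^ alpha)%:E)%E.
Proof.
have [C hC] := single_scale.
have [a [b [a0 mua]]] := mu_annulus mu_compact mu_away0.
have mub : mu (~` norm_ball b) = 0%E.
  apply: (subset_measure0 _ _ _ mua).
  - by apply: measurableC; exact: measurable_norm_ball.
  - by apply: measurableC; exact: measurable_annulus.
  - by move=> y /= hy hy'; apply: hy; case/andP: hy'.
(* In dimension 0 the measure is the Dirac mass at 0, so the point 0 is not null; there every x is
   0, the weight vanishes by convention, and both integrals are 0. *)
case: n G qn mu mu_compact mu_away0 mu_CA single_scale hC mua mub =>
    [|m] G qn mu _ _ mu_CA _ hC mua mub.
  exists 0 => f _; rewrite mul0e integral0_eq// => x _.
  by rewrite (thinmx0 x) qnorm0 powR0 ?lt_eqF// mule0.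
exact: (weighted_lacunary a0 mub mua alpha_lt0 p_gt1 mu_CA (lebesgue_set1 R m) hC).
Qed.
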